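(* Let $H,G:\mathbb{T}^n\times\mathbb{R}^n\to\mathbb{R}$ be two commuting Hamiltonians, i.e. $\{H,G\}=0$ in $\mathbb{T}^n\times\mathbb{R}^n$, such that both $H$ and $-G$ are Tonelli. Let $u_0:\mathbb{T}^n\to\mathbb{R}$ be Lipschitz. Then there exists a viscosity solution $u(t,s,x)$ of the multi-time Hamilton--Jacobi equation $$ \begin{cases} \partial_t u+H(x,D_xu)=0 & \text{in }(0,+\infty)\times(0,+\infty)\times\mathbb{T}^n,\\ \partial_s u+G(x,D_xu)=0 & \text{in }(0,+\infty)\times(0,+\infty)\times\mathbb{T}^n,\\ u(0,0,x)=u_0(x) & \text{on }\mathbb{T}^n, \end{cases} $$ if and only if $u_0$ is $C^{1,1}$ and the graph of its differential, $\{(x,D_xu_0):x\in\mathbb{T}^n\}\subset\mathbb{T}^n\times\mathbb{R}^n$, is invariant by both the Hamiltonian flows of $H$ and $G$. Moreover, in this case, there are two constants $c_H,c_G\in\mathbb{R}$ such that $$H(x,D_xu_0)=c_H\quad\text{and}\quad G(x,D_xu_0)=c_G\qquad\text{for every }x\in\mathbb{T}^n,$$ which means that $$S^t_H\circ S^s_G u_0=S^s_G\circ S^t_H u_0=u_0-t\,c_H-s\,c_G\qquad\text{for every }s,t>0.$$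
   Context: $\mathbb{T}^n$ is the flat $n$-dimensional torus, with cotangent bundle $\mathbb{T}^n\times\mathbb{R}^n$. A Hamiltonian is a continuous function on $\mathbb{T}^n\times\mathbb{R}^n$. A Hamiltonian $H$ is Tonelli if it is of class $C^2$, $H(x,p)/|p|\to+\infty$ as $|p|\to\infty$, and $\partial^2_{pp}H$ is everywhere positive definite as a quadratic form. The Poisson bracket is $\{H,G\}:=\partial_pH\cdot\partial_xG-\partial_pG\cdot\partial_xH$. The Hamiltonian flow of $H$ is the flow of the vector field $X_H(x,p)=(\partial_pH(x,p),-\partial_xH(x,p))$ on $\mathbb{T}^n\times\mathbb{R}^n$ (and similarly for $G$). A function is $C^{1,1}$ if it is $C^1$ with Lipschitz derivative. Viscosity solutions: a continuous function $u$ on an open set is a viscosity subsolution (resp. supersolution) of $\partial_tu+H(x,D_xu)=0$ if for every $C^1$ function $\varphi$ such that $u-\varphi$ has a local maximum (resp. local minimum) at a point of the open set, one has $\partial_t\varphi+H(x,D_x\varphi)\le0$ (resp. $\ge0$) at that point; it is a viscosity solution if it is both. The same definition applies to $\partial_su+G(x,D_xu)=0$. A viscosity solution of the multi-time equation is a continuous function on $[0,+\infty)\times[0,+\infty)\times\mathbb{T}^n$ that is a viscosity solution of both equations in $(0,+\infty)\times(0,+\infty)\times\mathbb{T}^n$ and satisfies the initial condition. For a Hamiltonian $K$ such that $K$ or $-K$ is Tonelli and a Lipschitz function $w:\mathbb{T}^n\to\mathbb{R}$, $S^t_Kw(x)$ denotes the value at $(t,x)$ of the unique Lipschitz viscosity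 solution on $[0,+\infty)\times\mathbb{T}^n$ of $\partial_tu+K(x,D_xu)=0$ in $(0,+\infty)\times\mathbb{T}^n$ with $u(0,\cdot)=w$. *)

(* Defs.v *)
From HB Require Import structures.
From mathcomp Require Import all_boot all_order all_algebra.
From mathcomp Require Import all_classical all_reals all_analysis.
Import Order.TTheory GRing.Theory Num.Theory.
Import numFieldNormedType.Exports.

Set Implicit Arguments.
Unset Strict Implicit.
Unset Printing Implicit Defensive.

Local Open Scope classical_set_scope.
Local Open Scope ring_scope.

(* A function on the torus R^n / Z^n is represented by its Z^n-periodic lift to
   R^n, so T^n x R^n is represented by pairs (x, p) with periodicity in x.
   The norm on 'rV[R]_n is the sup norm; it only enters through Lipschitz and
   growth conditions, which do not depend on the choice of the norm. *)
Definition Zn_periodic (R : realType) (n : nat) (W : Type)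
    (f : 'rV[R]_n -> W) : Prop :=
  forall (x : 'rV[R]_n) (k : 'rV[int]_n), f (x + map_mx intr k) = f x.

Definition dotp (R : realType) (n : nat) (v w : 'rV[R]_n) : R :=
  \sum_(i < n) v 0 i * w 0 i.

Definition grad (R : realType) (n : nat) (f : 'rV[R]_n -> R)
    (x : 'rV[R]_n) : 'rV[R]_n :=
  \row_(i < n) 'D_(delta_mx 0 i) f x.

(* On a finite-dimensional space V, continuity of all the directional
   derivatives is continuity of the differential. *)
Definition C1_on (R : realType) (V W : normedModType R) (A : set V)
    (f : V -> W) : Prop :=
  (forall z, A z -> differentiable f z) /\
  (forall v z, A z -> {for z, continuous ('D_v f)}).

Definition C1 (R : realType) (V W : normedModType R) (f : V -> W) : Prop :=
  C1_on setT f.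

Definition C2 (R : realType) (V W : normedModType R) (f : V -> W) : Prop :=
  C1 f /\ forall v, C1 ('D_v f).

Definition C11 (R : realType) (n : nat) (f : 'rV[R]_n -> R) : Prop :=
  C1 f /\ lipschitz (grad f).

Definition hamiltonian (R : realType) (n : nat)
    (H : 'rV[R]_n * 'rV[R]_n -> R) : Prop :=
  continuous H /\ forall p, Zn_periodic (fun x => H (x, p)).

Definition Dx (R : realType) (n : nat) (H : 'rV[R]_n * 'rV[R]_n -> R)
    (z : 'rV[R]_n * 'rV[R]_n) : 'rV[R]_n :=
  grad (fun x => H (x, z.2)) z.1.

Definition Dp (R : realType) (n : nat) (H : 'rV[R]_n * 'rV[R]_n -> R)
    (z : 'rV[R]_n * 'rV[R]_n) : 'rV[R]_n :=
  grad (fun p => H (z.1, p)) z.2.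

Definition Dpp (R : realType) (n : nat) (H : 'rV[R]_n * 'rV[R]_n -> R)
    (z : 'rV[R]_n * 'rV[R]_n) : 'M[R]_n :=
  \matrix_(i < n, j < n) 'D_(delta_mx 0 i) (fun p => Dp H (z.1, p) 0 j) z.2.

(* For a C^2 function that is convex in p, superlinearity at each x is
   automatically uniform in x, by compactness of the torus. *)
Definition tonelli (R : realType) (n : nat)
    (H : 'rV[R]_n * 'rV[R]_n -> R) : Prop :=
  [/\ C2 H,
      forall (x : 'rV[R]_n) (A : R), exists M : R,
        forall p : 'rV[R]_n, M < `|p| -> A < H (x, p) / `|p| &
      forall (z : 'rV[R]_n * 'rV[R]_n) (q : 'rV[R]_n), q != 0 ->
        0 < dotp (q *m Dpp H z) q].

Definition poisson (R : realType) (n : nat)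
    (H G : 'rV[R]_n * 'rV[R]_n -> R) (z : 'rV[R]_n * 'rV[R]_n) : R :=
  dotp (Dp H z) (Dx G z) - dotp (Dp G z) (Dx H z).

Definition ham_field (R : realType) (n : nat)
    (H : 'rV[R]_n * 'rV[R]_n -> R) (z : 'rV[R]_n * 'rV[R]_n) :
    'rV[R]_n * 'rV[R]_n :=
  (Dp H z, - Dx H z).

(* [flow X t z] is the value at time t of the integral curve of X through z.
   If H or -H is Tonelli, then [ham_field H] is C^1 and complete, the energy
   levels being compact modulo Z^n, so that this curve exists and is unique. *)
Definition flow (R : realType) (V : normedModType R) (X : V -> V)
    (t : R) (z : V) : V :=
  get [set c : R -> V |
    c 0 = z /\ forall s : R, is_derive s (1 : R) c (X (c s))] t.

Definition flow_invariant (R : realType) (V : normedModType R) (X : V -> V)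
    (A : set V) : Prop :=
  forall t : R, flow X t @` A `<=` A.

Definition grad_graph (R : realType) (n : nat) (f : 'rV[R]_n -> R) :
    set ('rV[R]_n * 'rV[R]_n) :=
  [set (x, grad f x) | x in setT].

Definition local_max (R : realType) (V : topologicalType) (f : V -> R)
    (z : V) : Prop :=
  \forall w \near z, f w <= f z.

Definition local_min (R : realType) (V : topologicalType) (f : V -> R)
    (z : V) : Prop :=
  \forall w \near z, f z <= f w.

(* The next definitions concern functions on O x T^n, where O is an open subset
   of a space T of time variables, and the equation
     d_e u + K(x, D_x u) = 0
   where d_e is the derivative in the direction e of T: for T = R and e = 1
   this is the usual time derivative, and for T = R * R the directions (1, 0)
   and (0, 1) give d_t and d_s. The values of the functions outside of O x T^n
   are irrelevant. *)
Definition test_function (R : realType) (T : normedModType R) (n : nat)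
    (O : set T) (phi : T * 'rV[R]_n -> R) : Prop :=
  C1_on (O `*` setT) phi /\
  forall t, O t -> Zn_periodic (fun x => phi (t, x)).

Definition HJ_lhs (R : realType) (T : normedModType R) (n : nat) (e : T)
    (K : 'rV[R]_n * 'rV[R]_n -> R) (phi : T * 'rV[R]_n -> R)
    (z : T * 'rV[R]_n) : R :=
  'D_e (fun t => phi (t, z.2)) z.1
  + K (z.2, grad (fun x => phi (z.1, x)) z.2).

Definition viscosity_subsolution (R : realType) (T : normedModType R)
    (n : nat) (O : set T) (e : T) (K : 'rV[R]_n * 'rV[R]_n -> R)
    (u : T * 'rV[R]_n -> R) : Prop :=
  forall phi, test_function O phi -> forall z, O z.1 ->
    local_max (fun w => u w - phi w) z -> HJ_lhs e K phi z <= 0.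

Definition viscosity_supersolution (R : realType) (T : normedModType R)
    (n : nat) (O : set T) (e : T) (K : 'rV[R]_n * 'rV[R]_n -> R)
    (u : T * 'rV[R]_n -> R) : Prop :=
  forall phi, test_function O phi -> forall z, O z.1 ->
    local_min (fun w => u w - phi w) z -> 0 <= HJ_lhs e K phi z.

Definition viscosity_solution (R : realType) (T : normedModType R)
    (n : nat) (O : set T) (e : T) (K : 'rV[R]_n * 'rV[R]_n -> R)
    (u : T * 'rV[R]_n -> R) : Prop :=
  [/\ forall t, O t -> Zn_periodic (fun x => u (t, x)),
      {within O `*` setT, continuous u},
      viscosity_subsolution O e K u &
      viscosity_supersolution O e K u].

Definition multitime_solution (R : realType) (n : nat)
    (H G : 'rV[R]_n * 'rV[R]_n -> R) (u0 : 'rV[R]_n -> R)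
    (u : (R * R) * 'rV[R]_n -> R) : Prop :=
  let Q : set (R * R) := [set t | 0 < t.1 /\ 0 < t.2] in
  let Qbar : set (R * R) := [set t | 0 <= t.1 /\ 0 <= t.2] in
  [/\ (forall t, Qbar t -> Zn_periodic (fun x => u (t, x))),
      {within Qbar `*` setT, continuous u},
      viscosity_solution Q (1, 0) H u,
      viscosity_solution Q (0, 1) G u &
      forall x, u ((0, 0), x) = u0 x].

Definition cauchy_solution (R : realType) (n : nat)
    (K : 'rV[R]_n * 'rV[R]_n -> R) (w : 'rV[R]_n -> R)
    (u : R * 'rV[R]_n -> R) : Prop :=
  [/\ (forall t, 0 <= t -> Zn_periodic (fun x => u (t, x))),
      [lipschitz u z | z in [set t : R | 0 <= t] `*` setT],
      viscosity_solution [set t : R | 0 < t] 1 K u &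
      forall x, u (0, x) = w x].

(* If K or -K is Tonelli and w is Lipschitz, there is a [cauchy_solution K w],
   and any two of them coincide for nonnegative times. *)
Definition semigroup (R : realType) (n : nat)
    (K : 'rV[R]_n * 'rV[R]_n -> R) (t : R) (w : 'rV[R]_n -> R) :
    'rV[R]_n -> R :=
  fun x => get (cauchy_solution K w) (t, x).

(* Main.v *)
(* Since [- G] is Tonelli, for a solution [u] the function [- u] solves in [s] the equation of
   the Tonelli Hamiltonian [- G (x, - p)]. At positive times [u] is therefore semiconcave in
   [x] by the first equation and semiconvex by the second one, hence C^{1,1} in [x].
   Let now [v] solve [d_t v + K (x, D_x v) = 0] with [K] Tonelli and [v] C^{1,1} in [x]. The
   maximum and the minimum over [x] of [v (t + h) - v t] do not depend on [t]: at an extremal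
   point both times have the same gradient, hence the same time derivative. By convexity of
   [K], [v] is asymptotically concave in time, so the gap between this maximum and this minimum
   at least doubles with [h]; it is bounded by the oscillation of [v] in space, hence it
   vanishes. So [K (x, D_x v)] is constant and [v] is affine in time. Applied to [u] in [t] and
   to [- u] in [s], as the times tend to 0, this gives the regularity of [u0] and the constant
   energies, which make the graph of [D u0] invariant. Conversely, the energies are constant on
   an invariant graph, and then [u0 - t cH - s cG] is a classical solution. *)
Require Import Defs.
From HB Require Import structures.
From mathcomp Require Import all_boot all_order all_algebra.
From mathcomp Require Import all_classical all_reals all_analysis.
From mathcomp Require Import ring lra.
Import Order.TTheory GRing.Theory Num.Theory.
Import numFieldNormedType.Exports.
Set Implicit Arguments.
Unset Strict Implicit.
Unset Printing Implicit Defensive.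
Local Open Scope classical_set_scope.
Local Open Scope ring_scope.

(** Up to the rigidity, everything is drawn from viscosity inequalities by doubling or tripling
    variables, with no representation of solutions by minimizing curves. The functions touching the
    solution are then quadratic, so the equations are first rewritten with explicit quadratic jets,
    on each slice where one time is frozen, the value 0 included; the obstacle there is that test
    functions are periodic and live over the open quadrant. [tame] collects derivative-free
    consequences of the Tonelli conditions that are stable under [p -> - p], so that both equations
    go through the same lemmas. Concavity in time comes from comparing [v] with its dilations
    [v ((1 + e) t)] and [v ((1 - e) t)]. For the flows the obstacle is that [D u0] is merely
    Lipschitz and cannot be differentiated along a Hamiltonian curve: increments of [u0] and of the
    Hamiltonian between nearby points replace its derivatives. *)

Section DotProduct.
Context {R : realType} {n : nat}.
Implicit Types u v w : 'rV[R]_n.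

(** The norm of row vectors is the sup norm, whose square is not smooth; penalizations and jets use
    this Euclidean square, whose expansion [sqnD] is exact. *)
Definition sqn v : R := dotp v v.

Lemma dotpC v w : dotp v w = dotp w v.
Proof. by apply: eq_bigr => i _; rewrite mulrC. Qed.

Lemma dotpDl u v w : dotp (u + v) w = dotp u w + dotp v w.
Proof. by rewrite /dotp -big_split; apply: eq_bigr => i _; rewrite mxE mulrDl. Qed.

Lemma dotpDr u v w : dotp u (v + w) = dotp u v + dotp u w.
Proof. by rewrite dotpC dotpDl !(dotpC u). Qed.

Lemma dotpZl a v w : dotp (a *: v) w = a * dotp v w.
Proof. by rewrite /dotp mulr_sumr; apply: eq_bigr => i _; rewrite mxE mulrA. Qed.

Lemma dotpZr a v w : dotp v (a *: w) = a * dotp v w.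
Proof. by rewrite dotpC dotpZl dotpC. Qed.

Lemma dotpNl v w : dotp (- v) w = - dotp v w.
Proof. by rewrite -scaleN1r dotpZl mulN1r. Qed.

Lemma dotpNr v w : dotp v (- w) = - dotp v w.
Proof. by rewrite dotpC dotpNl dotpC. Qed.

Lemma dotp0l v : dotp 0 v = 0.
Proof. by rewrite /dotp big1// => i _; rewrite mxE mul0r. Qed.

Lemma dotp0r v : dotp v 0 = 0.
Proof. by rewrite dotpC dotp0l. Qed.

Lemma sqn_ge0 v : 0 <= sqn v.
Proof. by apply: sumr_ge0 => i _; rewrite -expr2 sqr_ge0. Qed.

Lemma sqnD v w : sqn (v + w) = sqn v + 2 * dotp v w + sqn w.
Proof. rewrite /sqn !dotpDl !dotpDr (dotpC w v); ring. Qed.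

Lemma sqnN v : sqn (- v) = sqn v.
Proof. by rewrite /sqn dotpNl dotpNr opprK. Qed.

Lemma sqnB v w : sqn (v - w) = sqn v - 2 * dotp v w + sqn w.
Proof. by rewrite sqnD sqnN dotpNr mulrN. Qed.

Lemma sqnC v w : sqn (v - w) = sqn (w - v).
Proof. by rewrite -sqnN opprB. Qed.

Lemma sqnZ a v : sqn (a *: v) = a ^+ 2 * sqn v.
Proof. by rewrite /sqn dotpZl dotpZr mulrA expr2. Qed.

Lemma sqn0 : sqn 0 = 0.
Proof. exact: dotp0l. Qed.

Lemma coord_le_norm v i : `|v 0 i| <= `|v|.
Proof.
rewrite [leRHS]/Num.Def.normr/= mx_normrE.
exact: (le_bigmax _ (fun ij : 'I_1 * 'I_n => `|v ij.1 ij.2|) (0, i)).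
Qed.

Lemma norm_le_coord v (c : R) : 0 <= c -> (forall i, `|v 0 i| <= c) -> `|v| <= c.
Proof.
move=> c0 h; rewrite [leLHS]/Num.Def.normr/= mx_normrE bigmax_le// => -[i j] _ /=.
by rewrite ord1.
Qed.

Lemma norm_sqn v : `|v| ^+ 2 <= sqn v.
Proof.
rewrite -[leRHS]sqr_sqrtr ?sqn_ge0// ler_pXn2r ?nnegrE ?sqrtr_ge0//.
apply: norm_le_coord; rewrite ?sqrtr_ge0// => i.
rewrite -sqrtr_sqr ler_wsqrtr// /sqn /dotp (bigD1 i)//= -expr2 lerDl.
by apply: sumr_ge0 => j _; rewrite -expr2 sqr_ge0.
Qed.

Lemma norm_le_sqrt_sqn v : `|v| <= Num.sqrt (sqn v).
Proof. by rewrite -(ler_pXn2r (n := 2))// ?nnegrE ?sqrtr_ge0// sqr_sqrtr ?sqn_ge0 ?norm_sqn. Qed.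

Lemma dotp_le_norm v w : `|dotp v w| <= n%:R * (`|v| * `|w|).
Proof.
apply: le_trans (ler_norm_sum _ _ _) _.
apply: (@le_trans _ _ (\sum_(i < n) `|v| * `|w|)).
  by apply: ler_sum => i _; rewrite normrM ler_pM ?coord_le_norm.
by rewrite sumr_const card_ord mulr_natl.
Qed.

Lemma sqn_le_norm v : sqn v <= n%:R * `|v| ^+ 2.
Proof. by rewrite expr2; apply: le_trans (dotp_le_norm v v); rewrite ler_norm. Qed.

Lemma sqn_le_bound v (c : R) : `|v| <= c -> sqn v <= n%:R * c ^+ 2.
Proof.
move=> vc; apply: le_trans (sqn_le_norm v) _.
by rewrite ler_wpM2l ?ler0n// lerXn2r ?nnegrE// (le_trans _ vc).
Qed.

Lemma sqn_gt0 v : v != 0 -> 0 < sqn v.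
Proof.
move=> v0; apply: lt_le_trans (norm_sqn v).
by rewrite exprn_gt0// normr_gt0.
Qed.

Lemma dotp_delta v i : dotp v (delta_mx 0 i) = v 0 i.
Proof.
rewrite /dotp (bigD1 i)//= mxE !eqxx mulr1 big1 ?addr0// => j ji.
by rewrite mxE (negbTE ji) andbF mulr0.
Qed.

Lemma norm_delta i : `|delta_mx 0 i : 'rV[R]_n| <= 1.
Proof.
apply: norm_le_coord => // j; rewrite mxE eqxx/=.
by case: eqP => _ /=; rewrite ?normr1 ?normr0.
Qed.

End DotProduct.

(** * Continuity of expressions written pointwise *)

Section ContinuityRules.
Context {R : realType}.

Lemma ctsD (T : topologicalType) (V : normedModType R) (f g : T -> V) :
  continuous f -> continuous g -> continuous (fun z => f z + g z).
Proof. by move=> cf cg z; apply: cvgD; [exact: cf|exact: cg]. Qed.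

Lemma ctsN (T : topologicalType) (V : normedModType R) (f : T -> V) :
  continuous f -> continuous (fun z => - f z).
Proof. by move=> cf z; apply: cvgN; exact: cf. Qed.

Lemma ctsB (T : topologicalType) (V : normedModType R) (f g : T -> V) :
  continuous f -> continuous g -> continuous (fun z => f z - g z).
Proof. by move=> cf cg; apply: ctsD => //; exact: ctsN. Qed.

Lemma ctsM (T : topologicalType) (f g : T -> R) :
  continuous f -> continuous g -> continuous (fun z => f z * g z).
Proof. by move=> cf cg z; apply: cvgM; [exact: cf|exact: cg]. Qed.

Lemma ctsZ (T : topologicalType) (V : normedModType R) (f : T -> R) (g : T -> V) :
  continuous f -> continuous g -> continuous (fun z => f z *: g z).
Proof. by move=> cf cg z; apply: cvgZ; [exact: cf|exact: cg]. Qed.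

Lemma ctsV (T : topologicalType) (f : T -> R) :
  continuous f -> (forall z, f z != 0) -> continuous (fun z => (f z)^-1).
Proof. by move=> cf f0 z; apply: cvgV; [exact: f0|exact: cf]. Qed.

Lemma cts_cst (T U : topologicalType) (c : U) : continuous (fun _ : T => c).
Proof. by move=> z; exact: cvg_cst. Qed.

Lemma cts_id (T : topologicalType) : continuous (fun z : T => z).
Proof. by move=> z. Qed.

Lemma cts_comp (T U V : topologicalType) (g : U -> V) (f : T -> U) :
  continuous g -> continuous f -> continuous (fun z => g (f z)).
Proof. by move=> cg cf z; apply: (continuous_comp (cf z)); exact: cg. Qed.

Lemma cts_fst (T U V : topologicalType) (f : T -> U * V) :
  continuous f -> continuous (fun z => (f z).1).
Proof. by move=> cf z; apply: (continuous_comp (cf z)); exact: cvg_fst. Qed.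

Lemma cts_snd (T U V : topologicalType) (f : T -> U * V) :
  continuous f -> continuous (fun z => (f z).2).
Proof. by move=> cf z; apply: (continuous_comp (cf z)); exact: cvg_snd. Qed.

Lemma cts_pair (T U V : topologicalType) (f : T -> U) (g : T -> V) :
  continuous f -> continuous g -> continuous (fun z => (f z, g z)).
Proof. by move=> cf cg z; apply: cvg_pair; [exact: cf|exact: cg]. Qed.

Lemma cts_norm (T : topologicalType) (V : normedModType R) (f : T -> V) :
  continuous f -> continuous (fun z => `|f z|).
Proof. by move=> cf z; apply: cvg_norm; exact: cf. Qed.

Lemma cts_max (T : topologicalType) (f g : T -> R) :
  continuous f -> continuous g -> continuous (fun z => Num.max (f z) (g z)).
Proof. by move=> cf cg z; apply: continuous_max; [exact: cf|exact: cg]. Qed.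

Lemma cts_sum (T : topologicalType) (V : normedModType R) (I : Type) (r : seq I) (f : I -> T -> V) :
  (forall i, continuous (f i)) -> continuous (fun z => \sum_(i <- r) f i z).
Proof.
move=> cf; elim: r => [|i r IH].
  by rewrite (_ : (fun _ => _) = fun=> 0) => [|]; [exact: cts_cst|apply/funext => z; rewrite big_nil].
rewrite (_ : (fun _ => _) = fun z => f i z + \sum_(i <- r) f i z); first exact: ctsD.
by apply/funext => z; rewrite big_cons.
Qed.

Lemma cts_coord (T : topologicalType) n (f : T -> 'rV[R]_n) i :
  continuous f -> continuous (fun z => f z 0 i).
Proof. by move=> cf; apply: (cts_comp (@coord_continuous _ _ _ _ _) cf). Qed.

Lemma cts_dotp (T : topologicalType) n (f g : T -> 'rV[R]_n) :
  continuous f -> continuous g -> continuous (fun z => dotp (f z) (g z)).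
Proof. by move=> cf cg; apply: cts_sum => i; apply: ctsM; exact: cts_coord. Qed.

Lemma cts_sqn (T : topologicalType) n (f : T -> 'rV[R]_n) :
  continuous f -> continuous (fun z => sqn (f z)).
Proof. by move=> cf; exact: cts_dotp. Qed.

Lemma near_eps (V : normedModType R) (z : V) (P : V -> Prop) :
  (\forall w \near z, P w) <-> exists2 d : R, 0 < d & forall w, `|w - z| < d -> P w.
Proof.
split=> [/nbhs_ballP[d /= d0 h]|[d d0 h]].
  by exists d => // w wz; apply: h; rewrite -ball_normE/= distrC.
by apply/nbhs_ballP; exists d => //= w; rewrite -ball_normE/= distrC; exact: h.
Qed.

Lemma cts_eps (V W : normedModType R) (f : V -> W) : continuous f <->
  forall (z : V) (e : R), 0 < e -> exists2 d : R, 0 < d & forall w, `|w - z| < d -> `|f w - f z| < e.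
Proof.
split=> [cf z e e0|h z].
  have /cvgrPdist_lt/(_ _ e0)/near_eps[r r0 hr] := cf z.
  by exists r => // w /hr; rewrite distrC.
apply/cvgrPdist_lt => e e0; apply/near_eps.
by have [d d0 hd] := h z e e0; exists d => // w /hd; rewrite distrC.
Qed.

End ContinuityRules.

(** * Compactness and reduction modulo the lattice *)

Section Compactness.
Context {R : realType}.

Lemma max_compact (T : topologicalType) (S : set T) (f : T -> R) :
  S !=set0 -> compact S -> continuous f ->
  exists2 c, S c & forall t, S t -> f t <= f c.
Proof.
move=> S0 cS cf.
have [c cA h] := compact_EVT_max S0 cS (continuous_subspaceT cf).
by exists c => [|t St]; [rewrite inE in cA|apply: h; rewrite inE].
Qed.

Lemma compact_cball_at n (x0 : 'rV[R]_n) (M : R) : compact [set x : 'rV[R]_n | `|x - x0| <= M].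
Proof.
apply: bounded_closed_compact.
  exists (M + `|x0|); split => //; first by rewrite num_real.
  move=> N MN x /= xM; apply: le_trans (ltW MN).
  by rewrite -[x](subrK x0) (le_trans (ler_normD _ _))// lerD2r.
have /continuous_closedP/(_ [set r : R | r <= M])/(_ (@closed_le _ _)) :
    continuous (fun x : 'rV[R]_n => `|x - x0|).
  by apply: cts_norm; apply: ctsB; [exact: cts_id|exact: cts_cst].
exact.
Qed.

Lemma compact_cball n (M : R) : compact [set x : 'rV[R]_n | `|x| <= M].
Proof. by under eq_set do rewrite -[X in `|X|]subr0; exact: compact_cball_at. Qed.

Lemma compact_itv_le (a b : R) : compact [set t : R | a <= t <= b].
Proof.
rewrite (_ : mkset _ = `[a, b]%classic); first exact: segment_compact.
by rewrite eqEsubset; split => t /=; rewrite in_itv.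
Qed.

(** Only [z] is confined to [S]; the neighbour [w] may leave the compact set. Continuity holds on a
    ball around each [z], and the near-covering form of compactness makes the radius uniform. *)
Lemma uniform_on_compact (V W : normedModType R) (S : set V) (f : V -> W) :
  compact S -> continuous f -> forall e : R, 0 < e ->
  exists2 d : R, 0 < d & forall z w, S z -> `|w - z| < d -> `|f w - f z| < e.
Proof.
move=> /compact_near_coveringP cS cf e e0.
pose P (d : R) (z : V) := forall w, `|w - z| < d -> `|f w - f z| < e.
have : \forall d \near (0 : R)^'+, S `<=` P d.
  apply: cS => z Sz.
  have e20 : 0 < e / 2 by rewrite divr_gt0.
  have [r r0 hr] := (cts_eps f).1 cf z _ e20.
  exists ([set w | `|w - z| < r / 2], [set d | 0 < d < r / 2]) => /=.
    split; first by apply/near_eps; exists (r / 2); rewrite ?divr_gt0.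
    by exists (r / 2) => [|d]; [by rewrite /= divr_gt0|move=> /= hd d0; move: hd; rewrite distrC subr0 gtr0_norm// d0].
  case=> y d /= [yz /andP[d0 dr]] w wy.
  have : `|f y - f z| < e / 2 by apply: hr; move: r0 yz; lra.
  have : `|f w - f z| < e / 2.
    apply: hr; rewrite -(subrKA y); apply: le_lt_trans (ler_normD _ _) _; move: yz wy dr; lra.
  move=> a b; rewrite -(subrKA (f z)); apply: le_lt_trans (ler_normD _ _) _.
  by move: a b; rewrite (distrC (f z)); lra.
move=> [d /= d0 hd]; exists (d / 2); first by rewrite divr_gt0.
move=> z w Sz; apply: hd => //=; last by rewrite divr_gt0.
by rewrite sub0r normrN gtr0_norm ?divr_gt0//; lra.
Qed.

Lemma bounded_on_compact (V : topologicalType) (W : normedModType R) (S : set V) (f : V -> W) :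
  compact S -> continuous f -> exists2 B : R, 0 < B & forall z, S z -> `|f z| <= B.
Proof.
move=> cS cf; have [S0|/set0P/negP/negPn/eqP ->] := pselect (S !=set0); last by exists 1.
have cnf : continuous (fun z => `|f z|) by apply: cts_norm.
have [c _ hc] := max_compact S0 cS cnf.
by exists (`|f c| + 1) => [|z Sz]; rewrite ?ltr_wpDl// (le_trans (hc z Sz))// lerDl.
Qed.

(** This is how compactness of the torus enters: a periodic quantity only has to be controlled on
    the unit ball. *)
Lemma reduce_mod_Zn n (x : 'rV[R]_n) : exists k : 'rV[int]_n, `|x + map_mx intr k| <= 1.
Proof.
exists (\row_i - Num.floor (x 0 i)); apply: norm_le_coord => // i.
rewrite !mxE intrN ler_norml; apply/andP.
have := floorD1_gt (x 0 i); have := floor_le (x 0 i); rewrite intrD; split; lra.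
Qed.

End Compactness.

(** * Derivatives by epsilon estimates, one-sided maxima and mean values *)

Section Derivatives.
Context {R : realType}.

(** Multiplying the difference quotient by [h] removes the punctured neighbourhood and the division,
    so that derivatives are handled by norm inequalities. *)
Lemma is_derive_eps (V W : normedModType R) (f : V -> W) (z v : V) (d : W) :
  is_derive z v f d <-> forall e : R, 0 < e -> exists2 r : R, 0 < r &
    forall h : R, `|h| < r -> `|f (z + h *: v) - f z - h *: d| <= e * `|h|.
Proof.
split=> [[/[swap] <-]|h].
  move=> /cvgrPdist_le dv e e0; have [r /= r0 hr] := dv e e0.
  exists r => // h hlt; have [->|h0] := eqVneq h 0.
    by rewrite !scale0r addr0 !subrr !normr0 mulr0.
  have := hr h; rewrite /= distrC subr0 => /(_ hlt h0) /(ler_wpM2r (normr_ge0 h)).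
  by rewrite mulrC -normrZ scalerBr scalerA divff// scale1r distrC (addrC z).
have cv : h^-1 *: ((f \o shift z) (h *: v) - f z) @[h --> 0^'] --> d.
  apply/cvgrPdist_le => e e0; have [r r0 hr] := h e e0.
  exists r => // t; rewrite /= distrC subr0 => tr t0.
  have tp : 0 < `|t| by rewrite normr_gt0.
  rewrite -(ler_pM2l tp) -normrZ scalerBr scalerA divff// scale1r distrC (addrC _ z) (mulrC _ e).
  exact: hr.
by split; [apply: cvgP cv|apply: cvg_lim cv].
Qed.

Lemma is_derive1_eps (W : normedModType R) (f : R -> W) (c : R) (d : W) :
  is_derive c (1 : R) f d <-> forall e : R, 0 < e -> exists2 r : R, 0 < r &
    forall t : R, `|t - c| < r -> `|f t - f c - (t - c) *: d| <= e * `|t - c|.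
Proof.
rewrite is_derive_eps; split=> h e e0; have [r r0 hr] := h e e0; exists r => // t tr.
  by have := hr _ tr; rewrite [_ *: 1]mulr1 subrKC.
by have := hr (c + t *: 1); rewrite [_ *: 1]mulr1 addrAC subrr add0r; exact.
Qed.

Lemma is_derive_line (V W : normedModType R) (f : V -> W) (z w : V) (s : R) (d : W) :
  is_derive (z + s *: w) w f d <-> is_derive s (1 : R) (fun t => f (z + t *: w)) d.
Proof.
rewrite is_derive1_eps is_derive_eps; split=> h e e0; have [r r0 hr] := h e e0; exists r => // t tr.
  by have := hr _ tr; rewrite -[z + _ + _]addrA -scalerDl subrKC.
have := hr (s + t); rewrite addrAC subrr add0r => /(_ tr).
by rewrite scalerDl addrA.
Qed.

Lemma is_derive1_cts (W : normedModType R) (f : R -> W) (df : R -> W) :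
  (forall t, is_derive t (1 : R) f (df t)) -> continuous f.
Proof. by move=> h t; apply: differentiable_continuous; apply/derivable1_diffP; have [] := h t. Qed.

Lemma is_derive_ext (V W : normedModType R) (f g : V -> W) z v d :
  f =1 g -> is_derive z v f d -> is_derive z v g d.
Proof. by move=> /funext ->. Qed.

Lemma exists_lt_min (q r : R) : 0 < q -> 0 < r -> exists m : R, [/\ 0 < m, m < q & m < r].
Proof.
move=> q0 r0; exists (Num.min q r / 2).
have : 0 < Num.min q r by rewrite lt_min q0.
have : Num.min q r <= q by rewrite ge_min lexx.
have : Num.min q r <= r by rewrite ge_min lexx orbT.
by split; lra.
Qed.

(** A negative derivative would make [f] larger just before [c]. The maximum is one-sided because in
    [envelope] it may sit at the final time. *)
Lemma der_max_left (f : R -> R) (c d r : R) : is_derive c (1 : R) f d -> 0 < r ->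
  (forall t, c - r < t -> t < c -> f t <= f c) -> 0 <= d.
Proof.
move=> /is_derive1_eps df r0 hr; rewrite leNgt; apply/negP => d0.
have d20 : 0 < - d / 2 by rewrite divr_gt0// oppr_gt0.
have [q q0 hq] := df _ d20.
have [m [m0 mq mr]] := exists_lt_min q0 r0.
have := hq (c - m); rewrite addrAC subrr add0r normrN gtr0_norm// => /(_ mq).
have : f (c - m) <= f c by apply: hr; lra.
rewrite ler_norml /GRing.scale/= => h1 /andP[h2 _].
have : 0 < m * - d by rewrite mulr_gt0// oppr_gt0.
move: h1 h2; nra.
Qed.

Lemma der_max_right (f : R -> R) (c d r : R) : is_derive c (1 : R) f d -> 0 < r ->
  (forall t, c < t -> t < c + r -> f t <= f c) -> d <= 0.
Proof.
move=> df r0 hr; rewrite -oppr_ge0; apply: (@der_max_left (fun t => f (- t)) (- c) _ r) => //.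
  apply/is_derive1_eps => e e0; have [q q0 hq] := (is_derive1_eps _ _ _).1 df e e0.
  exists q => // t tq; rewrite opprK.
  have e1 : `|- t - c| = `|t + c| by rewrite -opprD normrN.
  have e2 : (- t - c) *: d = (t + c) *: - d by rewrite -opprD scalerN scaleNr.
  by have := hq (- t); rewrite e1 e2; apply; rewrite opprK in tq.
by move=> t h1 h2; rewrite opprK; apply: hr; lra.
Qed.

Lemma der_local_max (f : R -> R) (c d r : R) : is_derive c (1 : R) f d -> 0 < r ->
  (forall t, `|t - c| < r -> f t <= f c) -> d = 0.
Proof.
move=> df r0 hr; apply/eqP; rewrite eq_le; apply/andP; split.
  by apply: (der_max_right df r0) => t h1 h2; apply: hr; rewrite ltr_norml; lra.
by apply: (der_max_left df r0) => t h1 h2; apply: hr; rewrite ltr_norml; lra.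
Qed.

Lemma mvt (f df : R -> R) (a b : R) : a <= b ->
  (forall s, a <= s <= b -> is_derive s (1 : R) f (df s)) ->
  exists2 c : R, a <= c <= b & f b - f a = df c * (b - a).
Proof.
rewrite le_eqVlt => /predU1P[-> _|ab h]; first by exists b; rewrite ?lexx// !subrr mulr0.
have [|s|c] := @MVT _ f df a b ab.
- by move=> s; rewrite in_itv/= => /andP[h1 h2]; apply: h; rewrite !ltW.
- apply: derivable_within_continuous => t; rewrite in_itv/= => /h ht.
  by have [] := ht.
by rewrite in_itv/= => /andP[h1 h2] ->; exists c => //; rewrite !ltW.
Qed.

Lemma mvt_le (f df : R -> R) (a b C : R) : a <= b ->
  (forall s, a <= s <= b -> is_derive s (1 : R) f (df s)) ->
  (forall s, a <= s <= b -> df s <= C) -> f b - f a <= C * (b - a).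
Proof.
move=> ab h hC; have [c cab ->] := mvt ab h.
by rewrite ler_wpM2r ?subr_ge0// hC.
Qed.

Lemma mvt_abs (f df : R -> R) (a b C : R) : a <= b ->
  (forall s, a <= s <= b -> is_derive s (1 : R) f (df s)) ->
  (forall s, a <= s <= b -> `|df s| <= C) -> `|f b - f a| <= C * (b - a).
Proof.
move=> ab h hC; have [c cab ->] := mvt ab h.
by rewrite normrM (ger0_norm (x := b - a)) ?subr_ge0// ler_wpM2r ?subr_ge0// hC.
Qed.

End Derivatives.

(** * C1 and C2 functions, Taylor expansion *)

Section C1functions.
Context {R : realType}.

Lemma C1_differentiable (V W : normedModType R) (f : V -> W) z : C1 f -> differentiable f z.
Proof. by move=> [h _]; exact: h. Qed.

Lemma C1_is_derive (V W : normedModType R) (f : V -> W) z v : C1 f -> is_derive z v f ('D_v f z).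
Proof. by move=> h; apply: derivableP; apply: diff_derivable; exact: C1_differentiable. Qed.

Lemma C1_cts (V W : normedModType R) (f : V -> W) : C1 f -> continuous f.
Proof. by move=> h z; apply: differentiable_continuous; exact: C1_differentiable. Qed.

Lemma C1_Dcts (V W : normedModType R) (f : V -> W) v : C1 f -> continuous ('D_v f).
Proof. by move=> [_ h] z; exact: h. Qed.

Lemma deriveDdir (V W : normedModType R) (f : V -> W) z v w : differentiable f z ->
  'D_(v + w) f z = 'D_v f z + 'D_w f z.
Proof. by move=> df; rewrite !deriveE// linearD. Qed.

Lemma deriveZdir (V W : normedModType R) (f : V -> W) (z : V) (a : R) (v : V) : differentiable f z ->
  'D_(a *: v) f z = a *: 'D_v f z.
Proof. by move=> df; rewrite !deriveE// linearZ. Qed.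

Lemma derive_sumdir (V W : normedModType R) (f : V -> W) z I (r : seq I) (v : I -> V) :
  differentiable f z ->
  'D_(\sum_(i <- r) v i) f z = \sum_(i <- r) 'D_(v i) f z.
Proof. by move=> df; rewrite !deriveE// linear_sum; apply: eq_bigr => i _; rewrite deriveE. Qed.

Lemma C1_is_derive_line (V W : normedModType R) (f : V -> W) (z w : V) (s : R) : C1 f ->
  is_derive s (1 : R) (fun t => f (z + t *: w)) ('D_w f (z + s *: w)).
Proof. by move=> h; apply: (is_derive_line f z w s _).1; apply: C1_is_derive. Qed.

Lemma C1_mvt_segment (V : normedModType R) (f : V -> R) z w : C1 f ->
  exists2 s : R, 0 <= s <= 1 & f (z + w) - f z = 'D_w f (z + s *: w).
Proof.
move=> h.
have [s _|s s01] := @mvt R (fun s => f (z + s *: w)) (fun s => 'D_w f (z + s *: w)) 0 1 ler01.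
  exact: C1_is_derive_line.
by rewrite scale1r scale0r addr0 subr0 mulr1 => ?; exists s.
Qed.

(** With [M] fixed by the value at [z + w], the auxiliary [g] vanishes at 0 and 1. Rolle gives a
    zero [a] of its derivative, and the mean value theorem for the first derivative on [[0, a]]
    turns [2 * M] into a second derivative. *)
Lemma C2_taylor (V : normedModType R) (f : V -> R) z w : C2 f ->
  exists2 s : R, 0 <= s <= 1 &
    f (z + w) = f z + 'D_w f z + 2^-1 * 'D_w ('D_w f) (z + s *: w).
Proof.
move=> [h1 h2].
pose M := f (z + w) - f z - 'D_w f z.
pose g s := f (z + s *: w) - f z - s * 'D_w f z - M * s ^+ 2.
have dg s : is_derive s (1 : R) g ('D_w f (z + s *: w) - 'D_w f z - 2 * M * s).
  have d1 : is_derive s (1 : R) (fun s => f (z + s *: w)) ('D_w f (z + s *: w)).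
    exact: C1_is_derive_line.
  apply: is_derive_eq; rewrite /GRing.scale/=; ring.
have g0 : g 0 = 0 by rewrite /g scale0r addr0; ring.
have g1 : g 1 = 0 by rewrite /g scale1r /M; ring.
have [a /andP[a0 a1]] : exists2 a, 0 < a < 1 & 'D_w f (z + a *: w) - 'D_w f z - 2 * M * a = 0.
  have [s _|||a] := @Rolle _ g 0 1 ltr01.
  - by have [] := dg s.
  - exact/continuous_subspaceT/(is_derive1_cts dg).
  - by rewrite g0 g1.
  - rewrite in_itv/= => a01 [_ da]; exists a => //.
    by have [_ <-] := dg a.
move=> ea.
have [s _|s /andP[s0 sa]] := @mvt R (fun s => 'D_w f (z + s *: w))
   (fun s => 'D_w ('D_w f) (z + s *: w)) 0 a (ltW a0).
  exact: (C1_is_derive_line z w s (h2 w)).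
rewrite scale0r addr0 subr0 => es; exists s; first by rewrite s0 (le_trans sa)// ltW.
have : 'D_w ('D_w f) (z + s *: w) = 2 * M.
  apply: (mulIf (lt0r_neq0 a0)); rewrite -es; lra.
by move=> ->; rewrite /M; lra.
Qed.

(** Test functions are sums of functions of one time or of one coordinate; each summand is a real
    function composed with a linear form. *)
Lemma C1_lin_comp (V U W : normedModType R) (A : set V) (l : {linear V -> U}) (f : U -> W) :
  continuous l -> C1 f -> C1_on A (fun z => f (l z)).
Proof.
move=> cl h.
have dl z : differentiable l z by exact: linear_differentiable.
have df z : differentiable (fun z => f (l z)) z.
  exact: (differentiable_comp (dl z) (C1_differentiable _ h)).
split=> [z _|v z _]; first exact: df.
rewrite (_ : 'D_v (fun z => f (l z)) = fun z => 'D_(l v) f (l z)).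
  have cc := cts_comp (C1_Dcts (v := l v) h) cl; exact: cc.
apply/funext => y; rewrite deriveE//.
rewrite (_ : (fun z => f (l z)) = f \o l)// diff_comp//; last exact: C1_differentiable.
by rewrite /= diff_lin// deriveE//; exact: C1_differentiable.
Qed.

Lemma C1_on_eq (V W : normedModType R) (A : set V) (f g : V -> W) :
  C1 f -> f =1 g -> C1_on A g.
Proof. by move=> [h1 h2] /funext <-; split=> [z _|v z _]; [exact: h1|exact: h2]. Qed.

Lemma C1D (V W : normedModType R) (f g : V -> W) : C1 f -> C1 g -> C1 (fun z => f z + g z).
Proof.
move=> cf cg; split=> [z _|v z _].
  by apply: differentiableD; exact: C1_differentiable.
rewrite (_ : 'D_v (fun z => f z + g z) = fun z => 'D_v f z + 'D_v g z).
  have cc := ctsD (C1_Dcts (v := v) cf) (C1_Dcts (v := v) cg); exact: cc.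
by apply/funext => y; apply: deriveD; apply: diff_derivable; exact: C1_differentiable.
Qed.

Lemma C1N (V W : normedModType R) (f : V -> W) : C1 f -> C1 (fun z => - f z).
Proof.
move=> cf; split=> [z _|v z _].
  by apply: differentiableN; exact: C1_differentiable.
rewrite (_ : 'D_v (fun z => - f z) = fun z => - 'D_v f z).
  have cc := ctsN (C1_Dcts (v := v) cf); exact: cc.
by apply/funext => y; apply: deriveN; apply: diff_derivable; exact: C1_differentiable.
Qed.

Lemma C1_cst (V W : normedModType R) (c : W) : C1 (fun _ : V => c).
Proof.
split=> [z _|v z _]; first exact: differentiable_cst.
rewrite (_ : 'D_v (fun=> c) = fun=> 0); first exact: cst_continuous.
by apply/funext => y; exact: derive_cst.
Qed.

Lemma C1_sum (V W : normedModType R) I (r : seq I) (f : I -> V -> W) :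
  (forall i, C1 (f i)) -> C1 (fun z => \sum_(i <- r) f i z).
Proof.
move=> cf; elim: r => [|i r IH].
  apply: (@C1_on_eq _ _ _ (fun=> 0)); first exact: C1_cst.
  by move=> z; rewrite big_nil.
apply: (@C1_on_eq _ _ _ (fun z => f i z + \sum_(j <- r) f j z)); first exact: C1D.
by move=> z; rewrite big_cons.
Qed.

Lemma C1_real (f df : R -> R) : (forall t, is_derive t (1 : R) f (df t)) ->
  continuous df -> C1 f.
Proof.
move=> h cdf; have dff t : differentiable f t by apply/derivable1_diffP; have [] := h t.
split=> [t _|v t _]; first exact: dff.
rewrite (_ : 'D_v f = fun t => v * df t).
  have cc := ctsM (cts_cst (c := v)) cdf; exact: cc.
apply/funext => y; rewrite -[v in LHS]mulr1 -[v * 1]/(v *: (1 : R)) deriveZdir//.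
by have [_ ->] := h y.
Qed.

End C1functions.

(** * Phase space: partial derivatives and bounds on slabs of bounded momentum *)

Section PhaseSpace.
Context {R : realType} {n : nat}.
Notation P := ('rV[R]_n * 'rV[R]_n)%type.

(** A directional derivative sees only the restriction to a line. This identifies partial
    derivatives with derivatives in the product space, and shows that derivatives of periodic
    functions are periodic. *)
Lemma derive_eq_line (V V' W : normedModType R) (f : V -> W) (g : V' -> W) z v z' v' :
  (forall h : R, f (h *: v + z) = g (h *: v' + z')) -> 'D_v f z = 'D_v' g z'.
Proof.
move=> e; rewrite /derive.
rewrite (_ : (fun h : R => _) = fun h : R => h^-1 *: ((g \o shift z') (h *: v') - g z'))//.
apply/funext => h /=; congr (_ *: (_ - _)); first exact: e.
by have := e 0; rewrite !scale0r !add0r.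
Qed.

Lemma derive_partial_snd (U V W : normedModType R) (f : U * V -> W) (x : U) (p v : V) :
  'D_v (fun p => f (x, p)) p = 'D_((0, v) : U * V) f (x, p).
Proof.
apply: derive_eq_line => h.
by rewrite -[h *: (0, v)]/(h *: 0, h *: v) scaler0 -[(0, _) + _]/(0 + x, h *: v + p) add0r.
Qed.

Lemma derive_partial_fst (U V W : normedModType R) (f : U * V -> W) (x v : U) (p : V) :
  'D_v (fun x => f (x, p)) x = 'D_((v, 0) : U * V) f (x, p).
Proof.
apply: derive_eq_line => h.
by rewrite -[h *: (v, 0)]/(h *: v, h *: 0) scaler0 -[(_, 0) + _]/(h *: v + x, 0 + p) add0r.
Qed.

Definition x_periodic (W : Type) (f : P -> W) := forall p, Zn_periodic (fun x => f (x, p)).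

Lemma x_periodic_derive (W : normedModType R) (f : P -> W) (v : P) :
  x_periodic f -> x_periodic ('D_v f).
Proof.
move=> pf p x k; apply: derive_eq_line => h.
rewrite -[h *: v + (x + map_mx intr k, p)]/(h *: v.1 + (x + map_mx intr k), h *: v.2 + p).
by rewrite addrA pf.
Qed.

Lemma norm_fst_le (z : P) : `|z.1| <= `|z|.
Proof. by rewrite prod_normE le_max lexx. Qed.

Lemma norm_snd_le (z : P) : `|z.2| <= `|z|.
Proof. by rewrite prod_normE le_max lexx orbT. Qed.

Lemma norm_pair_le (x p : 'rV[R]_n) : `|((x, p) : P)| <= `|x| + `|p|.
Proof. by rewrite prod_normE ge_max lerDl lerDr !normr_ge0. Qed.

(** A slab of bounded momentum is compact modulo the lattice. *)
Lemma slab_bounded (W : normedModType R) (f : P -> W) (M : R) :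
  continuous f -> x_periodic f ->
  exists2 B : R, 0 < B & forall z : P, `|z.2| <= M -> `|f z| <= B.
Proof.
move=> cf pf.
have [B B0 hB] := bounded_on_compact (compact_setX (@compact_cball R n 1) (@compact_cball R n M)) cf.
exists B => // -[x p] /= pM; have [k hk] := reduce_mod_Zn x.
by rewrite -(pf p x k); apply: hB.
Qed.

Definition bas1 (i : 'I_n) : P := (delta_mx 0 i, 0).
Definition bas2 (i : 'I_n) : P := (0, delta_mx 0 i).

Lemma pair_decomp (w : P) :
  w = \sum_i w.1 0 i *: bas1 i + \sum_i w.2 0 i *: bas2 i.
Proof.
have f1 (I : Type) (r : seq I) (F : I -> P) : (\sum_(i <- r) F i) = (\sum_(i <- r) (F i).1, \sum_(i <- r) (F i).2).
  by elim: r => [|i r IH]; rewrite ?big_nil// !big_cons IH.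
rewrite !f1 -[RHS]/(_ + _, _ + _); case: w => x p /=; congr (_, _).
  under [X in _ + X]eq_bigr do rewrite scaler0.
  by rewrite [X in _ + X]big1// addr0 -row_sum_delta.
under [X in X + _]eq_bigr do rewrite scaler0.
by rewrite [X in X + _]big1// add0r -row_sum_delta.
Qed.

(** Each basis direction has its own bound on the slab; linearity in the direction makes the bound
    uniform in [w]. *)
Lemma C1_slab (f : P -> R) (M : R) : C1 f -> x_periodic f ->
  exists2 C : R, 0 < C & forall z w : P, `|z.2| <= M -> `|'D_w f z| <= C * `|w|.
Proof.
move=> cf pf.
have hB v : exists2 B : R, 0 < B & forall z : P, `|z.2| <= M -> `|'D_v f z| <= B.
  by apply: slab_bounded; [exact: C1_Dcts|exact: x_periodic_derive].
have hB1 (b : 'I_n -> P) : exists2 B : R, 0 < B &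
    forall i (z : P), `|z.2| <= M -> `|'D_(b i) f z| <= B.
  pose g i := sval (cid2 (hB (b i))).
  have g0 i : 0 < g i by rewrite /g; case: cid2.
  exists (1 + \sum_i g i).
    by rewrite ltr_pwDl// sumr_ge0// => i _; exact: ltW.
  move=> i z zM; apply: (@le_trans _ _ (g i)).
    by rewrite /g; case: cid2 => x /= _; exact.
  rewrite (bigD1 i)//= addrCA lerDl addr_ge0// sumr_ge0// => j _; exact: ltW.
have [B1 B10 h1] := hB1 bas1; have [B2 B20 h2] := hB1 bas2.
exists ((n%:R + 1) * (B1 + B2)); first by rewrite mulr_gt0// ?addr_gt0// ltr_wpDl.
move=> z w zM.
have df := C1_differentiable z cf.
rewrite [w in 'D_w f z]pair_decomp deriveDdir// !derive_sumdir//.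
apply: (@le_trans _ _ (\sum_(i < n) `|w| * B1 + \sum_(i < n) `|w| * B2)).
  apply: le_trans (ler_normD _ _) _; apply: lerD; apply: le_trans (ler_norm_sum _ _ _) _; apply: ler_sum => i _;
  rewrite (deriveZdir _ _ df) normrZ.
    apply: ler_pM => //; [exact: le_trans (coord_le_norm _ _) (norm_fst_le _)|exact: h1].
  by apply: ler_pM => //; [exact: le_trans (coord_le_norm _ _) (norm_snd_le _)|exact: h2].
rewrite !sumr_const card_ord -!(mulr_natl (_ * _)).
have : 0 <= `|w| * (B1 + B2) by rewrite mulr_ge0// addr_ge0// ltW.
lra.
Qed.

Lemma C1_slab_lip (f : P -> R) (M : R) : C1 f -> x_periodic f ->
  exists2 C : R, 0 < C & forall z w : P, `|z.2| <= M -> `|w.2| <= M -> `|f w - f z| <= C * `|w - z|.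
Proof.
move=> cf pf; have [C C0 hC] := C1_slab M cf pf.
exists C => // z w zM wM.
have [s /andP[s0 s1]] := C1_mvt_segment z (w - z) cf.
rewrite subrKC => ->; apply: hC.
rewrite -[X in `|X|]/(z.2 + s *: (w.2 - z.2)).
rewrite (_ : _ + _ = (1 - s) *: z.2 + s *: w.2); last by rewrite scalerBr scalerBl scale1r addrA addrAC.
apply: le_trans (ler_normD _ _) _; rewrite !normrZ !ger0_norm ?subr_ge0//.
have : (1 - s) * `|z.2| <= (1 - s) * M by rewrite ler_wpM2l// subr_ge0.
have : s * `|w.2| <= s * M by rewrite ler_wpM2l.
lra.
Qed.

Lemma C2_C1 (V W : normedModType R) (f : V -> W) : C2 f -> C1 f.
Proof. by case. Qed.

Lemma C2_D (V W : normedModType R) (f : V -> W) v : C2 f -> C1 ('D_v f).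
Proof. by case. Qed.

(** Continuity of second derivatives is only given for fixed directions. The outer direction is
    handled by [C1_slab], the inner one by decomposing it in the basis. *)
Lemma C2_slab (f : P -> R) (M : R) : C2 f -> x_periodic f ->
  exists2 C : R, 0 < C & forall z a b : P, `|z.2| <= M -> `|'D_a ('D_b f) z| <= C * (`|a| * `|b|).
Proof.
move=> cf pf.
have hB v : exists2 B : R, 0 < B & forall z a : P, `|z.2| <= M -> `|'D_a ('D_v f) z| <= B * `|a|.
  by apply: C1_slab; [exact: C2_D|exact: x_periodic_derive].
have hB1 (b : 'I_n -> P) : exists2 B : R, 0 < B &
    forall i (z a : P), `|z.2| <= M -> `|'D_a ('D_(b i) f) z| <= B * `|a|.
  pose g i := sval (cid2 (hB (b i))).
  have g0 i : 0 < g i by rewrite /g; case: cid2.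
  exists (1 + \sum_i g i).
    by rewrite ltr_pwDl// sumr_ge0// => i _; exact: ltW.
  move=> i z a zM; apply: (@le_trans _ _ (g i * `|a|)).
    by rewrite /g; case: cid2 => x /= _; exact.
  rewrite ler_wpM2r// (bigD1 i)//= addrCA lerDl addr_ge0// sumr_ge0// => j _; exact: ltW.
have [B1 B10 h1] := hB1 bas1; have [B2 B20 h2] := hB1 bas2.
exists ((n%:R + 1) * (B1 + B2)); first by rewrite mulr_gt0// ?addr_gt0// ltr_wpDl.
move=> z a w zM.
have -> : 'D_w f = fun y => \sum_i w.1 0 i * 'D_(bas1 i) f y + \sum_i w.2 0 i * 'D_(bas2 i) f y.
  apply/funext => y; have df := C1_differentiable y (C2_C1 cf).
  rewrite {1}[w]pair_decomp deriveDdir// !derive_sumdir//.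
  by congr (_ + _); apply: eq_bigr => i _; rewrite (deriveZdir _ _ df).
have dd (b : P) : derivable ('D_b f) z a.
  by apply: diff_derivable; apply: C1_differentiable; exact: C2_D.
have ds (c : 'I_n -> R) (b : 'I_n -> P) :
    is_derive z a (fun y => \sum_i c i * 'D_(b i) f y) (\sum_i c i * 'D_a ('D_(b i) f) z).
  rewrite (_ : (fun _ => _) = \sum_i (c i *: 'D_(b i) f)).
    apply: is_derive_sum => i; apply: is_deriveZ; exact: derivableP.
  by apply/funext => y; rewrite fct_sumE; apply: eq_bigr.
have [_ ->] := is_deriveD (ds (fun i => w.1 0 i) bas1) (ds (fun i => w.2 0 i) bas2).
apply: (@le_trans _ _ (\sum_(i < n) `|w| * (B1 * `|a|) + \sum_(i < n) `|w| * (B2 * `|a|))).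
  apply: le_trans (ler_normD _ _) _; apply: lerD; apply: le_trans (ler_norm_sum _ _ _) _; apply: ler_sum => i _;
  rewrite normrM.
    apply: ler_pM => //; [exact: le_trans (coord_le_norm _ _) (norm_fst_le _)|exact: h1].
  by apply: ler_pM => //; [exact: le_trans (coord_le_norm _ _) (norm_snd_le _)|exact: h2].
rewrite !sumr_const card_ord -!(mulr_natl (_ * _)).
have : 0 <= `|a| * `|w| * (B1 + B2) by rewrite mulr_ge0 ?mulr_ge0// addr_ge0// ltW.
lra.
Qed.

End PhaseSpace.

(** * Uniform consequences of the Tonelli conditions *)

Section TonelliEstimates.
Context {R : realType} {n : nat}.
Notation P := ('rV[R]_n * 'rV[R]_n)%type.
Implicit Types K : P -> R.

Lemma slab_segment (M s : R) (z w : P) : `|z.2| <= M -> `|(z + w).2| <= M ->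
  0 <= s <= 1 -> `|(z + s *: w).2| <= M.
Proof.
move=> zM wM /andP[s0 s1]; rewrite -[X in `|X|]/(z.2 + s *: w.2).
rewrite (_ : _ + _ = (1 - s) *: z.2 + s *: (z + w).2); last first.
  by rewrite scalerBl scale1r -[(z + w).2]/(z.2 + w.2) scalerDr addrA subrK.
apply: le_trans (ler_normD _ _) _; rewrite !normrZ !ger0_norm ?subr_ge0//.
have : (1 - s) * `|z.2| <= (1 - s) * M by rewrite ler_wpM2l// subr_ge0.
have : s * `|(z + w).2| <= s * M by rewrite ler_wpM2l.
lra.
Qed.

Lemma C2_taylor_slab K (M : R) : C2 K -> x_periodic K ->
  exists2 C : R, 0 < C & forall z w : P, `|z.2| <= M -> `|w.2| <= M ->
    `|K w - K z - 'D_(w - z) K z| <= C * `|w - z| ^+ 2.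
Proof.
move=> cK pK; have [C C0 hC] := C2_slab M cK pK.
exists C => // z w zM wM; have [s s01] := C2_taylor z (w - z) cK.
rewrite subrKC => ->.
rewrite (_ : _ - _ - _ = 2^-1 * 'D_(w - z) ('D_(w - z) K) (z + s *: (w - z))); last by ring.
have := hC (z + s *: (w - z)) (w - z) (w - z).
rewrite -expr2 slab_segment//; last by rewrite subrKC.
move=> /(_ isT) h; rewrite normrM ger0_norm; last lra.
by have := normr_ge0 ('D_(w - z) ('D_(w - z) K) (z + s *: (w - z))); lra.
Qed.

(** [Dpp] is built entrywise from partial gradients, whereas the Taylor formula produces an iterated
    derivative in one direction of the product. *)
Lemma Dpp_second_derivative K (z : P) (q : 'rV[R]_n) : C2 K ->
  dotp (q *m Dpp K z) q = 'D_((0, q) : P) ('D_((0, q) : P) K) z.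
Proof.
move=> cK.
have e0 (v : 'rV[R]_n) : ((0, v) : P) = \sum_i v 0 i *: bas2 i.
  rewrite [LHS]pair_decomp /= big1 ?add0r// => i _; by rewrite mxE scale0r.
have eK : 'D_((0, q) : P) K = fun y => \sum_j q 0 j * 'D_(bas2 j) K y.
  apply/funext => y; have df := C1_differentiable y (C2_C1 cK).
  by rewrite e0 derive_sumdir//; apply: eq_bigr => i _; rewrite (deriveZdir _ _ df).
have cE : C1 ('D_((0, q) : P) K) by exact: C2_D.
have := derive_sumdir (index_enum _) (fun i => q 0 i *: bas2 i) (C1_differentiable z cE).
rewrite -e0 => ->.
rewrite /dotp; under eq_bigr do rewrite mxE mulr_suml.
rewrite exchange_big/=; apply: eq_bigr => i _.
rewrite (deriveZdir _ _ (C1_differentiable z cE)) eK.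
have ds : is_derive z (bas2 i) (fun y => \sum_j q 0 j * 'D_(bas2 j) K y)
    (\sum_j q 0 j * 'D_(bas2 i) ('D_(bas2 j) K) z).
  rewrite (_ : (fun _ => _) = \sum_j (q 0 j *: 'D_(bas2 j) K)).
    apply: is_derive_sum => j; apply: is_deriveZ; apply: derivableP.
    by apply: diff_derivable; apply: C1_differentiable; exact: C2_D.
  by apply/funext => y; rewrite fct_sumE; apply: eq_bigr.
have [_ ->] := ds; rewrite /GRing.scale/= mulr_sumr; apply: eq_bigr => j _.
rewrite mxE mulrAC -mulrA; congr (_ * (_ * _)).
case: z {ds} => x p /=; rewrite -derive_partial_snd; congr ('D_ _ _ _).
by apply/funext => p'; rewrite mxE/= derive_partial_snd.
Qed.

(** By homogeneity only [|q| = 1] matters, and there the positive second derivative attains its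
    minimum over the slab, which is compact modulo the lattice. *)
Lemma uniformly_convex K (M : R) : C2 K -> x_periodic K ->
  (forall (z : P) (q : 'rV[R]_n), q != 0 -> 0 < dotp (q *m Dpp K z) q) ->
  exists2 th : R, 0 < th & forall (z : P) (q : 'rV[R]_n), `|z.2| <= M ->
    th * `|q| ^+ 2 <= 'D_((0, q) : P) ('D_((0, q) : P) K) z.
Proof.
move=> cK pK pos.
have [g [gE cg pg]] : exists g : 'I_n -> 'I_n -> P -> R, [/\
    forall (z : P) (q : 'rV[R]_n), \sum_i \sum_j q 0 i * q 0 j * g i j z =
      'D_((0, q) : P) ('D_((0, q) : P) K) z,
    forall i j, continuous (g i j) & forall i j, x_periodic (g i j)].
  exists (fun i j => 'D_(bas2 i) ('D_(bas2 j) K)); split.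
  - move=> z q; rewrite -Dpp_second_derivative// /dotp.
    under [RHS]eq_bigr do rewrite mxE mulr_suml.
    rewrite exchange_big/=; apply: eq_bigr => j _; apply: eq_bigr => i _.
    rewrite mxE mulrAC; congr (_ * _ * _); case: z => x p /=; rewrite -derive_partial_snd; congr ('D_ _ _ _).
    by apply/funext => p'; rewrite mxE/= derive_partial_snd.
  - by move=> i j; apply: C1_Dcts; exact: C2_D.
  - by move=> i j; apply: x_periodic_derive; exact: x_periodic_derive.
(* As a polynomial in the coordinates of [q] with continuous coefficients, the second derivative is
   jointly continuous in the point and the direction. *)
pose f (y : P * 'rV[R]_n) := \sum_i \sum_j y.2 0 i * y.2 0 j * g i j y.1.
have fE z q : f (z, q) = 'D_((0, q) : P) ('D_((0, q) : P) K) z by exact: gE.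
have cf : continuous (fun y => - f y).
  apply: ctsN; apply: cts_sum => i; apply: cts_sum => j; apply: ctsM.
    by apply: ctsM; apply: cts_coord; apply: cts_snd; exact: cts_id.
  by apply: (@cts_comp _ _ _ (g i j)) => //; apply: cts_fst; exact: cts_id.
pose S := [set q : 'rV[R]_n | `|q| = 1].
have cS : compact S.
  have -> : S = [set q : 'rV[R]_n | `|q| <= 1] `&` [set q | `|q| = 1].
    by rewrite eqEsubset; split => q /=; [move=> ->|case].
  apply: compact_closedI; first exact: compact_cball.
  have /continuous_closedP/(_ [set r : R | r = 1])/(_ (@closed_eq _ _)) :
    continuous (fun x : 'rV[R]_n => `|x|) by apply: cts_norm; exact: cts_id.
  exact.
pose S3 := ([set x : 'rV[R]_n | `|x| <= 1] `*` [set x : 'rV[R]_n | `|x| <= M]) `*` S.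
have c3 : compact S3 by apply: compact_setX => //; apply: compact_setX; exact: compact_cball.
(* [S3] is empty when [n = 0] or [M < 0]: there is then no nonzero [q] or no point in the slab, and
   any positive constant works. *)
have [S0|S0] := pselect (S3 !=set0); last first.
  exists 1 => // -[x p] q /= pM; have [->|q0] := eqVneq q 0.
    rewrite normr0 expr0n mulr0/= -fE /f big1// => i _; rewrite big1// => j _.
    by rewrite /= mxE mul0r mul0r.
  case: S0; exists ((0, p), `|q|^-1 *: q); split => /=; first by split => //=; rewrite normr0.
  by rewrite /S/= normfZV.
have [[[x1 p1] q1] [/= _ Sq] hc] := max_compact S0 c3 cf.
exists (f ((x1, p1), q1)).
  by rewrite fE -Dpp_second_derivative// pos// -normr_gt0 Sq.
move=> [x p] q /= pM; have [->|q0] := eqVneq q 0.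
  rewrite normr0 expr0n mulr0/= -fE /f big1// => i _; rewrite big1// => j _.
  by rewrite /= mxE mul0r mul0r.
have [k hk] := reduce_mod_Zn x.
have pf : f ((x, p), q) = f ((x + map_mx intr k, p), q).
  by rewrite /f /=; apply: eq_bigr => i _; apply: eq_bigr => j _; rewrite pg.
have := hc ((x + map_mx intr k, p), `|q|^-1 *: q).
rewrite lerN2 => h; rewrite -fE pf.
have -> : f (x + map_mx intr k, p, q) = f (x + map_mx intr k, p, `|q|^-1 *: q) * `|q| ^+ 2.
  rewrite /f mulr_suml; apply: eq_bigr => i _; rewrite mulr_suml; apply: eq_bigr => j _ /=.
  rewrite !mxE; have : `|q| != 0 by rewrite normr_eq0.
  by move=> ?; field.
by rewrite ler_wpM2r ?sqr_ge0// h//; split => //=; rewrite /S/= normfZV.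
Qed.

(** Convexity in [p] when the base points differ. At the midpoint of [(x, p)] and [(y, q)] the
    first-order terms of the two expansions cancel; the mixed second derivatives are absorbed by
    Young's inequality at the cost of [sqn (x - y)], and moving the base point to [z] costs a
    Lipschitz term. This form serves when three equations are combined at three points. *)
Lemma tonelli_midpoint K (M : R) : C2 K -> x_periodic K ->
  (forall (z : P) (q : 'rV[R]_n), q != 0 -> 0 < dotp (q *m Dpp K z) q) ->
  exists th C : R, [/\ 0 < th, 0 < C & forall x y z p q : 'rV[R]_n, `|p| <= M -> `|q| <= M ->
    th * sqn (p - q) <= K (x, p) + K (y, q) - 2 * K (z, 2^-1 *: (p + q))
      + C * sqn (x - y) + C * `|x + y - 2 *: z|].
Proof.
move=> cK pK pos.
have [t0 t00 ht] := uniformly_convex M cK pK pos.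
have [C C0 hC] := C2_slab M cK pK.
have [L L0 hL] := C1_slab_lip M (C2_C1 cK) pK.
(* In a direction [(d, q)] the full Hessian keeps half of the convexity in [q]; all the rest is
   charged to [d]. *)
have D2 (z : P) (d q : 'rV[R]_n) : `|z.2| <= M ->
    t0 / 2 * `|q| ^+ 2 - (C + 2 * C ^+ 2 / t0) * `|d| ^+ 2 <= 'D_((d, q) : P) ('D_((d, q) : P) K) z.
  move=> zM; have -> : ((d, q) : P) = (d, 0) + (0, q).
    by rewrite -[RHS]/(d + 0, 0 + q) addr0 add0r.
  have -> : 'D_((d, 0) + (0, q) : P) K = fun y => 'D_((d, 0) : P) K y + 'D_((0, q) : P) K y.
    by apply/funext => y; apply: deriveDdir; apply: C1_differentiable; exact: C2_C1.
  have c1 := C2_D ((d, 0) : P) cK; have c2 := C2_D ((0, q) : P) cK.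
  rewrite deriveDdir; last by apply: C1_differentiable; exact: C1D.
  have [B BE] : exists B : P -> P -> R, forall a b, B a b = 'D_a ('D_b K) z by exists (fun a b => 'D_a ('D_b K) z).
  have hB a b : - (C * (`|a| * `|b|)) <= B a b by rewrite BE; exact: lerNnormlW (hC z a b zM).
  have hq : t0 * `|q| ^+ 2 <= B (0, q) (0, q) by rewrite BE; exact: ht.
  have dd v : is_derive z v (fun y => 'D_((d, 0) : P) K y + 'D_((0, q) : P) K y) (B v (d, 0) + B v (0, q)).
    by rewrite !BE; exact: is_deriveD (C1_is_derive z v c1) (C1_is_derive z v c2).
  have [_ ->] := dd (d, 0); have [_ ->] := dd (0, q).
  have nd : `|((d, 0) : P)| = `|d| by rewrite prod_normE/= normr0; apply/max_idPl.
  have nq : `|((0, q) : P)| = `|q| by rewrite prod_normE/= normr0; apply/max_idPr.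
  have := hB (d, 0) (d, 0); have := hB (d, 0) (0, q); have := hB (0, q) (d, 0); rewrite nd nq.
  move: (B (d, 0) (d, 0)) (B (d, 0) (0, q)) (B (0, q) (d, 0)) (B (0, q) (0, q)) hq => A1 A2 A3 A4.
  have : 2 * C * (`|d| * `|q|) <= t0 / 2 * `|q| ^+ 2 + 2 * C ^+ 2 / t0 * `|d| ^+ 2.
    have : 0 <= (t0 * `|q| - 2 * C * `|d|) ^+ 2 / (2 * t0).
      by rewrite divr_ge0 ?sqr_ge0// mulr_ge0// ltW.
    have -> : (t0 * `|q| - 2 * C * `|d|) ^+ 2 / (2 * t0) =
      t0 / 2 * `|q| ^+ 2 + 2 * C ^+ 2 / t0 * `|d| ^+ 2 - 2 * C * (`|d| * `|q|).
      by field; exact: lt0r_neq0.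
    lra.
  rewrite (mulrC `|q| `|d|) -[`|d| * `|d|]expr2; lra.
have N0 : 0 <= n%:R :> R by rewrite ler0n.
(* Each remainder contributes [(1/2) (t0/2) |(p - q)/2|^2], hence [t0/8] for the two; the factor
   [n + 1] passes from the sup norm to [sqn]. *)
exists (t0 / 8 / (n%:R + 1)), (C + 2 * C ^+ 2 / t0 + L); split.
- by rewrite !divr_gt0// ltr_wpDl.
- by rewrite addr_gt0// addr_gt0// divr_gt0// mulr_gt0// exprn_gt0.
move=> x y z p q pM qM.
pose m : P := (2^-1 *: (x + y), 2^-1 *: (p + q)).
pose w : P := (2^-1 *: (x - y), 2^-1 *: (p - q)).
have half (a b : 'rV[R]_n) : 2^-1 *: (a + b) + 2^-1 *: (a - b) = a.
  by apply/rowP => i; rewrite !mxE; lra.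
have half' (a b : 'rV[R]_n) : 2^-1 *: (a + b) - 2^-1 *: (a - b) = b.
  by apply/rowP => i; rewrite !mxE; lra.
have halfz : 2^-1 *: (x + y) - z = 2^-1 *: (x + y - 2 *: z).
  by apply/rowP => i; rewrite !mxE; lra.
have e1 : (x, p) = m + w by rewrite -[RHS]/(_ + _, _ + _) !half.
have e2 : (y, q) = m + - w by rewrite -[RHS]/(_ - _, _ - _) !half'.
have mM : `|m.2| <= M.
  rewrite /= normrZ ger0_norm; last lra.
  have := ler_normD p q; lra.
have h20 : 0 <= 2^-1 :> R by lra.
have := lerNnormlW (hL (z, 2^-1 *: (p + q)) m mM mM).
have -> : m - (z, 2^-1 *: (p + q)) = (2^-1 *: (x + y - 2 *: z), 0).
  by rewrite -[LHS]/(_ - _, _ - _) subrr halfz.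
rewrite prod_normE/= normr0 (_ : Num.max _ 0 = `|2^-1 *: (x + y - 2 *: z)|); last by apply/max_idPl.
rewrite normrZ (ger0_norm h20) => b3.
have q1 : sqn (p - q) / (n%:R + 1) <= `|p - q| ^+ 2.
  rewrite ler_pdivrMr ?ltr_wpDl//.
  have := sqn_le_norm (p - q); have : 0 <= `|p - q| ^+ 2 by exact: sqr_ge0.
  clear; lra.
have cc : 0 <= C + 2 * C ^+ 2 / t0.
  by rewrite addr_ge0 ?(ltW C0)// divr_ge0 ?(ltW t00)// mulr_ge0// sqr_ge0.
set c1 := C + _ in cc D2 *; clearbody c1.
have c2 : c1 * `|x - y| ^+ 2 <= c1 * sqn (x - y) by rewrite ler_wpM2l// norm_sqn.
have c3 : t0 * (sqn (p - q) / (n%:R + 1)) <= t0 * `|p - q| ^+ 2 by rewrite ler_wpM2l// ltW.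
have := normr_ge0 (x + y - 2 *: z); set r := `|_ + _ - _| in b3 * => r0; clearbody r.
have c4 : 0 <= c1 * r by rewrite mulr_ge0.
have c5 : 0 <= L * sqn (x - y) by rewrite mulr_ge0 ?sqn_ge0// ltW.
have c6 : 0 <= c1 * sqn (x - y) by rewrite mulr_ge0 ?sqn_ge0.
have [s1 s101 T1] := C2_taylor m w cK.
have [s2 s201 T2] := C2_taylor m (- w) cK.
have df := C1_differentiable m (C2_C1 cK).
have eN : 'D_(- w) ('D_(- w) K) (m + s2 *: - w) = 'D_w ('D_w K) (m + s2 *: - w).
  have -> : 'D_(- w) K = fun y => - 'D_w K y.
    apply/funext => a; rewrite -scaleN1r deriveZdir ?scaleN1r//.
    by apply: C1_differentiable; exact: C2_C1.
  have cw : C1 ('D_w K) by exact: C2_D.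
  rewrite -[- w in LHS]scaleN1r deriveZdir; last by apply: C1_differentiable; exact: C1N.
  rewrite deriveN ?scaleN1r ?opprK//.
  by apply: diff_derivable; exact: C1_differentiable.
have eD : 'D_(- w) K m = - 'D_w K m by rewrite -[- w]scaleN1r (deriveZdir _ _ df) scaleN1r.
rewrite e1 e2 T1 T2 eN eD.
have b1 := D2 (m + s1 *: w) (2^-1 *: (x - y)) (2^-1 *: (p - q)).
have b2 := D2 (m + s2 *: - w) (2^-1 *: (x - y)) (2^-1 *: (p - q)).
have M1 : `|(m + w).2| <= M by rewrite -e1.
have M2 : `|(m + - w).2| <= M by rewrite -e2.
have {}b1 := b1 (slab_segment mM M1 s101); have {}b2 := b2 (slab_segment mM M2 s201).
move: b1 b2; rewrite !normrZ !(ger0_norm h20) => b1 b2.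
have -> : t0 / 8 / (n%:R + 1) * sqn (p - q) = t0 * (sqn (p - q) / (n%:R + 1)) / 8.
  by field; rewrite lt0r_neq0// ltr_wpDl.
rewrite -/w in b1 b2 *.
move: b1 b2 b3 c2 c3 c4 c5 c6; rewrite !exprMn.
move: ('D_w ('D_w K) (m + s1 *: w)) ('D_w ('D_w K) (m + s2 *: - w)) ('D_w K m) (K m) (K (z, _)) => A1 A2 A3 A4 A5.
move: (t0 * (sqn (p - q) / _)) (sqn (x - y)) (`|x - y| ^+ 2) (`|p - q| ^+ 2) => B1 B2 B3 B4.
by move: r0 L0 cc; clear; intros; lra.
Qed.

(** Coercivity is given at each [x] separately. An inequality on one sphere of momenta persists for
    nearby [x], convexity propagates it outwards along rays, and the unit ball is covered by such
    neighbourhoods. *)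
Lemma uniformly_coercive K : C2 K -> x_periodic K ->
  (forall (z : P) (q : 'rV[R]_n), q != 0 -> 0 < dotp (q *m Dpp K z) q) ->
  (forall (x : 'rV[R]_n) (A : R), exists M : R,
     forall p : 'rV[R]_n, M < `|p| -> A < K (x, p)) ->
  forall A : R, exists M : R, forall x p : 'rV[R]_n, M < `|p| -> A < K (x, p).
Proof.
move=> cK pK pos sl A.
have cK0 : continuous K by exact/C1_cts/C2_C1.
have [B B0 hB] := slab_bounded 0 cK0 pK.
(* Exceeding the bound [B] of [K] at zero momentum forces a positive slope somewhere before [s]; by
   convexity the slope stays positive after it. *)
have ray (x p : 'rV[R]_n) (s : R) : 0 < s <= 1 -> B < K (x, s *: p) -> K (x, s *: p) <= K (x, p).
  move=> /andP[s0 s1] hs.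
  pose w : P := (0, p).
  have ew t : (x, 0) + t *: w = (x, t *: p) :> P.
    by rewrite -[LHS]/(x + t *: 0, 0 + t *: p) scaler0 addr0 add0r.
  have dg t := C1_is_derive_line (x, 0) w t (C2_C1 cK).
  have dg2 t := C1_is_derive_line (x, 0) w t (C2_D w cK).
  have [c /andP[c0 cs] ec] := mvt (ltW s0) (fun t _ => dg t).
  have [c' /andP[c0' cs'] ec'] := mvt s1 (fun t _ => dg t).
  have [c'' _ ec''] := mvt (le_trans cs c0') (fun t _ => dg2 t).
  have pos2 : 0 <= 'D_w ('D_w K) ((x, 0) + c'' *: w).
    rewrite -Dpp_second_derivative//; have [->|p0] := eqVneq p 0; last exact/ltW/pos.
    by rewrite mul0mx dotp0l.
  move: ec ec' ec''; rewrite !ew scale1r scale0r subr0.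
  have : K (x, 0) <= B by apply: le_trans (ler_norm _) _; apply: hB; rewrite /= normr0.
  move: hs pos2; rewrite ew; move: ('D_w K (x, c *: p)) ('D_w K (x, c' *: p)) ('D_w ('D_w K) _) => D1 D2 D3.
  move=> h1 h2 h3 h4 h5 h6.
  have D10 : 0 < D1.
    rewrite -(pmulr_lgt0 _ s0) -h4 subr_gt0; exact: le_lt_trans h1.
  have : 0 <= D2 * (1 - s); last by lra.
  rewrite mulr_ge0 ?subr_ge0//; have : 0 <= D3 * (c' - c) by rewrite mulr_ge0// subr_ge0 (le_trans cs).
  lra.
(* Above [A], the value to be propagated, and above [B], so that [ray] applies. *)
pose A1 := `|A| + B.
have A1A : A <= A1 by rewrite /A1; have := ler_norm A; lra.
have A1B : B <= A1 by rewrite /A1; have := normr_ge0 A; lra.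
have /compact_near_coveringP cov := @compact_cball R n 1.
have : \forall M \near +oo, [set x : 'rV[R]_n | `|x| <= 1] `<=` (fun x => forall p, M < `|p| -> A < K (x, p)).
  apply: cov => x0 _.
  have [M0 hM0] := sl x0 A1.
  pose R0 := `|M0| + 1.
  have R00 : 0 < R0 by rewrite /R0 ltr_wpDl.
  have cS : compact [set p : 'rV[R]_n | `|p| = R0].
    rewrite (_ : mkset _ = [set p : 'rV[R]_n | `|p| <= R0] `&` [set p | `|p| = R0]).
      apply: compact_closedI; first exact: compact_cball.
      have /continuous_closedP/(_ [set r : R | r = R0])/(_ (@closed_eq _ _)) :
        continuous (fun x : 'rV[R]_n => `|x|) by apply: cts_norm; exact: cts_id.
      exact.
    by rewrite eqEsubset; split => q /=; [move=> ->|case].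
  have [/= d d0 hd] : exists2 d : R, 0 < d & forall x, `|x - x0| < d -> forall p, `|p| = R0 -> A1 < K (x, p).
    have [S0|S0] := pselect ([set p : 'rV[R]_n | `|p| = R0] !=set0); last first.
      by exists 1 => // x _ p pR; case: S0; exists p.
    have cm : continuous (fun p : 'rV[R]_n => - K (x0, p)).
      apply: ctsN; apply: (cts_comp cK0); apply: cts_pair; [exact: cts_cst|exact: cts_id].
    have [p1 /= p1R hp1] := max_compact S0 cS cm.
    have e0 : 0 < K (x0, p1) - A1.
      by rewrite subr_gt0; apply: hM0; rewrite p1R /R0; have := ler_norm M0; lra.
    have cS1 : compact ([set x0] `*` [set p : 'rV[R]_n | `|p| = R0]).
      by apply: compact_setX => //; exact: compact_set1.
    have [d d0 hd] := uniform_on_compact cS1 cK0 e0.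
    exists d => // x xd p pR.
    have := hd (x0, p) (x, p).
    rewrite (_ : (x, p) - (x0, p) = (x - x0, 0) :> P); last by rewrite -[LHS]/(_ - _, _ - _) subrr.
    rewrite prod_normE/= normr0 (_ : Num.max _ 0 = `|x - x0|); last by apply/max_idPl.
    move=> /(_ (conj erefl pR) xd); rewrite ltr_norml => /andP[h1 _].
    have := hp1 p pR; move: h1; rewrite lerN2; lra.
  exists ([set x | `|x - x0| < d], [set M | R0 < M]) => /=.
    have nb := (near_eps x0 (fun x => `|x - x0| < d)).2 (ex_intro2 _ _ d d0 (fun w h => h)).
    by split; [exact: nb|exists R0; split => //; rewrite num_real].
  case=> x M /= [xd MR] p pM.
  have p0 : 0 < `|p| by apply: lt_trans pM; apply: lt_trans MR.
  have sR : `|(R0 / `|p|) *: p| = R0.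
    by rewrite normrZ normrM normfV normr_id mulfVK ?gtr0_norm// lt0r_neq0.
  have hs := hd x xd _ sR.
  apply: lt_le_trans (ray x p (R0 / `|p|) _ _).
  - exact: le_lt_trans A1A hs.
  - by rewrite divr_gt0//= ler_pdivrMr// mul1r ltW// (lt_trans MR).
  - exact: le_lt_trans A1B hs.
case=> M [_ hM]; exists (M + 1) => x p pM.
have [k hk] := reduce_mod_Zn x.
have := hM (M + 1) _ (x + map_mx intr k) hk p pM.
by rewrite pK; apply; rewrite ltrDl.
Qed.

(** All that the viscosity arguments use of a Tonelli Hamiltonian. No derivative appears and each
    clause is stable under [p -> - p], so that it covers [H] as well as [(x, p) -> - G (x, - p)].
    The constants are local in the momentum, which Lipschitz solutions keep bounded. *)
Definition tame K := [/\ continuous K, x_periodic K,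
  forall A : R, exists M : R, forall x p : 'rV[R]_n, M < `|p| -> A < K (x, p) &
  forall M : R, exists th C : R, [/\ 0 < th, 0 < C,
    forall x y z p q : 'rV[R]_n, `|p| <= M -> `|q| <= M ->
      th * sqn (p - q) <= K (x, p) + K (y, q) - 2 * K (z, 2^-1 *: (p + q))
      + C * sqn (x - y) + C * `|x + y - 2 *: z| &
    forall x p q : 'rV[R]_n, `|p| <= M -> `|q| <= M -> `|K (x, p) - K (x, q)| <= C * `|p - q|]].

Lemma tonelli_tame K : x_periodic K -> tonelli K -> tame K.
Proof.
move=> pK [cK sl pos]; split => //; first exact/C1_cts/C2_C1.
  apply: uniformly_coercive => // x A.
  (* With [|p| > 1], a quotient above the absolute value of [A] gives a value of [K] above [A]. *)
  have [M hM] := sl x (`|A|); exists (Num.max M 1) => p; rewrite gt_max => /andP[/hM h p1].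
  have p0 : 0 < `|p| by lra.
  rewrite ltr_pdivlMr// in h.
  have := ler_norm A; have := normr_ge0 A; nra.
move=> M; have [th [C [th0 C0 hC]]] := tonelli_midpoint M cK pK pos.
have [L L0 hL] := C1_slab_lip M (C2_C1 cK) pK.
exists th, (C + L); split => //; first by rewrite addr_gt0.
  move=> x y z p q pM qM; have := hC x y z p q pM qM.
  have : 0 <= L * sqn (x - y) by rewrite mulr_ge0 ?sqn_ge0// ltW.
  have : 0 <= L * `|x + y - 2 *: z| by rewrite mulr_ge0// ltW.
  lra.
move=> x p q pM qM; have := hL (x, q) (x, p) qM pM.
rewrite (_ : (x, p) - (x, q) = (0, p - q) :> P); last by rewrite -[LHS]/(_ - _, _ - _) subrr.
rewrite prod_normE/= normr0 (_ : Num.max 0 _ = `|p - q|); last by apply/max_idPr.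
by move=> /le_trans; apply; rewrite ler_wpM2r// lerDr ltW.
Qed.

Lemma tame_flip K : tame K -> tame (fun z => K (z.1, - z.2)).
Proof.
move=> [cK pK co md]; split.
- apply: (cts_comp cK); apply: cts_pair; first by apply: cts_fst; exact: cts_id.
  by apply: ctsN; apply: cts_snd; exact: cts_id.
- by move=> p x k /=; apply: pK.
- by move=> A; have [M hM] := co A; exists M => x p pM /=; apply: hM; rewrite normrN.
move=> M; have [th [C [th0 C0 h1 h2]]] := md M.
exists th, C; split => // [x y z p q pM qM|x p q pM qM] /=.
  have := h1 x y z (- p) (- q); rewrite !normrN => /(_ pM qM).
  have -> : 2^-1 *: (- p - q) = - (2^-1 *: (p + q)) by rewrite -opprD scalerN.
  by rewrite -[- p - - q]opprD sqnN.
have := h2 x (- p) (- q); rewrite !normrN => /(_ pM qM).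
by rewrite -[- p - - q]opprD normrN.
Qed.

End TonelliEstimates.

(** * Quadratic jets and the comparison principle *)

Section Jets.
Context {R : realType} {n : nat}.
Notation P := ('rV[R]_n * 'rV[R]_n)%type.
Implicit Types (K : P -> R) (v : R -> 'rV[R]_n -> R).

(** A one-sided expansion with quadratic error instead of a test function: penalized maxima produce
    exactly this, with no periodicity to check. The neighbourhood is full in time, whence the
    restriction to positive times in [jet_sub]. *)
Definition superjet v (t0 : R) (x0 : 'rV[R]_n) (a : R) (p : 'rV[R]_n) :=
  exists M r : R, 0 < r /\ forall t x, `|t - t0| < r -> `|x - x0| < r ->
    v t x <= v t0 x0 + a * (t - t0) + dotp p (x - x0) + M * ((t - t0) ^+ 2 + sqn (x - x0)).

Definition subjet v (t0 : R) (x0 : 'rV[R]_n) (a : R) (p : 'rV[R]_n) :=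
  exists M r : R, 0 < r /\ forall t x, `|t - t0| < r -> `|x - x0| < r ->
    v t0 x0 + a * (t - t0) + dotp p (x - x0) <= v t x + M * ((t - t0) ^+ 2 + sqn (x - x0)).

Definition jet_sub K v := forall t x a p, 0 < t -> superjet v t x a p -> a + K (x, p) <= 0.
Definition jet_super K v := forall t x a p, 0 < t -> subjet v t x a p -> 0 <= a + K (x, p).

Definition jcont v := continuous (fun z : R * 'rV[R]_n => v z.1 z.2).
Definition sper v := forall t, Zn_periodic (v t).

Lemma jcont_comp (T : topologicalType) v (f : T -> R) (g : T -> 'rV[R]_n) :
  jcont v -> continuous f -> continuous g -> continuous (fun z => v (f z) (g z)).
Proof. by move=> cv cf cg; apply: (cts_comp cv (cts_pair cf cg)). Qed.

Lemma strip_bounded v (T : R) : jcont v -> sper v ->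
  exists2 B : R, 0 < B & forall t x, 0 <= t <= T -> `|v t x| <= B.
Proof.
move=> cv pv.
have [B B0 hB] := bounded_on_compact (compact_setX (@compact_itv_le R 0 T) (@compact_cball R n 1)) cv.
exists B => // t x tT; have [k hk] := reduce_mod_Zn x.
by rewrite -(pv t x k); apply: (hB (t, _)).
Qed.

Lemma strip_uniform v (T e : R) : jcont v -> sper v -> 0 < e ->
  exists2 d : R, 0 < d & forall t s x y, 0 <= t <= T -> `|s - t| < d -> `|y - x| < d ->
    `|v s y - v t x| < e.
Proof.
move=> cv pv e0.
have [d d0 hd] := uniform_on_compact (compact_setX (@compact_itv_le R 0 T) (@compact_cball R n 1)) cv e0.
exists d => // t s x y tT st yx; have [k hk] := reduce_mod_Zn x.
rewrite -(pv t x k) -(pv s y k); apply: (hd (t, _) (s, _)) => //.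
by rewrite prod_normE gt_max/= st/= opprD addrACA subrr addr0.
Qed.

Lemma slab_uniform K (M e : R) : continuous K -> x_periodic K -> 0 < e ->
  exists2 d : R, 0 < d & forall x y p : 'rV[R]_n, `|p| <= M -> `|y - x| < d ->
    `|K (y, p) - K (x, p)| < e.
Proof.
move=> cK pK e0.
have [d d0 hd] := uniform_on_compact (compact_setX (@compact_cball R n 1) (@compact_cball R n M)) cK e0.
exists d => // x y p pM yx; have [k hk] := reduce_mod_Zn x.
rewrite -(pK p x k) -(pK p y k); apply: (hd (_, p) (_, p)) => //.
by rewrite prod_normE gt_max/= subrr normr0 d0 andbT opprD addrACA subrr addr0.
Qed.

(** A C^{1,1} barrier in time: zero up to a chosen time, large after it once multiplied by a
    constant, it keeps maxima away from the end of the time interval. Its nonnegative slope has the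
    favourable sign in the viscosity inequalities. *)
Definition sqpos (s : R) : R := Num.max 0 s ^+ 2.

Lemma sqpos_ge0 s : 0 <= sqpos s.
Proof. exact: sqr_ge0. Qed.

Lemma sqpos0 s : s <= 0 -> sqpos s = 0.
Proof. by rewrite /sqpos => s0; rewrite (_ : Num.max 0 s = 0) ?expr0n//; apply/max_idPl. Qed.

Lemma sqpos_ge1 s : 1 <= s -> 1 <= sqpos s.
Proof.
move=> s1; rewrite /sqpos (_ : Num.max 0 s = s) ?exprn_ege1//.
by apply/max_idPr; lra.
Qed.

Lemma sqpos_taylor s h : sqpos (s + h) <= sqpos s + 2 * Num.max 0 s * h + h ^+ 2.
Proof. rewrite /sqpos; case: (lerP 0 s) => h1; case: (lerP 0 (s + h)) => h2; nra. Qed.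

Lemma sqpos_cts : continuous sqpos.
Proof.
rewrite (_ : sqpos = fun s => Num.max 0 s * Num.max 0 s); last by apply/funext => s; rewrite /sqpos expr2.
by apply: ctsM; apply: cts_max; (exact: cts_cst || exact: cts_id).
Qed.

Lemma sqrt_small (x y : R) : 0 < y -> x ^+ 2 < y ^+ 2 -> `|x| < y.
Proof.
by move=> y0 h; rewrite -(ltr_pXn2r (n := 2))// ?nnegrE ?ltW// -normrX ger0_norm ?sqr_ge0.
Qed.

Lemma sqn_small (x : 'rV[R]_n) (y : R) : 0 < y -> sqn x < y ^+ 2 -> `|x| < y.
Proof.
move=> y0 h; rewrite -[`|x|]ger0_norm//; apply: sqrt_small => //.
exact: le_lt_trans (norm_sqn x) h.
Qed.

(* The penalization in time is fixed before the one in space: it bounds the time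
   component of the jet, hence the momentum by coercivity, uniformly in the
   penalization in space. *)
Lemma jet_comparison K v1 v2 (c : R) : tame K -> jcont v1 -> jcont v2 -> sper v1 -> sper v2 ->
  jet_sub K v1 -> jet_super K v2 -> (forall x, v1 0 x <= v2 0 x + c) ->
  forall t x, 0 <= t -> v1 t x <= v2 t x + c.
Proof.
move=> tK c1 c2 p1 p2 s1 s2 h0 ts xs ts0; rewrite leNgt; apply/negP => hlt.
(* A third of the gap: one part pays for [lam], and at least [2 * eta] remains at the maximum. At
   time 0 the ordering of the data and a variation below [eta] would allow less than [eta]. *)
pose eta := (v1 ts xs - v2 ts xs - c) / 3.
have eta0 : 0 < eta by rewrite /eta; lra.
have etaE : v1 ts xs - v2 ts xs - c = 3 * eta by rewrite /eta; lra.
clearbody eta.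
have [B1 B10 hB1] := strip_bounded (ts + 2) c1 p1.
have [B2 B20 hB2] := strip_bounded (ts + 2) c2 p2.
pose B := B1 + B2 + `|c|.
have B0 : 0 < B by rewrite /B ltr_pwDl// addr_gt0.
have hB t s x y : 0 <= t <= ts + 2 -> 0 <= s <= ts + 2 -> v1 t x - v2 s y - c <= B.
  move=> tT sT; have h1 := ler_normlW (hB1 t x tT); have h2 := lerNnormlW (hB2 s y sT); rewrite /B.
  by have := lerNnormlW (lexx `|c|); move: h1 h2; clear -n; lra.
clearbody B.
pose lam := eta / (ts + 1).
have lam0 : 0 < lam by rewrite divr_gt0// ltr_wpDl.
have lamts : lam * ts <= eta.
  by rewrite /lam mulrAC ler_pdivrMr ?ltr_wpDl//; move: eta0 ts0; clear -n; nra.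
clearbody lam.
have [d1 d10 hd1] := strip_uniform (ts + 2) c1 p1 eta0.
have [d2 d20 hd2] := strip_uniform (ts + 2) c2 p2 eta0.
have [d [d0 dd1 dd2]] := exists_lt_min d10 d20.
have [d' [d'0 dd' d'1]] := exists_lt_min d0 (ltr01 : 0 < 1 :> R).
(* [B] bounds the difference to be maximized, so this factor forces the two times within [d'] of
   each other; [g] likewise forces the two points within [e]. *)
pose b := (B + 1) / d' ^+ 2.
have b0 : 0 < b by rewrite divr_gt0 ?exprn_gt0// addr_gt0.
have bE : B < b * d' ^+ 2 by rewrite /b divfK ?lt0r_neq0 ?exprn_gt0//; lra.
clearbody b.
have [cK pK co _] := tK.
(* The time component of the jet will be at least [- 2 b d'], and beyond [M] the Hamiltonian exceeds
   [2 b d']: the momentum is at most [M] whatever [g] is, so [d3], hence [g], may depend on [M]. *)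
have [M hM] := co (2 * b * d').
have [d3 d30 hd3] := slab_uniform M cK pK lam0.
have [e [e0 ed' ed3]] := exists_lt_min d'0 d30.
pose g := (B + 1) / e ^+ 2.
have g0 : 0 < g by rewrite divr_gt0 ?exprn_gt0// addr_gt0.
have gE : B < g * e ^+ 2 by rewrite /g divfK ?lt0r_neq0 ?exprn_gt0//; lra.
clearbody g.
pose psi t := lam * t + (B + 1) * sqpos (t - ts).
pose Phi t s x y := v1 t x - v2 s y - c - psi t - b * (t - s) ^+ 2 - g * sqn (x - y).
(* The second point is encoded as [x0 + e1] with both vectors in the unit ball; by periodicity this
   reaches every pair at distance at most 1. *)
have [[[t0 x0] [s0 e1]] [[/= t0T x01] [/= s0T e11]] hmax] :
  exists2 m : (R * 'rV[R]_n) * (R * 'rV[R]_n),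
   (([set t : R | 0 <= t <= ts + 2] `*` [set x : 'rV[R]_n | `|x| <= 1]) `*`
    ([set t : R | 0 <= t <= ts + 2] `*` [set x : 'rV[R]_n | `|x| <= 1])) m &
   forall m', (([set t : R | 0 <= t <= ts + 2] `*` [set x : 'rV[R]_n | `|x| <= 1]) `*`
    ([set t : R | 0 <= t <= ts + 2] `*` [set x : 'rV[R]_n | `|x| <= 1])) m' ->
   Phi m'.1.1 m'.2.1 m'.1.2 (m'.1.2 + m'.2.2) <= Phi m.1.1 m.2.1 m.1.2 (m.1.2 + m.2.2).
  apply: max_compact.
  - have t2 : 0 <= ts + 2 by lra.
    by exists ((0, 0), (0, 0)); split; split => /=; rewrite ?normr0 ?lexx.
  - by apply: compact_setX; apply: compact_setX; (exact: compact_itv_le || exact: compact_cball).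
  - have c11 : continuous (fun m : (R * 'rV[R]_n) * (R * 'rV[R]_n) => m.1.1).
      by apply: cts_fst; apply: cts_fst; exact: cts_id.
    have c12 : continuous (fun m : (R * 'rV[R]_n) * (R * 'rV[R]_n) => m.1.2).
      by apply: cts_snd; apply: cts_fst; exact: cts_id.
    have c21 : continuous (fun m : (R * 'rV[R]_n) * (R * 'rV[R]_n) => m.2.1).
      by apply: cts_fst; apply: cts_snd; exact: cts_id.
    have c22 : continuous (fun m : (R * 'rV[R]_n) * (R * 'rV[R]_n) => m.2.2).
      by apply: cts_snd; apply: cts_snd; exact: cts_id.
    have cd := ctsB c11 c21.
    rewrite /Phi /psi; apply: ctsB; [apply: ctsB; [apply: ctsB; [apply: ctsB; [apply: ctsB|]|]|]|].
    + exact: (jcont_comp c1 c11 c12).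
    + exact: (jcont_comp c2 c21 (ctsD c12 c22)).
    + exact: cts_cst.
    + apply: ctsD; apply: ctsM; (try exact: cts_cst) => //.
      by apply: (cts_comp sqpos_cts); apply: ctsB => //; exact: cts_cst.
    + exact: (ctsM (cts_cst (c := _)) (ctsM cd cd)).
    + exact: (ctsM (cts_cst (c := _)) (cts_sqn (ctsB c12 (ctsD c12 c22)))).
pose y0 := x0 + e1.
have H t s x y : 0 <= t <= ts + 2 -> 0 <= s <= ts + 2 -> `|y - x| <= 1 ->
    Phi t s x y <= Phi t0 s0 x0 y0.
  move=> tT sT yx; have [k hk] := reduce_mod_Zn x.
  have := hmax ((t, x + map_mx intr k), (s, y - x)) (conj (conj tT hk) (conj sT yx)).
  rewrite /= (_ : x + map_mx intr k + (y - x) = y + map_mx intr k); last by rewrite addrAC subrKC.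
  have ek : x + map_mx intr k - (y + map_mx intr k) = x - y by rewrite opprD addrACA subrr addr0.
  by rewrite /Phi p1 p2 ek.
have Hs : 2 * eta <= Phi t0 s0 x0 y0.
  have tsT : 0 <= ts <= ts + 2 by rewrite ts0/=; lra.
  apply: le_trans (H ts ts xs xs tsT tsT _); last by rewrite subrr normr0.
  by rewrite /Phi /psi !subrr sqn0 sqpos0// expr0n/=; move: etaE lamts; clear -n; lra.
have q0 := sqpos_ge0 (t0 - ts).
have psi0 : 0 <= psi t0.
  rewrite /psi addr_ge0// mulr_ge0// ?(ltW lam0)//; first by case/andP: t0T.
  by rewrite ltW// addr_gt0.
have bb := hB t0 s0 x0 y0 t0T s0T.
have n1 : 0 <= b * (t0 - s0) ^+ 2 by rewrite mulr_ge0 ?sqr_ge0// ltW.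
have n2 : 0 <= g * sqn (x0 - y0) by rewrite mulr_ge0 ?sqn_ge0// ltW.
have ts0d : `|t0 - s0| < d'.
  apply: sqrt_small => //; rewrite -(ltr_pM2l b0); apply: le_lt_trans bE.
  by move: Hs psi0 bb n1 n2 eta0; rewrite /Phi; clear -n; lra.
have xy0 : `|x0 - y0| < e.
  apply: sqn_small => //; rewrite -(ltr_pM2l g0); apply: le_lt_trans gE.
  by move: Hs psi0 bb n1 n2 eta0; rewrite /Phi; clear -n; lra.
have t0ts : t0 < ts + 1.
  rewrite ltNge; apply/negP => h; have q1 : 1 <= sqpos (t0 - ts) by apply: sqpos_ge1; lra.
  have : (B + 1) * 1 <= (B + 1) * sqpos (t0 - ts) by rewrite ler_wpM2l// ltW// addr_gt0.
  have : 0 <= lam * t0 by rewrite mulr_ge0 ?(ltW lam0)//; case/andP: t0T.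
  by move: Hs bb n1 n2 eta0; rewrite /Phi /psi; clear -n; lra.
have big : 2 * eta <= v1 t0 x0 - v2 s0 y0 - c by move: Hs psi0 n1 n2; rewrite /Phi; clear -n; lra.
have t00 : 0 < t0.
  rewrite lt_neqAle; apply/andP; split; last by case/andP: t0T.
  apply/eqP => t0E; have := hd2 t0 s0 x0 y0 t0T; rewrite distrC => /(_ (lt_trans ts0d (lt_trans dd' dd2))).
  rewrite distrC => /(_ (lt_trans xy0 (lt_trans ed' (lt_trans dd' dd2)))).
  have := h0 x0; rewrite t0E => h; rewrite ltr_norml => /andP[+ _].
  by move: h big eta0; rewrite -t0E; clear -n; lra.
have s00 : 0 < s0.
  rewrite lt_neqAle; apply/andP; split; last by case/andP: s0T.
  apply/eqP => s0E; have := hd1 s0 t0 y0 x0 s0T (lt_trans ts0d (lt_trans dd' dd1)).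
  move=> /(_ (lt_trans xy0 (lt_trans ed' (lt_trans dd' dd1)))).
  have := h0 y0; rewrite s0E => h; rewrite ltr_norml => /andP[_ +].
  by move: h big eta0; rewrite -s0E; clear -n; lra.
have s0ts : s0 < ts + 2 by move: ts0d d'1 t0ts; rewrite ltr_norml => /andP[]; clear -n; lra.
have y0x0 : `|y0 - x0| < 1 by rewrite distrC; move: xy0 ed' d'1; clear -n; lra.
have J1 : superjet v1 t0 x0 (lam + (B + 1) * (2 * Num.max 0 (t0 - ts)) + b * (2 * (t0 - s0)))
    ((2 * g) *: (x0 - y0)).
  exists (B + 1 + b + g), (Num.min (Num.min t0 1) (1 - `|y0 - x0|)); split.
    by rewrite !lt_min t00 ltr01 subr_gt0.
  move=> t x; rewrite !lt_min => /andP[/andP[tt0 tt1] _] /andP[_ xx].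
  have tT : 0 <= t <= ts + 2.
    by move: tt0 tt1 t0ts; rewrite !ltr_norml => /andP[+ _] /andP[_ +]; clear -n; lra.
  have yx : `|y0 - x| <= 1.
    rewrite -(subrKA x0); apply: le_trans (ler_normD _ _) _.
    by rewrite (distrC x0); move: xx; clear -n; lra.
  have := H t s0 x y0 tT s0T yx; rewrite /Phi /psi.
  have -> : t - s0 = (t0 - s0) + (t - t0) by ring.
  have -> : x - y0 = (x0 - y0) + (x - x0) by rewrite [RHS]addrC subrKA.
  have -> : t - ts = (t0 - ts) + (t - t0) by ring.
  have := sqpos_taylor (t0 - ts) (t - t0).
  rewrite sqnD dotpZl.
  have := sqn_ge0 (x - x0); have := sqr_ge0 (t - t0).
  move: (sqpos (t0 - ts + _)) (sqpos (t0 - ts)) (Num.max _ _) (sqn (x - x0)) (sqn (x0 - y0)) (dotp _ _) => S1 S2 mx Q1 Q2 D.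
  move=> a1 a2 a3.
  have : (B + 1) * S1 <= (B + 1) * (S2 + 2 * mx * (t - t0) + (t - t0) ^+ 2) by rewrite ler_wpM2l// ltW// addr_gt0.
  have : 0 <= (B + 1 + b) * Q1 by rewrite mulr_ge0// ltW// !addr_gt0.
  have : 0 <= g * (t - t0) ^+ 2 by rewrite mulr_ge0// ltW.
  by clear -n; lra.
have J2 : subjet v2 s0 y0 (b * (2 * (t0 - s0))) ((2 * g) *: (x0 - y0)).
  exists (b + g), (Num.min (Num.min s0 (ts + 2 - s0)) (1 - `|y0 - x0|)); split.
    by rewrite !lt_min s00 !subr_gt0 s0ts.
  move=> s y; rewrite !lt_min => /andP[/andP[ss0 ss1] _] /andP[_ yy].
  have sT : 0 <= s <= ts + 2.
    by move: ss0 ss1; rewrite !ltr_norml => /andP[+ _] /andP[_ +]; clear -n; lra.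
  have yx : `|y - x0| <= 1.
    rewrite -(subrKA y0); apply: le_trans (ler_normD _ _) _.
    by move: yy; clear -n; lra.
  have := H t0 s x0 y t0T sT yx; rewrite /Phi.
  have -> : t0 - s = (t0 - s0) - (s - s0) by ring.
  have -> : x0 - y = (x0 - y0) - (y - y0) by rewrite opprB addrA subrK.
  rewrite sqnB dotpZl.
  have : 0 <= b * sqn (y - y0) by rewrite mulr_ge0 ?sqn_ge0// ltW.
  have : 0 <= g * (s - s0) ^+ 2 by rewrite mulr_ge0 ?sqr_ge0// ltW.
  move: (sqn (y - y0)) (sqn (x0 - y0)) (dotp _ _) (psi t0) => Q1 Q2 D S.
  by clear -n; lra.
(* Both jets have the same momentum and their time components differ by at least [lam], whereas [K]
   varies by less than [lam] between [x0] and [y0]. *)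
have := s1 _ _ _ _ t00 J1; have := s2 _ _ _ _ s00 J2.
set p := (2 * g) *: _.
have mx0 : 0 <= (B + 1) * (2 * Num.max 0 (t0 - ts)).
  by rewrite !mulr_ge0// ?le_max ?lexx// ltW// addr_gt0.
have bts : - (2 * b * d') <= b * (2 * (t0 - s0)).
  have : b * - d' <= b * (t0 - s0) by rewrite ler_wpM2l ?ltW//; move: ts0d; rewrite ltr_norml => /andP[].
  by clear -n; lra.
move=> k2 k1.
have pM : `|p| <= M.
  rewrite leNgt; apply/negP => /(hM x0); move: k1 mx0 bts lam0; clear -n; lra.
have := hd3 x0 y0 p pM; rewrite distrC => /(_ (lt_trans xy0 ed3)).
by rewrite ltr_norml => /andP[_]; move: k1 k2 mx0; clear -n; lra.
Qed.

End Jets.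

(** * Lipschitz bounds that are uniform in the solution *)

Section LipschitzRegularity.
Context {R : realType} {n : nat}.
Notation P := ('rV[R]_n * 'rV[R]_n)%type.
Implicit Types (K : P -> R) (v : R -> 'rV[R]_n -> R).

Lemma le_small (X Y M r : R) : 0 < r -> (forall h : R, 0 < h -> h < r -> X <= Y + M * h) -> X <= Y.
Proof.
move=> r0 H; rewrite leNgt; apply/negP => YX.
have M1 : 0 < `|M| + 1 by rewrite ltr_wpDl.
have q0 : 0 < (X - Y) / (`|M| + 1) by rewrite divr_gt0// subr_gt0.
have [h [h0 hr hq]] := exists_lt_min r0 q0.
move: hq; rewrite ltr_pdivlMr// => hq.
have := H h h0 hr; have : M * h <= `|M| * h by rewrite ler_wpM2r ?ler_norm// ltW.
by move: hq h0; clear -n; lra.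
Qed.

Lemma subjetN v t x a p : subjet v t x a p <-> superjet (fun t x => - v t x) t x (- a) (- p).
Proof.
split=> -[M [r [r0 H]]]; exists M, r; split => // s y sr yr; have := H s y sr yr; rewrite dotpNl; lra.
Qed.

(** Along a small coordinate step [v] drops at least as much as [dotp p], up to a quadratic error,
    and the one-sided Lipschitz bound limits this drop. *)
Lemma superjet_momentum v t x a p (L : R) : 0 <= L -> superjet v t x a p ->
  (forall y, v t x - v t y <= L * `|y - x|) -> `|p| <= L.
Proof.
move=> L0 [M [r [r0 H]]] vL; apply: norm_le_coord => // i.
have key (s : R) : `|s| <= 1 -> - (s * p 0 i) <= L.
  move=> s1; apply: (@le_small _ _ (`|M| * n%:R) r) => // h h0 hr.
  have nh : `|(h * s) *: delta_mx 0 i : 'rV[R]_n| <= h.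
    rewrite normrZ normrM (gtr0_norm h0) -mulrA ler_piMr ?(ltW h0)//.
    by rewrite mulr_ile1// norm_delta.
  have := H t (x + (h * s) *: delta_mx 0 i); rewrite subrr normr0 => /(_ r0).
  rewrite addrAC subrr add0r dotpZr dotp_delta => /(_ (le_lt_trans nh hr)).
  have := vL (x + (h * s) *: delta_mx 0 i); rewrite addrAC subrr add0r.
  have := sqn_le_bound nh; have := sqn_ge0 ((h * s) *: delta_mx 0 i : 'rV[R]_n).
  set S := sqn _; move=> S0 Sh h1 h2.
  have h3 : L * `|(h * s) *: delta_mx 0 i : 'rV[R]_n| <= L * h by rewrite ler_wpM2l.
  have h4 : M * S <= `|M| * (n%:R * h ^+ 2).
    by apply: le_trans (ler_wpM2l (normr_ge0 M) Sh); rewrite ler_wpM2r ?ler_norm.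
  rewrite -(ler_pM2l h0); move: h1 h2 h3 h4; rewrite expr0n/=; clear -n; nra.
rewrite ler_norml; apply/andP; split.
  by have := key 1; rewrite normr1 => /(_ (lexx _)); lra.
by have := key (- 1); rewrite normrN normr1 => /(_ (lexx _)); lra.
Qed.

Lemma superjet_backward v t x a p (C r : R) : 0 < r -> superjet v t x a p ->
  (forall h, 0 < h -> h < r -> v t x + C * h <= v (t - h) x) -> a <= - C.
Proof.
move=> r0 [M [q [q0 H]]] vC; have [m [m0 mr mq]] := exists_lt_min r0 q0.
apply: (@le_small _ _ M m) => // h h0 hm.
have := H (t - h) x; rewrite addrAC subrr add0r normrN gtr0_norm// subrr normr0 => /(_ (lt_trans hm mq) q0).
rewrite dotp0r sqn0; have := vC h h0 (lt_trans hm mr) => h1 h2.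
by rewrite -(ler_pM2l h0); move: h1 h2; clear -n; lra.
Qed.

Lemma superjet_forward v t x a p (C r : R) : 0 < r -> superjet v t x a p ->
  (forall h, 0 < h -> h < r -> v t x + C * h <= v (t + h) x) -> C <= a.
Proof.
move=> r0 [M [q [q0 H]]] vC; have [m [m0 mr mq]] := exists_lt_min r0 q0.
apply: (@le_small _ _ M m) => // h h0 hm.
have := H (t + h) x; rewrite addrAC subrr add0r gtr0_norm// subrr normr0 => /(_ (lt_trans hm mq) q0).
rewrite dotp0r sqn0; have := vC h h0 (lt_trans hm mr) => h1 h2.
by rewrite -(ler_pM2l h0); move: h1 h2; clear -n; lra.
Qed.

Lemma superjet_time v t x a p (C : R) : 0 < t -> superjet v t x a p ->
  (forall s, 0 <= s -> `|v s x - v t x| <= C * `|s - t|) -> `|a| <= C.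
Proof.
move=> t0 J vC; rewrite ler_norml; apply/andP; split.
  apply: (superjet_forward ltr01 J) => h h0 _.
  have := vC (t + h); rewrite [t + h - t]addrAC subrr add0r (gtr0_norm h0) => /(_ (ltW (addr_gt0 t0 h0))).
  by rewrite ler_norml => /andP[+ _]; clear -n; lra.
rewrite -[leRHS]opprK; apply: (superjet_backward t0 J) => h h0 ht.
have := vC (t - h); rewrite [t - h - t]addrAC subrr add0r normrN (gtr0_norm h0) subr_ge0 => /(_ (ltW ht)).
by rewrite ler_norml => /andP[+ _]; clear -n; lra.
Qed.

Lemma superjet_shift v t x a p (s : R) : superjet (fun t => v (t + s)) t x a p -> superjet v (t + s) x a p.
Proof.
move=> [M [r [r0 H]]]; exists M, r; split => // t' y t'r yr.
have -> : t' - (t + s) = (t' - s) - t by ring.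
have := H (t' - s) y; rewrite subrK; apply => //.
by rewrite -addrA -opprD (addrC s).
Qed.

Lemma jet_sub_shift K v (s : R) : 0 <= s -> jet_sub K v -> jet_sub K (fun t => v (t + s)).
Proof. by move=> s0 H t x a p t0 /superjet_shift; apply: H; rewrite ltr_wpDr. Qed.

Lemma jet_super_shift K v (s : R) : 0 <= s -> jet_super K v -> jet_super K (fun t => v (t + s)).
Proof.
move=> s0 H t x a p t0 /subjetN J; apply: (H (t + s)); first by rewrite ltr_wpDr.
by apply/subjetN; apply: (@superjet_shift (fun t x => - v t x)).
Qed.

Lemma jcont_shift v (s : R) : jcont v -> jcont (fun t => v (t + s)).
Proof.
move=> cv; apply: (@jcont_comp _ _ _ v (fun z : R * 'rV[R]_n => z.1 + s) (fun z => z.2)) => //.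
  by apply: ctsD; [apply: cts_fst; exact: cts_id|exact: cts_cst].
by apply: cts_snd; exact: cts_id.
Qed.

(** Away from 0 the Euclidean norm is touched from above by a quadratic function, since
    [2 N N' <= N^2 + N'^2]. This allows a cone to produce a jet. *)
Lemma euclid_norm_expand (y h : 'rV[R]_n) : y != 0 ->
  Num.sqrt (sqn (y + h)) <= Num.sqrt (sqn y) + (Num.sqrt (sqn y))^-1 * dotp y h
     + (2 * Num.sqrt (sqn y))^-1 * sqn h.
Proof.
move=> y0; have := sqn_gt0 y0; rewrite -sqrtr_gt0.
set N := Num.sqrt (sqn y) => N0; set N' := Num.sqrt (sqn _).
have e1 : N ^+ 2 = sqn y by rewrite sqr_sqrtr ?sqn_ge0.
have e2 : N' ^+ 2 = sqn (y + h) by rewrite sqr_sqrtr ?sqn_ge0.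
rewrite sqnD -e1 in e2.
have -> : N + N^-1 * dotp y h + (2 * N)^-1 * sqn h = (N' ^+ 2 + N ^+ 2) / (2 * N).
  by rewrite e2; field; exact: lt0r_neq0.
rewrite ler_pdivlMr ?mulr_gt0//; have := sqr_ge0 (N' - N); clear -n; lra.
Qed.

(** In time, [v 0 x + C t] and [v 0 x - C t] are barriers, and comparison of [v] with its translates
    carries the bound to all times. The equation and coercivity then bound the momentum of jets,
    which becomes a Lipschitz bound in space by touching [v] with cones. The constants are fixed
    before [v]. *)
Lemma jet_lipschitz K (L : R) : tame K -> 0 <= L -> exists L' C : R, [/\ 0 <= L', 0 <= C &
  forall v, jcont v -> sper v -> jet_sub K v -> jet_super K v ->
  (forall x y, `|v 0 x - v 0 y| <= L * `|x - y|) ->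
  (forall t s x, 0 <= t -> 0 <= s -> `|v t x - v s x| <= C * `|t - s|) /\
  (forall t x y, 0 <= t -> `|v t x - v t y| <= L' * `|x - y|)].
Proof.
move=> tK L0; have [cK pK co _] := tK.
have [C C0 hC] := slab_bounded L cK pK.
have [M hM] := co C.
(* A momentum of sup norm at most [M] has Euclidean length below [L2], whereas a cone of slope [L2]
   produces a jet of length exactly [L2]. *)
pose L2 := (n%:R + 1) * (`|M| + 1).
have L20 : 0 < L2 by rewrite mulr_gt0// ltr_wpDl.
have L2M : n%:R * M ^+ 2 < L2 ^+ 2.
  rewrite -(real_normK (num_real M)) /L2 exprMn.
  have : 0 <= n%:R :> R by rewrite ler0n.
  have := normr_ge0 M; clear; nra.
exists (L + L2 * (n%:R + 1)), C; split; [|exact: ltW|].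
  by rewrite addr_ge0// mulr_ge0// ltW.
move=> v cv pv sub sup v0L.
have cc0 : jcont (fun _ x => v 0 x).
  apply: (@jcont_comp _ _ _ v (fun z : R * 'rV[R]_n => 0) (fun z => z.2)) => //; first exact: cts_cst.
  by apply: cts_snd; exact: cts_id.
have ct (a : R) : jcont (fun t x => v 0 x + a * t).
  by apply: ctsD => //; apply: ctsM; [exact: cts_cst|apply: cts_fst; exact: cts_id].
have vL0 x y : v 0 x - v 0 y <= L * `|y - x|.
  by rewrite distrC; apply: le_trans (v0L x y); exact: ler_norm.
have up (t : R) x : 0 <= t -> v t x <= v 0 x + C * t.
  move=> t0; rewrite -[leRHS]addr0.
  apply: (jet_comparison (v2 := fun t x => v 0 x + C * t) tK) => //.
  - by move=> s y k; rewrite pv.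
  - move=> s y a p s0 /subjetN J.
    have pL : `|p| <= L.
      rewrite -normrN; apply: (superjet_momentum L0 J) => z.
      by have := vL0 z y; rewrite distrC; clear -n; lra.
    have : - a <= - C by apply: (superjet_backward ltr01 J) => h h0 _; clear -n; lra.
    by have := lerNnormlW (hC (y, p) pL); clear -n; lra.
  - by move=> y; rewrite mulr0 !addr0.
have dn (t : R) x : 0 <= t -> v 0 x - C * t <= v t x.
  move=> t0; rewrite -[leRHS]addr0 -mulNr.
  apply: (jet_comparison (v1 := fun t x => v 0 x + (- C) * t) tK) => //.
  - by move=> s y k; rewrite pv.
  - move=> s y a p s0 J.
    have pL : `|p| <= L.
      by apply: (superjet_momentum L0 J) => z; have := vL0 y z; clear -n; lra.
    have : a <= - C by apply: (superjet_backward ltr01 J) => h h0 _; clear -n; lra.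
    by have := ler_normlW (hC (y, p) pL); clear -n; lra.
  - by move=> y; rewrite mulr0 !addr0.
(* [v] and its translate by [s] satisfy the same inequalities and differ by at most [C * s] at time
   0. *)
have tl (t s : R) x : 0 <= t -> 0 <= s -> `|v (t + s) x - v t x| <= C * s.
  move=> t0 s0; rewrite ler_norml; apply/andP; split.
    have := @jet_comparison R n K v (fun t => v (t + s)) (C * s) tK cv (jcont_shift (s := s) cv) pv (fun t => pv (t + s))
      sub (jet_super_shift s0 sup) _ t x t0.
    move=> H; have H1 : forall y, v 0 y <= v (0 + s) y + C * s by move=> y; rewrite add0r; have := dn s y s0; clear -n; lra.
    by have := H H1; clear -n; lra.
  have := @jet_comparison R n K (fun t => v (t + s)) v (C * s) tK (jcont_shift (s := s) cv) cv (fun t => pv (t + s)) pv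
      (jet_sub_shift s0 sub) sup _ t x t0.
  move=> H; have H1 : forall y, v (0 + s) y <= v 0 y + C * s by move=> y; rewrite add0r; exact: up.
  by have := H H1; clear -n; lra.
have tlip (t s : R) x : 0 <= t -> 0 <= s -> `|v t x - v s x| <= C * `|t - s|.
  move=> t0 s0; have [st|ts] := lerP s t.
    by have := tl s (t - s) x s0; rewrite subr_ge0 subrKC => /(_ st).
  have := tl t (s - t) x t0; rewrite subr_ge0 subrKC => /(_ (ltW ts)).
  by rewrite distrC.
split => // t0 x1 x0 t00.
have base x0' x1' : 0 < t0 -> v t0 x1' - v t0 x0' <= L2 * Num.sqrt (sqn (x1' - x0')).
  move=> {}t00; rewrite leNgt; apply/negP => hlt.
  pose eta := v t0 x1' - v t0 x0' - L2 * Num.sqrt (sqn (x1' - x0')).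
  have eta0 : 0 < eta by rewrite /eta; lra.
  have [B B0 hB] := strip_bounded (t0 + 1) cv pv.
  have T1 : 0 <= t0 <= t0 + 1 by rewrite ltW//=; lra.
  have [m [m0 mt m1]] := exists_lt_min t00 (ltr01 : 0 < 1 :> R).
  (* The first term confines the maximum to [|t - t0| < m]. The second excludes the tip of the cone,
     where, with [r = |t - t0|], the Lipschitz bound in time would give
     [eta <= C r - b r^2 <= C^2 / (4 b)]. *)
  pose b := (2 * B + 1) / m ^+ 2 + (C ^+ 2 + 1) / eta.
  have b1 : 0 < (2 * B + 1) / m ^+ 2 by rewrite divr_gt0 ?exprn_gt0//; lra.
  have b2 : 0 < (C ^+ 2 + 1) / eta by rewrite divr_gt0// ltr_wpDl ?sqr_ge0.
  have b0 : 0 < b by rewrite addr_gt0.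
  have bm : 2 * B < b * m ^+ 2.
    have : (2 * B + 1) / m ^+ 2 * m ^+ 2 <= b * m ^+ 2 by rewrite ler_wpM2r ?sqr_ge0// lerDl ltW.
    by rewrite divfK ?lt0r_neq0 ?exprn_gt0//; lra.
  have be : C ^+ 2 < b * eta.
    have : (C ^+ 2 + 1) / eta * eta <= b * eta by rewrite ler_wpM2r ?(ltW eta0)// lerDr ltW.
    by rewrite divfK ?lt0r_neq0//; lra.
  clearbody b.
  (* At distance [rho] the cone exceeds the oscillation of [v]: the maximum is interior to the ball
     although the penalization is not periodic. *)
  pose rho := (2 * B + 1) / L2.
  have rhoE : L2 * rho = 2 * B + 1 by rewrite /rho mulrC divfK// lt0r_neq0.
  have rho0 : 0 < rho by rewrite divr_gt0//; lra.
  clearbody rho.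
  pose Phi t x := v t x - L2 * Num.sqrt (sqn (x - x0')) - b * (t - t0) ^+ 2.
  have far (x : 'rV[R]_n) : rho <= `|x - x0'| -> 2 * B + 1 <= L2 * Num.sqrt (sqn (x - x0')).
    move=> h; rewrite -rhoE ler_wpM2l ?(ltW L20)//.
    exact: le_trans h (norm_le_sqrt_sqn _).
  have x1r : `|x1' - x0'| <= rho.
    rewrite leNgt; apply/negP => /ltW/far.
    have := ler_normlW (hB t0 x1' T1); have := lerNnormlW (hB t0 x0' T1).
    by move: eta0; rewrite /eta; clear -n; lra.
  have cN : continuous (fun z : R * 'rV[R]_n => Num.sqrt (sqn (z.2 - x0'))).
    apply: (cts_comp (@sqrt_continuous R)).
    by apply: cts_sqn; apply: ctsB; [apply: cts_snd; exact: cts_id|exact: cts_cst].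
  have [[t x] [/= tT xr] hmax] : exists2 z : R * 'rV[R]_n,
     ([set t : R | 0 <= t <= t0 + 1] `*` [set x : 'rV[R]_n | `|x - x0'| <= rho]) z &
     forall z', ([set t : R | 0 <= t <= t0 + 1] `*` [set x : 'rV[R]_n | `|x - x0'| <= rho]) z' ->
       Phi z'.1 z'.2 <= Phi z.1 z.2.
    apply: max_compact.
    - by exists (t0, x1').
    - by apply: compact_setX; [exact: compact_itv_le|exact: compact_cball_at].
    - rewrite /Phi; apply: ctsB; first by apply: ctsB => //; apply: ctsM => //; exact: cts_cst.
      apply: ctsM; first exact: cts_cst.
      have c2 : continuous (fun z : R * 'rV[R]_n => z.1 - t0).
        by apply: ctsB; [apply: cts_fst; exact: cts_id|exact: cts_cst].
      have cq := ctsM c2 c2; exact: cq.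
  have H s y : 0 <= s <= t0 + 1 -> `|y - x0'| <= rho -> Phi s y <= Phi t x.
    by move=> sT yr; apply: (hmax (s, y)).
  have big : v t0 x0' + eta <= Phi t x.
    by apply: le_trans (H t0 x1' T1 x1r); rewrite /Phi /eta subrr expr0n/=; clear -n; lra.
  have N0 : 0 <= L2 * Num.sqrt (sqn (x - x0')) by rewrite mulr_ge0 ?sqrtr_ge0// ltW.
  have n1 : 0 <= b * (t - t0) ^+ 2 by rewrite mulr_ge0 ?sqr_ge0// ltW.
  have B1 := ler_normlW (hB t x tT); have B2 := lerNnormlW (hB t0 x0' T1).
  have tt0 : `|t - t0| < m.
    apply: sqrt_small => //; rewrite -(ltr_pM2l b0); apply: le_lt_trans bm.
    by move: big N0 B1 B2 eta0; rewrite /Phi; clear -n; lra.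
  have xr' : `|x - x0'| < rho.
    rewrite ltNge; apply/negP => /far.
    by move: big n1 B1 B2 eta0; rewrite /Phi; clear -n; lra.
  have t0' : 0 < t by move: tt0 mt; rewrite ltr_norml => /andP[+ _]; clear -n; lra.
  have t1' : t < t0 + 1 by move: tt0 m1; rewrite ltr_norml => /andP[_]; clear -n; lra.
  have xx0 : x - x0' != 0.
    apply/eqP => /eqP; rewrite subr_eq0 => /eqP xE.
    have := tlip t t0 x0' (ltW t0') (ltW t00); move: big; rewrite /Phi xE subrr sqn0 sqrtr0 mulr0 subr0 => h1 /ler_normlW h2.
    rewrite -(real_normK (num_real (t - t0))) in h1.
    have := sqr_ge0 (2 * b * `|t - t0| - C).
    have : b * eta <= b * (C * `|t - t0| - b * `|t - t0| ^+ 2).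
      by rewrite ler_wpM2l ?(ltW b0)//; move: h1 h2; clear -n; lra.
    by move: be; have := sqr_ge0 C; clear -n; nra.
  have N1 : 0 < Num.sqrt (sqn (x - x0')) by rewrite sqrtr_gt0 sqn_gt0.
  have J : superjet v t x (2 * b * (t - t0)) ((L2 / Num.sqrt (sqn (x - x0'))) *: (x - x0')).
    exists (b + L2 / (2 * Num.sqrt (sqn (x - x0')))), (Num.min (Num.min t (t0 + 1 - t)) (rho - `|x - x0'|)); split.
      by rewrite !lt_min t0' !subr_gt0 t1'.
    move=> s y; rewrite !lt_min => /andP[/andP[ss0 ss1] _] /andP[_ yy].
    have sT : 0 <= s <= t0 + 1.
      by move: ss0 ss1; rewrite !ltr_norml => /andP[+ _] /andP[_ +]; clear -n; lra.
    have yx : `|y - x0'| <= rho.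
      rewrite -(subrKA x); apply: le_trans (ler_normD _ _) _.
      by move: yy; clear -n; lra.
    have := H s y sT yx; rewrite /Phi.
    have -> : s - t0 = (t - t0) + (s - t) by ring.
    have -> : y - x0' = (x - x0') + (y - x) by rewrite [RHS]addrC subrKA.
    have := euclid_norm_expand (y - x) xx0; rewrite dotpZl.
    move: (Num.sqrt (sqn (x - x0'))) N1 => N N1.
    move: (Num.sqrt _) (dotp _ _) (sqn _) (sqn_ge0 (y - x)) => N' D S S0 e1 e2.
    have e3 : L2 * N' <= L2 * (N + N^-1 * D + (2 * N)^-1 * S) by rewrite ler_wpM2l// ltW.
    have : 0 <= b * S by rewrite mulr_ge0// ltW.
    have : 0 <= L2 / (2 * N) * (s - t) ^+ 2 by rewrite mulr_ge0 ?sqr_ge0// divr_ge0 ?ltW// mulr_gt0.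
    by move: e2 e3; clear -n; lra.
  have aC : `|2 * b * (t - t0)| <= C.
    by apply: (superjet_time t0' J) => s s0; apply: tlip => //; exact: ltW.
  have := sub _ _ _ _ t0' J; have aC' := lerNnormlW aC; set p := _ *: _ => kp.
  have pM : `|p| <= M by rewrite leNgt; apply/negP => /(hM x); move: kp aC'; clear -n; lra.
  have M0 : 0 <= M by apply: le_trans pM.
  have := sqn_le_bound pM; rewrite /p sqnZ -{2}(sqr_sqrtr (sqn_ge0 (x - x0'))).
  rewrite exprMn exprVn mulfVK; last by rewrite lt0r_neq0// exprn_gt0.
  by move: L2M; clear -n; lra.
have sq y : Num.sqrt (sqn (y : 'rV[R]_n)) <= (n%:R + 1) * `|y|.
  rewrite -(ler_pXn2r (n := 2))// ?nnegrE ?sqrtr_ge0 ?mulr_ge0 ?addr_ge0//.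
  rewrite sqr_sqrtr ?sqn_ge0// exprMn; apply: le_trans (sqn_le_norm y) _.
  rewrite ler_wpM2r ?sqr_ge0//; have : 0 <= n%:R :> R by rewrite ler0n.
  by clear; nra.
have s1 := sq (x1 - x0).
have s1' : L2 * Num.sqrt (sqn (x1 - x0)) <= L2 * ((n%:R + 1) * `|x1 - x0|) by rewrite ler_wpM2l// ltW.
have r0 : 0 <= L2 * ((n%:R + 1) * `|x1 - x0|) by rewrite !mulr_ge0// ?addr_ge0// ltW.
have r1 : 0 <= L * `|x1 - x0| by rewrite mulr_ge0.
(* [base] concerns positive times only; at time 0 the initial constant is used, which is why [L] is
   a summand of the space constant. *)
have [t0E|t0n] := eqVneq t0 0.
  by rewrite t0E; apply: le_trans (v0L _ _) _; move: r0; clear -n; lra.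
have t0p : 0 < t0 by rewrite lt_neqAle eq_sym t0n.
have := base x1 x0 t0p; have := base x0 x1 t0p; rewrite (sqnC x0).
by rewrite ler_norml => h1 h2; apply/andP; move: s1' r1 h1 h2; clear -n; split; lra.
Qed.

End LipschitzRegularity.

(** * Semiconcavity in space at positive times *)

Section Semiconcavity.
Context {R : realType} {n : nat}.
Notation P := ('rV[R]_n * 'rV[R]_n)%type.
Implicit Types (K : P -> R) (v : R -> 'rV[R]_n -> R).

(** An upper quadratic expansion of the weight in time, with an error constant that [dl] keeps
    finite; it turns the penalization into a jet. *)
Lemma inv_taylor (t s dl : R) : 0 < dl -> 0 <= t -> 0 <= s ->
  (t + dl)^-1 <= (s + dl)^-1 - (s + dl) ^- 2 * (t - s) + dl ^- 3 * (t - s) ^+ 2.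
Proof.
move=> d0 t0 s0.
have td : 0 < t + dl by lra.
have sd : 0 < s + dl by lra.
have e1 : (t + dl)^-1 - (s + dl)^-1 + (s + dl) ^- 2 * (t - s) = ((t + dl) * (s + dl) ^+ 2)^-1 * (t - s) ^+ 2.
  by field; rewrite !lt0r_neq0.
have : ((t + dl) * (s + dl) ^+ 2)^-1 * (t - s) ^+ 2 <= dl ^- 3 * (t - s) ^+ 2.
  rewrite ler_wpM2r ?sqr_ge0// lef_pV2 ?posrE ?mulr_gt0 ?exprn_gt0//.
  have h1 : dl <= t + dl by lra.
  have h2 : dl ^+ 2 <= (s + dl) ^+ 2 by rewrite ler_pXn2r ?nnegrE ?(ltW d0) ?(ltW sd)//; lra.
  by rewrite (exprS dl 2); apply: ler_pM => //; [exact: ltW|exact: sqr_ge0].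
by move: e1; clear -n; lra.
Qed.

(* The penalization [A / t |x - y|^2] is a supersolution of the Riccati inequality
   [c' + 16 th c^2 >= C] produced by the uniform convexity of the Hamiltonian. *)
Lemma jet_semiconcave K (L Ct t0 : R) : tame K -> 0 <= L -> 0 <= Ct -> 0 < t0 ->
  exists2 A : R, 0 <= A & forall v, jcont v -> sper v -> jet_sub K v -> jet_super K v ->
  (forall t s x, 0 <= t -> 0 <= s -> `|v t x - v s x| <= Ct * `|t - s|) ->
  (forall t x y, 0 <= t -> `|v t x - v t y| <= L * `|x - y|) ->
  forall x h, v t0 (x + h) + v t0 (x - h) - 2 * v t0 x <= A * sqn h.
Proof.
move=> tK L0 Ct0 t00; have [cK pK _ mid] := tK.
have [th [C [th0 C0 hK _]]] := mid L.
(* A bound for [t3 + dl] at the maximum, where [t3 < t0 + 1] and [dl < 1]. *)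
pose T := t0 + 3.
(* Large enough for [A + C T^2 <= 16 th A^2], which is the Riccati inequality for [A / t] multiplied
   by [t^2] and taken at its worst time. *)
pose A := 1 + (1 + C * T ^+ 2) / th.
have CT : 0 <= C * T ^+ 2 by rewrite mulr_ge0 ?sqr_ge0// ltW.
have A1 : 1 <= A by rewrite /A lerDl divr_ge0// ?(ltW th0)// addr_ge0.
have A0 : 0 < A by lra.
have riccati : A + C * T ^+ 2 <= 16 * th * A ^+ 2.
  have : th * A = th + (1 + C * T ^+ 2) by rewrite /A mulrDr mulr1 mulrCA divff ?mulr1// lt0r_neq0.
  by move: CT A1 th0; clear -n; nra.
clearbody A.
(* The two outer points are [2 h] apart, whence the factor 4. *)
exists (4 * A / t0); first by rewrite divr_ge0 ?mulr_ge0// ltW.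
move=> v cv pv sub sup vt vx xs hs; rewrite leNgt; apply/negP => hlt.
pose eta := (v t0 (xs + hs) + v t0 (xs - hs) - 2 * v t0 xs - 4 * A / t0 * sqn hs) / 3.
have eta0 : 0 < eta by rewrite /eta; move: hlt; clear -n; lra.
have etaE : v t0 (xs + hs) + v t0 (xs - hs) - 2 * v t0 xs - 4 * A / t0 * sqn hs = 3 * eta.
  by rewrite /eta; clear -n; lra.
clearbody eta; clear hlt.
have [B B0 hB] := strip_bounded (t0 + 2) cv pv.
pose lam := eta / t0.
have lam0 : 0 < lam by rewrite divr_gt0.
have lamE : lam * t0 = eta by rewrite /lam divfK// lt0r_neq0.
clearbody lam.
(* The shift makes the weight finite at time 0. Near this time [L |x - y| - c |x - y|^2] is at most
   [L^2 w / (4 A)] with [w <= 3 dl], which the last condition keeps below [eta / 2]. *)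
have [dl [dl0 dl1 dlE]] : exists dl : R, [/\ 0 < dl, dl < 1 & 3 * L ^+ 2 * dl <= eta * (2 * A)].
  have q0 : 0 < eta * (2 * A) / (3 * L ^+ 2 + 1) by rewrite divr_gt0 ?mulr_gt0// ltr_wpDl// mulr_ge0// sqr_ge0.
  have [dl [dl0 dl1 dlE]] := exists_lt_min ltr01 q0; exists dl; split => //.
  move: dlE; rewrite ltr_pdivlMr ?ltr_wpDl// ?mulr_ge0 ?sqr_ge0//.
  by move: dl0; clear -n; lra.
have [d [d0 ddl dE]] : exists d : R, [/\ 0 < d, d < dl & 2 * Ct * d <= eta / 2].
  have q0 : 0 < eta / 2 / (2 * Ct + 1) by rewrite !divr_gt0// ltr_wpDl// mulr_ge0.
  have [d [d0 ddl dE]] := exists_lt_min dl0 q0; exists d; split => //.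
  move: dE; rewrite ltr_pdivlMr ?ltr_wpDl ?mulr_ge0//.
  by move: d0; clear -n; lra.
pose rho := 4 * B * T / A + 1.
have T3 : 3 <= T by rewrite /T; lra.
have T0 : 0 < T by lra.
have rho1 : 1 <= rho by rewrite /rho lerDr divr_ge0 ?mulr_ge0// ltW.
have rhoE : 4 * B < A / T * rho ^+ 2.
  have : A / T * rho = 4 * B + A / T by rewrite /rho; field; rewrite !lt0r_neq0.
  have : 0 < A / T by rewrite divr_gt0.
  by move: rho1 B0; clear -n; nra.
clearbody rho.
have [e [e0 ed eL eC]] : exists e : R, [/\ 0 < e, e < 1, L * e <= eta / 2 & C * e < lam].
  have q0 : 0 < eta / 2 / (L + 1) by rewrite !divr_gt0// ltr_wpDl.
  have q1 : 0 < lam / (C + 1) by rewrite divr_gt0// addr_gt0.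
  have [e1 [e10 e11 e12]] := exists_lt_min q0 q1.
  have [e [e00 e01 e02]] := exists_lt_min e10 ltr01; exists e; split => //.
    move: (lt_trans e01 e11); rewrite ltr_pdivlMr ?ltr_wpDl//.
    by move: e00; clear -n; lra.
  move: (lt_trans e01 e12); rewrite ltr_pdivlMr ?addr_gt0//.
  by move: e00; clear -n; lra.
pose b := (4 * B + 1) / d ^+ 2.
have B41 : 0 < 4 * B + 1 by move: B0; clear -n; lra.
have b0 : 0 < b by rewrite divr_gt0 ?exprn_gt0.
have bE : 4 * B < b * d ^+ 2 by rewrite /b divfK ?lt0r_neq0 ?exprn_gt0//; clear -n; lra.
clearbody b.
pose g := (4 * B + 1) / e ^+ 2.
have g0 : 0 < g by rewrite divr_gt0 ?exprn_gt0.
have gE : 4 * B < g * e ^+ 2 by rewrite /g divfK ?lt0r_neq0 ?exprn_gt0//; clear -n; lra.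
clearbody g.
pose psi (t : R) := lam * t + (4 * B + 1) * sqpos (t - t0).
(* Three independent times and points, since [v] has no derivative yet: [b] brings the times
   together and [g] brings [z] to the midpoint of [x] and [y]. *)
pose Phi (t1 t2 t3 : R) x y z := v t1 x + v t2 y - 2 * v t3 z - psi t3 - A * (t3 + dl)^-1 * sqn (x - y)
   - g * sqn (x + y - 2 *: z) - b * ((t1 - t3) ^+ 2 + (t2 - t3) ^+ 2).
pose I := [set t : R | 0 <= t <= t0 + 2].
pose Br := [set x : 'rV[R]_n | `|x| <= rho].
pose D := (I `*` [set x : 'rV[R]_n | `|x| <= 1]) `*` ((I `*` Br) `*` (I `*` Br)).
(* [Num.max 0] changes nothing on the compact set; it makes the inverse of [t3 + dl] continuous
   everywhere, as [max_compact] demands. *)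
have [[[t1 x0] [[t2 e1] [t3 e2]]] [[/= t1T x01] [[/= t2T e11] [/= t3T e21]]] hmax] :
  exists2 m, D m & forall m', D m' ->
   Phi m'.1.1 m'.2.1.1 (Num.max 0 m'.2.2.1) m'.1.2 (m'.1.2 + m'.2.1.2) (m'.1.2 + m'.2.2.2) <=
   Phi m.1.1 m.2.1.1 (Num.max 0 m.2.2.1) m.1.2 (m.1.2 + m.2.1.2) (m.1.2 + m.2.2.2).
  apply: max_compact.
  - have t2 : 0 <= t0 + 2 by move: t00; clear -n; lra.
    have r0 : 0 <= rho by move: rho1; clear -n; lra.
    by exists ((0, 0), ((0, 0), (0, 0))); rewrite /D/I/Br; do !split => //=; rewrite ?normr0 ?lexx.
  - by do ![apply: compact_setX]; (exact: compact_itv_le || exact: compact_cball).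
  - pose E := ((R * 'rV[R]_n) * ((R * 'rV[R]_n) * (R * 'rV[R]_n)))%type.
    have c1 : continuous (fun m : E => m.1.1) by do !apply: cts_fst; exact: cts_id.
    have c2 : continuous (fun m : E => m.2.1.1) by do 2!apply: cts_fst; apply: cts_snd; exact: cts_id.
    have c3 : continuous (fun m : E => Num.max 0 m.2.2.1).
      by apply: cts_max; [exact: cts_cst|apply: cts_fst; do 2!apply: cts_snd; exact: cts_id].
    have cx : continuous (fun m : E => m.1.2) by apply: cts_snd; apply: cts_fst; exact: cts_id.
    have ce1 : continuous (fun m : E => m.2.1.2) by apply: cts_snd; apply: cts_fst; apply: cts_snd; exact: cts_id.
    have ce2 : continuous (fun m : E => m.2.2.2) by do 3!apply: cts_snd; exact: cts_id.
    have cy := ctsD cx ce1; have cz := ctsD cx ce2.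
    have d1 := ctsB c1 c3; have d2 := ctsB c2 c3.
    rewrite /Phi /psi; apply: ctsB; [apply: ctsB; [apply: ctsB; [apply: ctsB; [apply: ctsB; [apply: ctsD|]|]|]|]|].
    + exact: (jcont_comp cv c1 cx).
    + exact: (jcont_comp cv c2 cy).
    + by apply: ctsM; [exact: cts_cst|exact: (jcont_comp cv c3 cz)].
    + apply: ctsD; apply: ctsM; (try exact: cts_cst) => //.
      exact: (cts_comp sqpos_cts (ctsB c3 (cts_cst (c := t0)))).
    + apply: ctsM; last by apply: cts_sqn; exact: ctsB.
      apply: ctsM; first exact: cts_cst.
      apply: ctsV; first by apply: ctsD => //; exact: cts_cst.
      by move=> m; rewrite lt0r_neq0// ltr_wpDl// le_max lexx.
    + apply: ctsM; first exact: cts_cst.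
      apply: cts_sqn; apply: ctsB; first exact: ctsD.
      by apply: ctsZ => //; exact: cts_cst.
    + apply: ctsM; first exact: cts_cst.
      by apply: ctsD; apply: ctsM.
pose y0 := x0 + e1; pose z0 := x0 + e2.
have mx (t : R) : 0 <= t <= t0 + 2 -> Num.max 0 t = t by case/andP => h _; apply/max_idPr.
have H (s1 s2 s3 : R) x y z : 0 <= s1 <= t0 + 2 -> 0 <= s2 <= t0 + 2 -> 0 <= s3 <= t0 + 2 ->
    `|y - x| <= rho -> `|z - x| <= rho -> Phi s1 s2 s3 x y z <= Phi t1 t2 t3 x0 y0 z0.
  move=> s1T s2T s3T yx zx; have [k hk] := reduce_mod_Zn x.
  have := hmax ((s1, x + map_mx intr k), ((s2, y - x), (s3, z - x)))
    (conj (conj s1T hk) (conj (conj s2T yx) (conj s3T zx))).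
  rewrite /= (mx _ s3T) (mx _ t3T).
  have ek (u : 'rV[R]_n) : x + map_mx intr k + (u - x) = u + map_mx intr k by rewrite addrAC subrKC.
  rewrite !ek.
  have ek1 : x + map_mx intr k - (y + map_mx intr k) = x - y by rewrite opprD addrACA subrr addr0.
  have ek2 : x + map_mx intr k + (y + map_mx intr k) - 2 *: (z + map_mx intr k) = x + y - 2 *: z.
    by apply/rowP => i; rewrite !mxE; ring.
  by rewrite /Phi !pv ek1 ek2.
have t0T : 0 <= t0 <= t0 + 2 by rewrite ltW//=; clear -n; lra.
have Hs : 2 * eta <= Phi t1 t2 t3 x0 y0 z0.
  (* [H] only reaches points within [rho] of each other. For a longer [hs] the claimed bound already
     exceeds [4 * B], the largest possible second difference. *)
  have [hsr|hsr] := lerP (2 * `|hs|) rho; last first.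
    exfalso; have h1 := ler_normlW (hB t0 (xs + hs) t0T); have h2 := ler_normlW (hB t0 (xs - hs) t0T).
    have h3 := lerNnormlW (hB t0 xs t0T).
    have rh : rho ^+ 2 <= 4 * sqn hs.
      have := norm_sqn hs; have : rho ^+ 2 <= (2 * `|hs|) ^+ 2 by rewrite ler_pXn2r ?nnegrE ?mulr_ge0 ?(ltW hsr)// (le_trans _ rho1).
      by rewrite exprMn; clear -n; lra.
    have AT : A / T <= A / t0 by rewrite ler_pM2l// lef_pV2 ?posrE// /T; clear -n; lra.
    have : A / T * rho ^+ 2 <= A / t0 * (4 * sqn hs) by rewrite ler_pM// ?sqr_ge0// divr_ge0 ?ltW.
    by move: h1 h2 h3 etaE rhoE eta0; clear -n; lra.
  have e1' : xs - hs - (xs + hs) = - (2 *: hs) by apply/rowP => i; rewrite !mxE; ring.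
  have e2' : xs - (xs + hs) = - hs by apply/rowP => i; rewrite !mxE; ring.
  have hr : `|hs| <= rho by move: hsr rho1 (normr_ge0 hs); clear -n; lra.
  apply: le_trans (H t0 t0 t0 (xs + hs) (xs - hs) xs t0T t0T t0T _ _); last 2 first.
  - by rewrite e1' normrN normrZ ger0_norm.
  - by rewrite e2' normrN.
  have e3 : xs + hs - (xs - hs) = 2 *: hs by apply/rowP => i; rewrite !mxE; ring.
  have e4 : xs + hs + (xs - hs) - 2 *: xs = 0 by apply/rowP => i; rewrite !mxE; ring.
  rewrite /Phi e3 e4 /psi !subrr sqn0 sqpos0// sqnZ expr0n/=.
  have : A * (t0 + dl)^-1 * sqn hs <= A / t0 * sqn hs.
    rewrite ler_wpM2r ?sqn_ge0// ler_pM2l// lef_pV2 ?posrE// ?addr_gt0//.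
    by rewrite lerDl ltW.
  by move: etaE lamE; clear -n; lra.
have q0 := sqpos_ge0 (t3 - t0).
have [t10 t20 t30] : [/\ 0 <= t1, 0 <= t2 & 0 <= t3] by move: t1T t2T t3T => /andP[-> _] /andP[-> _] /andP[-> _].
have psi0 : 0 <= psi t3 by rewrite /psi addr_ge0// mulr_ge0// ltW.
have bb : v t1 x0 + v t2 y0 - 2 * v t3 z0 <= 4 * B.
  have h1 := ler_normlW (hB t1 x0 t1T); have h2 := ler_normlW (hB t2 y0 t2T).
  by have h3 := lerNnormlW (hB t3 z0 t3T); move: h1 h2 h3; clear -n; lra.
pose c := A * (t3 + dl)^-1; have c0 : 0 < c by rewrite /c mulr_gt0// invr_gt0 ltr_wpDl.
have [r rE] : exists r, r = x0 + y0 - 2 *: z0 by exists (x0 + y0 - 2 *: z0).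
have n1 : 0 <= b * ((t1 - t3) ^+ 2 + (t2 - t3) ^+ 2) by rewrite mulr_ge0 ?addr_ge0 ?sqr_ge0// ltW.
have n2 : 0 <= g * sqn r by rewrite mulr_ge0 ?sqn_ge0// ltW.
have n3 : 0 <= c * sqn (x0 - y0) by rewrite mulr_ge0 ?sqn_ge0// ltW.
have PhiE : Phi t1 t2 t3 x0 y0 z0 = v t1 x0 + v t2 y0 - 2 * v t3 z0 - psi t3 - c * sqn (x0 - y0)
   - g * sqn r - b * ((t1 - t3) ^+ 2 + (t2 - t3) ^+ 2) by rewrite rE.
have d1 : `|t1 - t3| < d.
  apply: sqrt_small => //; rewrite -(ltr_pM2l b0); apply: le_lt_trans bE.
  have : 0 <= b * (t2 - t3) ^+ 2 by rewrite mulr_ge0 ?sqr_ge0// ltW.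
  by move: Hs psi0 bb n1 n2 n3 eta0; rewrite PhiE; clear -n; lra.
have d2 : `|t2 - t3| < d.
  apply: sqrt_small => //; rewrite -(ltr_pM2l b0); apply: le_lt_trans bE.
  have : 0 <= b * (t1 - t3) ^+ 2 by rewrite mulr_ge0 ?sqr_ge0// ltW.
  by move: Hs psi0 bb n1 n2 n3 eta0; rewrite PhiE; clear -n; lra.
have re : `|r| < e.
  apply: sqn_small => //; rewrite -(ltr_pM2l g0); apply: le_lt_trans gE.
  by move: Hs psi0 bb n1 n2 n3 eta0; rewrite PhiE; clear -n; lra.
have t3t0 : t3 < t0 + 1.
  rewrite ltNge; apply/negP => h; have q1 : 1 <= sqpos (t3 - t0) by apply: sqpos_ge1; move: h; clear -n; lra.
  have : (4 * B + 1) * 1 <= (4 * B + 1) * sqpos (t3 - t0) by rewrite ler_wpM2l// ltW.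
  have : 0 <= lam * t3 by rewrite mulr_ge0 ?(ltW lam0).
  by move: Hs bb n1 n2 n3 eta0; rewrite PhiE /psi; clear -n; lra.
have t3T' : t3 + dl <= T by rewrite /T; move: t3t0 dl1; clear -n; lra.
have cT : A / T <= c.
  by rewrite /c ler_pM2l// lef_pV2 ?posrE// ltr_wpDl.
have xy : `|x0 - y0| < rho.
  apply: sqn_small; first by move: rho1; clear -n; lra.
  have AT0 : 0 < A / T by rewrite divr_gt0.
  rewrite -(ltr_pM2l AT0); apply: le_lt_trans rhoE.
  have : A / T * sqn (x0 - y0) <= c * sqn (x0 - y0) by rewrite ler_wpM2r ?sqn_ge0.
  by move: Hs psi0 bb n1 n2 n3 eta0; rewrite PhiE; clear -n; lra.
have exz : x0 - z0 = 2^-1 *: ((x0 - y0) + r) by rewrite rE; clear -n; apply/rowP => i; rewrite !mxE; lra.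
have eyz : y0 - z0 = 2^-1 *: (r - (x0 - y0)) by rewrite rE; clear -n; apply/rowP => i; rewrite !mxE; lra.
have h20 : 0 <= 2^-1 :> R by clear -n; lra.
have xz : `|x0 - z0| <= 2^-1 * (`|x0 - y0| + `|r|).
  by rewrite exz normrZ (ger0_norm h20) ler_wpM2l// ler_normD.
have yz : `|y0 - z0| <= 2^-1 * (`|x0 - y0| + `|r|).
  by rewrite eyz normrZ (ger0_norm h20) ler_wpM2l// addrC; apply: le_trans (ler_normD _ _) _; rewrite normrN.
have xz' : `|x0 - z0| < rho by move: xz xy re ed rho1; clear -n; lra.
have big : 2 * eta <= v t1 x0 + v t2 y0 - 2 * v t3 z0 - c * sqn (x0 - y0).
  by move: Hs psi0 n1 n2; rewrite PhiE; clear -n; lra.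
(* Near time 0 the Lipschitz bounds and the strength of the penalization leave no room for a gap of
   [2 * eta]. *)
have init : t3 <= 2 * d -> False.
  move=> t3d; have := vt t1 t3 x0 t10 t30; have := vt t2 t3 y0 t20 t30.
  have a1 : Ct * `|t1 - t3| <= Ct * d by rewrite ler_wpM2l// ltW.
  have a2 : Ct * `|t2 - t3| <= Ct * d by rewrite ler_wpM2l// ltW.
  move=> /ler_normlW a3 /ler_normlW a4.
  have := ler_normlW (vx t3 x0 z0 t30); have := ler_normlW (vx t3 y0 z0 t30) => a5 a6.
  have a7 : L * `|x0 - z0| <= L * (2^-1 * (`|x0 - y0| + `|r|)) by rewrite ler_wpM2l.
  have a8 : L * `|y0 - z0| <= L * (2^-1 * (`|x0 - y0| + `|r|)) by rewrite ler_wpM2l.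
  have a9 : L * `|r| <= L * e by rewrite ler_wpM2l// ltW.
  pose w := t3 + dl; have w0 : 0 < w by rewrite /w ltr_wpDl.
  have w3 : w <= 3 * dl by rewrite /w; move: t3d ddl; clear -n; lra.
  have a10 : c * `|x0 - y0| ^+ 2 <= c * sqn (x0 - y0) by rewrite ler_wpM2l ?norm_sqn// ltW.
  have a11 : L * `|x0 - y0| - c * `|x0 - y0| ^+ 2 <= L ^+ 2 * w / (4 * A).
    have -> : L * `|x0 - y0| - c * `|x0 - y0| ^+ 2 = L ^+ 2 * w / (4 * A) - (2 * A * `|x0 - y0| - L * w) ^+ 2 / (4 * A * w).
      by rewrite /c -/w; field; rewrite !lt0r_neq0.
    by rewrite lerBlDr lerDl divr_ge0 ?sqr_ge0// mulr_ge0 ?mulr_ge0// ltW.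
  have a12 : L ^+ 2 * w / (4 * A) <= eta / 2.
    rewrite ler_pdivrMr ?mulr_gt0//.
    have : L ^+ 2 * w <= L ^+ 2 * (3 * dl) by rewrite ler_wpM2l ?sqr_ge0.
    by move: dlE; clear -n; lra.
  by move: big a1 a2 a3 a4 a5 a6 a7 a8 a9 a10 a11 a12 dE eL eta0; clear -n; lra.
have t3d : 2 * d < t3 by rewrite ltNge; apply/negP.
have t10' : 0 < t1 by move: d1 t3d d0; rewrite ltr_norml => /andP[+ _]; clear -n; lra.
have t20' : 0 < t2 by move: d2 t3d d0; rewrite ltr_norml => /andP[+ _]; clear -n; lra.
have t30' : 0 < t3 by move: t3d d0; clear -n; lra.
have d1' : d < 1 by exact: lt_trans ddl dl1.
have t11 : t1 < t0 + 2 by move: d1 d1' t3t0; rewrite ltr_norml => /andP[_]; clear -n; lra.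
have t21 : t2 < t0 + 2 by move: d2 d1' t3t0; rewrite ltr_norml => /andP[_]; clear -n; lra.
have t31 : t3 < t0 + 2 by move: t3t0; clear -n; lra.
have near_itv (t s : R) : 0 < t -> t < t0 + 2 -> `|s - t| < t -> `|s - t| < t0 + 2 - t -> 0 <= s <= t0 + 2.
  by rewrite !ltr_norml => _ _ /andP[+ _] /andP[_]; clear -n; lra.
have J1 : superjet v t1 x0 (b * (2 * (t1 - t3))) ((2 * c) *: (x0 - y0) + (2 * g) *: r).
  exists (b + g + c), (Num.min (Num.min t1 (t0 + 2 - t1)) (Num.min (rho - `|x0 - y0|) (rho - `|x0 - z0|))); split.
    by rewrite !lt_min t10' !subr_gt0 t11 xy xz'.
  move=> t x; rewrite !lt_min => /andP[/andP[tt0 tt1] _] /andP[_ /andP[xx1 xx2]].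
  have tT := near_itv t1 t t10' t11 tt0 tt1.
  have yx : `|y0 - x| <= rho.
    rewrite -(subrKA x0); apply: le_trans (ler_normD _ _) _.
    by rewrite (distrC y0) (distrC x0 x); move: xx1; clear -n; lra.
  have zx : `|z0 - x| <= rho.
    rewrite -(subrKA x0); apply: le_trans (ler_normD _ _) _.
    by rewrite (distrC z0) (distrC x0 x); move: xx2; clear -n; lra.
  have := H t t2 t3 x y0 z0 tT t2T t3T yx zx; rewrite PhiE /Phi -/c.
  have -> : t - t3 = (t1 - t3) + (t - t1) by ring.
  have -> : x - y0 = (x0 - y0) + (x - x0) by rewrite [RHS]addrC subrKA.
  have -> : x + y0 - 2 *: z0 = r + (x - x0) by rewrite rE; clear -n; apply/rowP => i; rewrite !mxE; ring.
  rewrite (sqnD (x0 - y0)) (sqnD r) (dotpDl (_ *: _)) !dotpZl.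
  move: (dotp _ _) (dotp _ _) (sqn (x - x0)) (sqn_ge0 (x - x0)) (sqn r) (sqn (x0 - y0)) => D1 D2 S S0 Sr Sxy.
  have : 0 <= b * S by rewrite mulr_ge0// ltW.
  have : 0 <= (g + c) * (t - t1) ^+ 2 by rewrite mulr_ge0 ?sqr_ge0// ltW// addr_gt0.
  by move: (psi t3) => ps; clear -n; lra.
have J2 : superjet v t2 y0 (b * (2 * (t2 - t3))) ((- (2 * c)) *: (x0 - y0) + (2 * g) *: r).
  exists (b + g + c), (Num.min (Num.min t2 (t0 + 2 - t2)) (rho - `|x0 - y0|)); split.
    by rewrite !lt_min t20' !subr_gt0 t21 xy.
  move=> t y; rewrite !lt_min => /andP[/andP[tt0 tt1] _] /andP[_ yy1].
  have tT := near_itv t2 t t20' t21 tt0 tt1.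
  have yx : `|y - x0| <= rho.
    rewrite -(subrKA y0); apply: le_trans (ler_normD _ _) _.
    by rewrite (distrC y0); move: yy1; clear -n; lra.
  have zx : `|z0 - x0| <= rho by rewrite distrC ltW.
  have := H t1 t t3 x0 y z0 t1T tT t3T yx zx; rewrite PhiE /Phi -/c.
  have -> : t - t3 = (t2 - t3) + (t - t2) by ring.
  have -> : x0 - y = (x0 - y0) - (y - y0) by rewrite opprB addrA subrK.
  have -> : x0 + y - 2 *: z0 = r + (y - y0) by rewrite rE; clear -n; apply/rowP => i; rewrite !mxE; ring.
  rewrite (sqnB (x0 - y0)) (sqnD r) (dotpDl (_ *: _)) !dotpZl.
  move: (dotp _ _) (dotp _ _) (sqn (y - y0)) (sqn_ge0 (y - y0)) (sqn r) (sqn (x0 - y0)) => D1 D2 S S0 Sr Sxy.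
  have : 0 <= b * S by rewrite mulr_ge0// ltW.
  have : 0 <= (g + c) * (t - t2) ^+ 2 by rewrite mulr_ge0 ?sqr_ge0// ltW// addr_gt0.
  by move: (psi t3) => ps; clear -n; lra.
pose S0 := sqn (x0 - y0).
(* The derivative at [t3] of the penalization; since [v] enters there with the factor 2, the time
   component of its jet is [- X' / 2]. *)
pose X' := - A * (t3 + dl) ^- 2 * S0 + lam + (4 * B + 1) * (2 * Num.max 0 (t3 - t0))
   - b * (2 * (t1 - t3)) - b * (2 * (t2 - t3)).
have S00 : 0 <= S0 by exact: sqn_ge0.
have J3 : subjet v t3 z0 (- (X' / 2)) ((2 * g) *: r).
  pose MM := A * dl ^- 3 * S0 + (4 * B + 1) + 2 * b + 4 * g.
  have MM0 : 0 <= A * dl ^- 3 * S0.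
    by rewrite mulr_ge0// mulr_ge0 ?(ltW A0)// invr_ge0 exprn_ge0// ltW.
  exists MM, (Num.min (Num.min t3 (t0 + 2 - t3)) (rho - `|x0 - z0|)); split.
    by rewrite !lt_min t30' !subr_gt0 t31 xz'.
  move=> t z; rewrite !lt_min => /andP[/andP[tt0 tt1] _] /andP[_ zz1].
  have tT := near_itv t3 t t30' t31 tt0 tt1.
  have zx : `|z - x0| <= rho.
    rewrite -(subrKA z0); apply: le_trans (ler_normD _ _) _.
    by rewrite (distrC z0); move: zz1; clear -n; lra.
  have yx : `|y0 - x0| <= rho by rewrite distrC ltW.
  have := H t1 t2 t x0 y0 z t1T t2T tT yx zx; rewrite PhiE /Phi /psi -/S0.
  have tt : 0 <= t by case/andP: tT.
  have := inv_taylor dl0 tt t30.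
  have := sqpos_taylor (t3 - t0) (t - t3).
  have -> : t - t0 = (t3 - t0) + (t - t3) by ring.
  have -> : t1 - t = (t1 - t3) - (t - t3) by ring.
  have -> : t2 - t = (t2 - t3) - (t - t3) by ring.
  have -> : x0 + y0 - 2 *: z = r - 2 *: (z - z0) by rewrite rE; clear -n; apply/rowP => i; rewrite !mxE; ring.
  rewrite (sqnB r) sqnZ dotpZl dotpZr /c /X' /MM.
  move: (sqpos (t3 - t0 + _)) (sqpos (t3 - t0)) (Num.max _ _) => S1 S2 mm.
  move: (dotp _ _) (sqn (z - z0)) (sqn_ge0 (z - z0)) (sqn r) => D1 Sz Sz0 Sr.
  move: ((t + dl)^-1) ((t3 + dl)^-1) ((t3 + dl) ^- 2) => i1 i2 i3.
  move=> a1 a2 a3.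
  have f1 : (4 * B + 1) * S1 <= (4 * B + 1) * (S2 + 2 * mm * (t - t3) + (t - t3) ^+ 2) by rewrite ler_wpM2l// ltW.
  have f2 : (A * S0) * i1 <= (A * S0) * (i2 - i3 * (t - t3) + dl ^- 3 * (t - t3) ^+ 2).
    by rewrite ler_wpM2l// mulr_ge0// ltW.
  have f3 : 0 <= A * dl ^- 3 * S0 * Sz by rewrite mulr_ge0.
  have f4 : 0 <= (4 * B + 1) * Sz by rewrite mulr_ge0// ltW.
  have f5 : 0 <= b * Sz by rewrite mulr_ge0// ltW.
  have f6 : 0 <= g * (t - t3) ^+ 2 by rewrite mulr_ge0 ?sqr_ge0// ltW.
  have f7 : 0 <= A * dl ^- 3 * S0 * (t - t3) ^+ 2 by rewrite mulr_ge0 ?sqr_ge0.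
  have f8 : 0 <= (4 * B + 1) * (t - t3) ^+ 2 by rewrite mulr_ge0 ?sqr_ge0// ltW.
  have f9 : 0 <= b * (t - t3) ^+ 2 by rewrite mulr_ge0 ?sqr_ge0// ltW.
  have f10 : 0 <= g * Sz by rewrite mulr_ge0// ltW.
  by move: a3 f1 f2 f3 f4 f5 f6 f7 f8 f9 f10; clear -n; lra.
(* The momentum at [z0] is the mean of the two others, so the midpoint inequality combines the three
   equations. [riccati] absorbs the terms in [sqn (x0 - y0)], and [lam] exceeds [C * |r|], the cost
   of the midpoint defect. *)
have k1 := sub _ _ _ _ t10' J1; have k2 := sub _ _ _ _ t20' J2; have k3 := sup _ _ _ _ t30' J3.
have pL1 := superjet_momentum L0 J1 (fun y => _).
have {}pL1 : `|(2 * c) *: (x0 - y0) + (2 * g) *: r| <= L.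
  by apply: (superjet_momentum L0 J1) => y; rewrite distrC; apply: le_trans (ler_norm _) (vx _ _ _ t10).
have pL2 : `|(- (2 * c)) *: (x0 - y0) + (2 * g) *: r| <= L.
  by apply: (superjet_momentum L0 J2) => y; rewrite distrC; apply: le_trans (ler_norm _) (vx _ _ _ t20).
have := hK x0 y0 z0 _ _ pL1 pL2.
have -> : 2^-1 *: ((2 * c) *: (x0 - y0) + (2 * g) *: r + ((- (2 * c)) *: (x0 - y0) + (2 * g) *: r)) = (2 * g) *: r.
  by clear -n; apply/rowP => i; rewrite !mxE; lra.
have -> : (2 * c) *: (x0 - y0) + (2 * g) *: r - ((- (2 * c)) *: (x0 - y0) + (2 * g) *: r) = (4 * c) *: (x0 - y0).
  by clear -n; apply/rowP => i; rewrite !mxE; ring.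
rewrite sqnZ -rE -/S0 => mid1.
have mx0 : 0 <= (4 * B + 1) * (2 * Num.max 0 (t3 - t0)).
  by rewrite !mulr_ge0// ?le_max ?lexx// ltW.
have Cr : C * `|r| < lam by apply: le_lt_trans eC; rewrite ler_wpM2l// ltW.
have ric : (A * (t3 + dl) ^- 2 + C) * S0 <= th * (4 * c) ^+ 2 * S0.
  rewrite ler_wpM2r//.
  have w0 : 0 < (t3 + dl) ^+ 2 by rewrite exprn_gt0// ltr_wpDl.
  rewrite -(ler_pM2r w0) mulrDl mulfVK ?lt0r_neq0//.
  have -> : th * (4 * c) ^+ 2 * (t3 + dl) ^+ 2 = 16 * th * A ^+ 2.
    by rewrite /c; field; rewrite lt0r_neq0// ltr_wpDl.
  apply: le_trans riccati; rewrite lerD2l ler_pM2l//.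
  by rewrite ler_pXn2r ?nnegrE ?(ltW T0)// addr_ge0// ltW.
move: k1 k2 k3 mid1 mx0 Cr ric; rewrite /X'.
by clear -n; lra.
Qed.

End Semiconcavity.

(** * From two-sided bounds on second differences to C11 regularity *)

Section SecondDifferences.
Context {R : realType}.

Lemma differentiable_eps (V W : normedModType R) (f : V -> W) (df : {linear V -> W}) (x : V) :
  continuous df ->
  (forall e : R, 0 < e -> exists2 r : R, 0 < r &
    forall y, `|y - x| < r -> `|f y - f x - df (y - x)| <= e * `|y - x|) ->
  differentiable f x.
Proof.
move=> cdf H; apply/diffP => /=.
apply: (@getPex _ (fun (df : {linear V -> W}) => continuous df /\
  forall y, f y = f (lim (nbhs x)) + df (y - lim (nbhs x))
                  +o_(y \near x) (y - lim (nbhs x)))).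
have E : f = (fun y => f x + df (y - x)) +o_ x (fun y => y - x).
  apply/eqaddoP => e e0; have [r r0 hr] := H e e0; apply/near_eps; exists r => // y yr.
  by have := hr y yr; rewrite -addrA -opprD.
by exists df; split=> //; rewrite lim_id//; move: E; rewrite funeqE.
Qed.

Lemma lipschitz_onI (V W : normedModType R) (A : set V) (f : V -> W) (k : R) :
  (forall x y, A x -> A y -> `|f x - f y| <= k * `|x - y|) -> [lipschitz f x | x in A].
Proof.
move=> H; exists k; split; first by rewrite num_real.
move=> M kM [x y] [/= Ax Ay]; apply: le_trans (H x y Ax Ay) _.
by rewrite ler_wpM2r// ltW.
Qed.

Lemma lipschitz_onE (V W : normedModType R) (A : set V) (f : V -> W) :
  [lipschitz f x | x in A] -> exists2 k : R, 0 < k &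
  forall x y, A x -> A y -> `|f x - f y| <= k * `|x - y|.
Proof.
move=> [M [_ hM]]; exists (`|M| + 1); first by rewrite ltr_wpDl.
move=> x y Ax Ay; apply: (hM (`|M| + 1) _ (x, y)) => //.
by have := ler_norm M; lra.
Qed.

Context {n : nat}.

Lemma dotp_linear (p : 'rV[R]_n) : linear (dotp p : 'rV[R]_n -> R).
Proof. by move=> a u v; rewrite dotpDr dotpZr. Qed.

HB.instance Definition _ (p : 'rV[R]_n) :=
  GRing.isLinear.Build R 'rV[R]_n R _ (dotp p : 'rV[R]_n -> R) (dotp_linear p).

(** A quantitative C^{1,1} bound that names the gradient and the constant: it yields
    differentiability, [grad f = P] and a Lipschitz bound on [P]. *)
Definition quad_diff (f : 'rV[R]_n -> R) (P : 'rV[R]_n -> 'rV[R]_n) (C : R) :=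
  forall x h, `|f (x + h) - f x - dotp (P x) h| <= C * sqn h.

Lemma quad_diff_eps f P C x : 0 <= C -> quad_diff f P C -> forall e : R, 0 < e ->
  exists2 r : R, 0 < r & forall y, `|y - x| < r -> `|f y - f x - dotp (P x) (y - x)| <= e * `|y - x|.
Proof.
move=> C0 H e e0; exists (e / (C * n%:R + 1)); first by rewrite divr_gt0// ltr_wpDl// mulr_ge0.
move=> y yr; have := H x (y - x); rewrite subrKC => /le_trans; apply.
apply: le_trans (ler_wpM2l C0 (sqn_le_norm _)) _.
rewrite expr2 !mulrA ler_wpM2r//.
move: yr; rewrite ltr_pdivlMr ?ltr_wpDl ?mulr_ge0//.
by have := normr_ge0 (y - x); clear -n; lra.
Qed.

Lemma quad_diff_differentiable f P C x : 0 <= C -> quad_diff f P C -> differentiable f x.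
Proof.
move=> C0 H; apply: (@differentiable_eps _ _ f (dotp (P x) : {linear 'rV[R]_n -> R})).
  by apply: cts_dotp; [exact: cts_cst|exact: cts_id].
exact: (quad_diff_eps _ C0 H).
Qed.

Lemma quad_diff_derive f P C x v : 0 <= C -> quad_diff f P C -> is_derive x v f (dotp (P x) v).
Proof.
move=> C0 H; apply/is_derive_eps => e e0.
have q0 : 0 < e / (C * sqn v + 1) by rewrite divr_gt0// ltr_wpDl// mulr_ge0 ?sqn_ge0.
exists (e / (C * sqn v + 1)) => // h hr; have := H x (h *: v); rewrite dotpZr => /le_trans; apply.
rewrite sqnZ -(real_normK (num_real h)).
have -> : C * (`|h| ^+ 2 * sqn v) = (`|h| * (C * sqn v)) * `|h| by ring.
rewrite ler_wpM2r//.
move: hr; rewrite ltr_pdivlMr ?ltr_wpDl ?mulr_ge0 ?sqn_ge0//.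
by have := normr_ge0 h; clear -n; lra.
Qed.

Lemma quad_diff_grad f P C x : 0 <= C -> quad_diff f P C -> grad f x = P x.
Proof.
move=> C0 H; apply/rowP => i; rewrite mxE.
by have [_ ->] := quad_diff_derive x (delta_mx 0 i) C0 H; rewrite dotp_delta.
Qed.

Lemma norm_le_dotp (p : 'rV[R]_n) (c : R) : 0 <= c ->
  (forall i (s : R), `|s| <= 1 -> dotp p (s *: delta_mx 0 i) <= c) -> `|p| <= c.
Proof.
move=> c0 H; apply: norm_le_coord => // i; rewrite ler_norml; apply/andP; split.
  by have := H i (- 1); rewrite dotpZr dotp_delta normrN normr1 => /(_ (lexx _)); lra.
by have := H i 1; rewrite dotpZr dotp_delta normr1 => /(_ (lexx _)); lra.
Qed.

(** The expansions at [x] towards [y] and [y + e], and at [y] towards [y + e], isolate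
    [dotp (P y - P x) e] up to three quadratic errors. With [e] along a coordinate and at most as
    long as [y - x], they add up to [C (3 + 3 n) |y - x|^2]. *)
Lemma quad_diff_lip f P (C : R) : 0 <= C -> quad_diff f P C ->
  forall x y, `|P y - P x| <= C * (3 + 3 * n%:R) * `|y - x|.
Proof.
move=> C0 H x y; set a := y - x.
have [a0|a0] := eqVneq a 0.
  by have /eqP := a0; rewrite subr_eq0 => /eqP ->; rewrite subrr normr0 mulr_ge0// mulr_ge0// addr_ge0// mulr_ge0.
have na : 0 < `|a| by rewrite normr_gt0.
apply: norm_le_dotp => [|i s s1]; first by rewrite !mulr_ge0// addr_ge0// mulr_ge0.
pose e := (`|a| * s) *: (delta_mx 0 i : 'rV[R]_n).
have ne : sqn e <= `|a| ^+ 2.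
  have -> : sqn e = (`|a| * s) ^+ 2 by rewrite sqnZ /sqn dotp_delta mxE !eqxx mulr1.
  have : s ^+ 2 <= 1 by rewrite -(real_normK (num_real s)) expr_le1.
  by rewrite exprMn => h; rewrite ler_piMr ?sqr_ge0.
have sa := sqn_le_norm a.
have h1 := H y e; have h2 := H x (a + e); have h3 := H x a.
have yE : y = x + a by rewrite /a subrKC.
have sae : sqn (a + e) <= 2 * sqn a + 2 * sqn e.
  by have := sqn_ge0 (a - e); rewrite sqnB sqnD; clear -n; lra.
rewrite dotpDr addrA -yE in h2; rewrite -yE in h3.
have : dotp (P y - P x) e <= C * (3 + 3 * n%:R) * `|a| * `|a|.
  rewrite dotpDl dotpNl.
  have c1 : C * sqn e <= C * `|a| ^+ 2 by rewrite ler_wpM2l.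
  have c2 : C * sqn a <= C * (n%:R * `|a| ^+ 2) by rewrite ler_wpM2l.
  have c3 : C * sqn (a + e) <= C * (2 * sqn a + 2 * sqn e) by rewrite ler_wpM2l.
  move: h1 h2 h3; rewrite !ler_norml => /andP[h1 _] /andP[_ h2] /andP[h3 _].
  by move: h1 h2 h3 c1 c2 c3; clear -n; lra.
move=> hf; rewrite -(ler_pM2r na); apply: le_trans hf.
by rewrite /e -scalerA (dotpZr `|a|) mulrC.
Qed.

Lemma quad_diff_C1 f P C : 0 <= C -> quad_diff f P C -> C1 f.
Proof.
move=> C0 H; split=> [x _|v x _]; first exact: quad_diff_differentiable C0 H.
rewrite (_ : 'D_v f = fun x => dotp (P x) v).
  have cP : continuous P.
    apply/cts_eps => z e e0; have k0 : 0 <= C * (3 + 3 * n%:R) by rewrite mulr_ge0// addr_ge0// mulr_ge0.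
    exists (e / (C * (3 + 3 * n%:R) + 1)); first by rewrite divr_gt0// ltr_wpDl.
    move=> w wz; apply: le_lt_trans (quad_diff_lip C0 H _ _) _.
    move: wz; rewrite ltr_pdivlMr ?ltr_wpDl//; have := normr_ge0 (w - z); clear -n; lra.
  have cc := cts_dotp cP (cts_cst (c := v)); exact: cc.
by apply/funext => y; have [_ ->] := quad_diff_derive y v C0 H.
Qed.

Lemma quad_diff_C11 f P C : 0 <= C -> quad_diff f P C -> C11 f.
Proof.
move=> C0 H; split; first exact: quad_diff_C1 C0 H.
apply: (@lipschitz_onI _ _ _ _ (C * (3 + 3 * n%:R))) => x y _ _.
by rewrite !(quad_diff_grad _ C0 H); exact: quad_diff_lip.
Qed.

(** The intervals of centre [a k] and radius [2 ^- k * s] are nested. *)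
Lemma geometric_limit (a : nat -> R) (s : R) : 0 <= s ->
  (forall k : nat, `|a k.+1 - a k| <= 2 ^- k.+1 * s) ->
  exists l : R, forall k : nat, `|a k - l| <= 2 ^- k * s.
Proof.
move=> s0 step.
have half (k : nat) : 2 ^- k = 2 * 2 ^- k.+1 :> R by rewrite exprS; field; exact: lt0r_neq0 (exprn_gt0 _ _).
pose b k := a k - 2 ^- k * s; pose c k := a k + 2 ^- k * s.
have p2 (k : nat) : 0 < 2 ^- k :> R by rewrite invr_gt0 exprn_gt0.
have bS k : b k <= b k.+1.
  by have := lerNnormlW (step k); rewrite /b (half k); clear -n; lra.
have cS k : c k.+1 <= c k.
  by have := ler_normlW (step k); rewrite /c (half k); clear -n; lra.
have bm i j : b i <= b (i + j)%N.
  by elim: j => [|j IH]; rewrite ?addn0// addnS; apply: le_trans IH (bS _).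
have cm i j : c (i + j)%N <= c i.
  by elim: j => [|j IH]; rewrite ?addn0// addnS; apply: le_trans (cS _) IH.
have bc i : b i <= c i.
  by have : 0 <= 2 ^- i * s; [rewrite mulr_ge0// ltW|rewrite /b /c; clear -n; lra].
have bc2 i j : b i <= c j by apply: le_trans (bm i j) _; apply: le_trans (bc _) _; rewrite addnC.
have hs : has_sup (range b).
  by split; [exists (b 0%N), 0%N|exists (c 0%N) => _ [i _ <-]].
exists (sup (range b)) => k; rewrite ler_norml; apply/andP; split.
  have : sup (range b) <= c k by apply: ge_sup; [exists (b 0%N), 0%N|move=> _ [i _ <-]].
  by rewrite /c; clear -n; lra.
have : b k <= sup (range b) by apply: sup_upper_bound => //; exists k.
by rewrite /b; clear -n; lra.
Qed.

(** Two consecutive dyadic quotients differ by a rescaled second difference centred at the midpoint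
    of the longer step. *)
Lemma dyadic_derivative (f : 'rV[R]_n -> R) (C : R) x h : 0 <= C ->
  (forall x h, `|f (x + h) + f (x - h) - 2 * f x| <= C * sqn h) ->
  exists l : R, forall k : nat, `|2 ^+ k * (f (x + 2 ^- k *: h) - f x) - l| <= 2 ^- k * (C * sqn h).
Proof.
move=> C0 H; pose s := C * sqn h; have s0 : 0 <= s by rewrite mulr_ge0 ?sqn_ge0.
pose a (k : nat) := 2 ^+ k * (f (x + 2 ^- k *: h) - f x).
have p2 (k : nat) : 0 < 2 ^- k :> R by rewrite invr_gt0 exprn_gt0.
have step (k : nat) : `|a k.+1 - a k| <= 2 ^- k.+1 * s.
  have := H (x + 2 ^- k.+1 *: h) (2 ^- k.+1 *: h).
  have -> : x + 2 ^- k.+1 *: h + 2 ^- k.+1 *: h = x + 2 ^- k *: h.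
    rewrite -addrA -scalerDl; congr (_ + _ *: _); rewrite exprS; field; exact: lt0r_neq0 (exprn_gt0 _ _).
  rewrite addrK sqnZ => h1.
  have -> : a k.+1 - a k = - (2 ^+ k * (f (x + 2 ^- k *: h) + f x - 2 * f (x + 2 ^- k.+1 *: h))).
    by rewrite /a exprS; ring.
  rewrite normrN normrM gtr0_norm ?exprn_gt0//.
  have e1 : 2 ^- k.+1 * s = 2 * (2 ^+ k * (C * ((2 ^- k.+1) ^+ 2 * sqn h))).
    by rewrite /s exprS; field; exact: lt0r_neq0 (exprn_gt0 _ _).
  have := ler_wpM2l (ltW (exprn_gt0 k (ltr0n R 2))) h1; rewrite e1.
  have : 0 <= 2 ^+ k * (C * ((2 ^- k.+1) ^+ 2 * sqn h)).
    by rewrite mulr_ge0 ?exprn_ge0// mulr_ge0// mulr_ge0 ?sqr_ge0 ?sqn_ge0.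
  by clear -n; lra.
by have [l hl] := geometric_limit s0 step; exists l.
Qed.

Lemma expn2_small (X Y D : R) : (forall k : nat, X <= Y + 2 ^- k * D) -> X <= Y.
Proof.
move=> H; rewrite leNgt; apply/negP => YX.
have := archi_boundP (x := `|D| / (X - Y)); rewrite divr_ge0 ?subr_ge0 ?(ltW YX)// => /(_ isT).
set k := Num.bound _ => hk.
have kp : k%:R <= 2 ^+ k :> R by rewrite -natrX ler_nat ltnW// ltn_expl.
have := lt_le_trans hk kp; rewrite ltr_pdivrMr ?subr_gt0// => h1.
have := H k; have : 2 ^- k * D <= 2 ^- k * `|D| by rewrite ler_wpM2l ?ler_norm// invr_ge0 exprn_ge0.
have : 2 ^- k * `|D| < X - Y by rewrite mulrC ltr_pdivrMr ?exprn_gt0// mulrC.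
by clear -n; lra.
Qed.

Lemma expn2_eq (X Y D : R) : (forall k : nat, `|X - Y| <= 2 ^- k * D) -> X = Y.
Proof.
move=> H; apply/eqP; rewrite eq_le; apply/andP; split.
  by apply: (@expn2_small _ _ D) => k; have := ler_normlW (H k); lra.
by apply: (@expn2_small _ _ D) => k; have := lerNnormlW (H k); lra.
Qed.

(** Additivity gives homogeneity for natural factors. For a real factor [s], [2 ^ k * s] is compared
    with its integer part, and the bound on [l] controls the remainder. *)
Lemma additive_lipschitz_linear (l : 'rV[R]_n -> R) (L : R) :
  (forall a b, l (a + b) = l a + l b) -> (forall a, `|l a| <= L * `|a|) ->
  forall h, l h = dotp (\row_i l (delta_mx 0 i)) h.
Proof.
move=> lD lL.
have l0 : l 0 = 0 by have := lD 0 0; rewrite addr0; lra.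
have lN a : l (- a) = - l a by have := lD a (- a); rewrite subrr l0; lra.
have lM (m : nat) a : l (m%:R *: a) = m%:R * l a.
  elim: m => [|m IH]; first by rewrite scale0r l0 mul0r.
  by rewrite -natr1 scalerDl scale1r lD IH mulrDl mul1r.
have lZ (s : R) a : l (s *: a) = s * l a.
  wlog s0 : s / 0 <= s.
    move=> W; have [|s0] := lerP 0 s; first exact: W.
    have := W (- s); rewrite oppr_ge0 => /(_ (ltW s0)).
    by rewrite scaleNr lN mulNr => /oppr_inj.
  apply: (@expn2_eq _ _ (2 * L * `|a|)) => k.
  have q0 : 0 <= 2 ^+ k * s by rewrite mulr_ge0// exprn_ge0.
  have /andP[m1 m2] := truncn_itv q0; set m := Num.trunc _ in m1 m2.
  pose t := 2 ^+ k * s - m%:R.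
  have t01 : 0 <= t <= 1 by rewrite /t; rewrite -natr1 in m2; apply/andP; split; lra.
  have p0 : 0 < 2 ^+ k :> R by rewrite exprn_gt0.
  have e1 : 2 ^+ k * (l (s *: a) - s * l a) = l (t *: a) - t * l a.
    have : 2 ^+ k * l (s *: a) = l ((m%:R + t) *: a).
      by rewrite -natrX -lM scalerA natrX /t subrKC.
    by rewrite scalerDl lD lM /t => h; rewrite mulrBr h; ring.
  have : `|l (t *: a) - t * l a| <= 2 * L * `|a|.
    have a1 := lL (t *: a); have a2 := lL a; case/andP: t01 => t0 t1.
    apply: le_trans (ler_normB _ _) _; rewrite normrM normrZ (ger0_norm t0) in a1 *.
    have La : 0 <= L * `|a| by apply: le_trans a2.
    have c1 : t * (L * `|a|) <= L * `|a| by rewrite ler_piMl.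
    have c2 : t * `|l a| <= t * (L * `|a|) by rewrite ler_wpM2l.
    by move: a1 c1 c2; clear -n; lra.
  rewrite -e1 normrM gtr0_norm// => h1; rewrite -(ler_pM2l p0); apply: le_trans h1 _.
  by rewrite mulrA divff ?mul1r// lt0r_neq0.
have lS (I : Type) (r : seq I) (F : I -> 'rV[R]_n) : l (\sum_(i <- r) F i) = \sum_(i <- r) l (F i).
  by elim: r => [|i r IH]; rewrite ?big_nil ?l0// !big_cons lD IH.
move=> h; rewrite {1}[h]row_sum_delta lS /dotp; apply: eq_bigr => i _.
by rewrite lZ mxE mulrC.
Qed.

(** The limits of dyadic quotients form the candidate differential. It is additive because steps
    along [a] and [b] are symmetric about the step along their mean, and bounded by the Lipschitz
    estimate, hence linear; the quotient with [k = 0] is the required expansion. *)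
Lemma second_difference_quad_diff (f : 'rV[R]_n -> R) (C L : R) : 0 <= C ->
  (forall x h, `|f (x + h) + f (x - h) - 2 * f x| <= C * sqn h) ->
  (forall x y, `|f x - f y| <= L * `|x - y|) ->
  exists P, quad_diff f P C.
Proof.
move=> C0 H fL.
have key x : exists p, forall h, `|f (x + h) - f x - dotp p h| <= C * sqn h.
  pose l h := sval (cid (dyadic_derivative x h C0 H)).
  have lP h (k : nat) : `|2 ^+ k * (f (x + 2 ^- k *: h) - f x) - l h| <= 2 ^- k * (C * sqn h).
    by rewrite /l; case: cid.
  have p0 (k : nat) : 0 < 2 ^+ k :> R by rewrite exprn_gt0.
  have p1 (k : nat) : 0 < 2 ^- k :> R by rewrite invr_gt0.
  have l2 h : l (2 *: h) = 2 * l h.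
    apply: (@expn2_eq _ _ (4 * (C * sqn h))) => k.
    have := lP h k; have := lP (2 *: h) k.+1.
    have -> : 2 ^- k.+1 *: (2 *: h) = 2 ^- k *: h.
      by rewrite scalerA exprS; congr (_ *: _); field; exact: lt0r_neq0.
    rewrite sqnZ; have -> : 2 ^- k = 2 * 2 ^- k.+1 :> R by rewrite exprS; field; exact: lt0r_neq0.
    rewrite !ler_norml exprS => /andP[a1 a2] /andP[a3 a4]; apply/andP; move: a1 a2 a3 a4; clear -n; split; lra.
  have lD a b : l (a + b) = l a + l b.
    apply: (@expn2_eq _ _ (C * (sqn a + sqn b + 2 * sqn (2^-1 *: (a + b)) + sqn (2^-1 *: (a - b))))) => k.
    have e2 : l (a + b) = 2 * l (2^-1 *: (a + b)) by rewrite -l2 scalerA divff// scale1r.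
    rewrite e2.
    have h1 := lP a k; have h2 := lP b k; have h3 := lP (2^-1 *: (a + b)) k.
    have := H (x + 2 ^- k *: (2^-1 *: (a + b))) (2 ^- k *: (2^-1 *: (a - b))).
    have -> : x + 2 ^- k *: (2^-1 *: (a + b)) + 2 ^- k *: (2^-1 *: (a - b)) = x + 2 ^- k *: a.
      rewrite -addrA -!scalerDr; congr (_ + _ *: _); clear -n; apply/rowP => i; rewrite !mxE; lra.
    have -> : x + 2 ^- k *: (2^-1 *: (a + b)) - 2 ^- k *: (2^-1 *: (a - b)) = x + 2 ^- k *: b.
      rewrite -addrA -!scalerBr; congr (_ + _ *: _); clear -n; apply/rowP => i; rewrite !mxE; lra.
    rewrite sqnZ => h4; have := ler_wpM2l (ltW (p0 k)) h4.
    have -> : 2 ^+ k * (C * ((2 ^- k) ^+ 2 * sqn (2^-1 *: (a - b)))) = 2 ^- k * (C * sqn (2^-1 *: (a - b))).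
      by field; exact: lt0r_neq0.
    rewrite -[X in X * `|_|]gtr0_norm// -normrM.
    move: h1 h2 h3; rewrite !ler_norml => /andP[a1 a2] /andP[a3 a4] /andP[a5 a6] /andP[a7 a8].
    by apply/andP; move: a1 a2 a3 a4 a5 a6 a7 a8; clear -n; split; lra.
  have lL a : `|l a| <= L * `|a|.
    apply: (@expn2_small _ _ (C * sqn a)) => k.
    have := lP a k; have := fL (x + 2 ^- k *: a) x; rewrite addrAC subrr add0r normrZ (gtr0_norm (p1 k)) => h1.
    have := ler_wpM2l (ltW (p0 k)) h1.
    have -> : 2 ^+ k * (L * (2 ^- k * `|a|)) = L * `|a| by field; exact: lt0r_neq0.
    rewrite -[X in X * `|_|]gtr0_norm// -normrM => h2 h3.
    have := ler_normD (2 ^+ k * (f (x + 2 ^- k *: a) - f x)) (l a - 2 ^+ k * (f (x + 2 ^- k *: a) - f x)).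
    by rewrite subrKC (distrC (l a)); move: h2 h3; clear -n; lra.
  exists (\row_i l (delta_mx 0 i)) => h.
  rewrite -(additive_lipschitz_linear lD lL).
  by have := lP h 0%N; rewrite expr0 invr1 scale1r !mul1r.
by exists (fun x => sval (cid (key x))) => x h; case: cid => p /=.
Qed.

End SecondDifferences.

(** * From viscosity solutions to jets at a frozen time *)

Section Slices.
Context {R : realType} {n : nat}.
Notation P := ('rV[R]_n * 'rV[R]_n)%type.

Lemma second_derivative_min (f df : R -> R) (c : R) : (forall y, is_derive y (1 : R) f (df y)) ->
  df 0 = 0 -> is_derive 0 (1 : R) df c -> 0 < c ->
  exists2 r : R, 0 < r & forall y, `|y| < r -> f 0 <= f y.
Proof.
move=> h df0 /is_derive1_eps dc c0.
have c20 : 0 < c / 2 by rewrite divr_gt0.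
have [r r0 hr] := dc _ c20; exists r => // y.
have key s : `|s| < r -> `|df s - s * c| <= c / 2 * `|s|.
  by move=> sr; have := hr s; rewrite !subr0 df0 subr0; exact.
rewrite ltr_norml => /andP[y1 y2]; have [y0|y0] := leP 0 y.
  have [s /andP[s0 sy] es] := mvt y0 (fun s _ => h s).
  have := key s; rewrite ger0_norm// => /(_ (le_lt_trans sy y2)).
  rewrite ler_norml => /andP[k1 _].
  have : 0 <= df s * (y - 0).
    rewrite subr0 mulr_ge0//; have : 0 <= c / 2 * s by rewrite mulr_ge0// ltW.
    by move: k1; clear -n; lra.
  by rewrite -es subr_ge0.
have [s /andP[s0 sy] es] := mvt (ltW y0) (fun s _ => h s).
have := key s; rewrite ler0_norm// => kk.
have /kk : - s < r by move: y1 s0; clear -n; lra.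
rewrite ler_norml => /andP[_ k1].
have : df s * (0 - y) <= 0.
  rewrite sub0r; apply: mulr_le0_ge0; last by rewrite oppr_ge0 ltW.
  have : 0 <= c / 2 * - s by rewrite mulr_ge0 ?oppr_ge0// ltW.
  by move: k1; clear -n; lra.
by rewrite -es subr_le0.
Qed.

Lemma periodic_int (f : R -> R) (w : R) (m : int) y : periodic f w -> f (y + w * m%:~R) = f y.
Proof.
move=> pf; case: m => m; first by rewrite -pmulrn mulr_natr periodicn.
by rewrite NegzE intrN mulrN -pmulrn mulr_natr -[in RHS](subrK (w *+ m.+1) y) periodicn.
Qed.

(** Test functions must be periodic, so a parabola is replaced by a trigonometric function above it
    near 0: the second derivative of the latter at 0 is [M w^2 = 2 N + 1], one more than that of the
    parabola. *)
Lemma periodic_parabola (c N : R) : 0 <= N -> exists q dq : R -> R, [/\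
  (forall y, is_derive y (1 : R) q (dq y)) /\ continuous dq,
  forall y (m : int), q (y + m%:~R) = q y, dq 0 = c, q 0 = 0 &
  exists2 r : R, 0 < r & forall y, `|y| < r -> c * y + N * y ^+ 2 <= q y].
Proof.
move=> N0; have [w [w0 wE]] : exists w : R, 0 < w /\ w = pi *+ 2.
  by exists (pi *+ 2); rewrite mulrn_wgt0// pi_gt0.
have w1 : w != 0 by exact: lt0r_neq0.
pose M := (2 * N + 1) / w ^+ 2.
have Mw : M * w ^+ 2 = 2 * N + 1 by rewrite /M divfK// expf_neq0.
pose q y := c / w * sin (w * y) + M * (1 - cos (w * y)).
pose dq y := c * cos (w * y) + M * (w * sin (w * y)).
have dw (y : R) : is_derive y (1 : R) (fun y => w * y) w.
  by apply: is_derive_eq; exact: mulr1.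
have ds (y : R) : is_derive y (1 : R) (fun y => sin (w * y)) (cos (w * y) * w).
  exact: (@is_derive1_comp _ sin (fun y => w * y)).
have dc (y : R) : is_derive y (1 : R) (fun y => cos (w * y)) (- sin (w * y) * w).
  exact: (@is_derive1_comp _ cos (fun y => w * y)).
have dqP (y : R) : is_derive y (1 : R) q (dq y).
  rewrite /q /dq; have d1 := ds y; have d2 := dc y; apply: is_derive_eq.
  by rewrite /GRing.scale/=; field.
have cw : continuous (fun y : R => w * y) by apply: ctsM; [exact: cts_cst|exact: cts_id].
exists q, dq; split.
- split => //; rewrite /dq; apply: ctsD.
    apply: ctsM; first exact: cts_cst.
    by apply: (cts_comp (@continuous_cos R)).
  apply: ctsM; first exact: cts_cst.
  apply: ctsM; first exact: cts_cst.
  by apply: (cts_comp (@continuous_sin R)).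
- move=> y m; rewrite /q mulrDr !periodic_int// wE; [exact: cosD2pi|exact: sinD2pi].
- by rewrite /dq mulr0 sin0 cos0 !mulr0 addr0 mulr1.
- by rewrite /q mulr0 sin0 cos0 subrr !mulr0 addr0.
pose f y := q y - c * y - N * y ^+ 2.
pose df y := dq y - c - 2 * N * y.
have dfP (y : R) : is_derive y (1 : R) f (df y).
  rewrite /f /df; have d1 := dqP y; apply: is_derive_eq.
  by rewrite /GRing.scale/=; ring.
have df0 : df 0 = 0 by rewrite /df /dq mulr0 sin0 cos0 !mulr0; ring.
have ddf : is_derive 0 (1 : R) df 1.
  rewrite /df /dq; have d1 := ds 0; have d2 := dc 0; apply: is_derive_eq.
  by rewrite /GRing.scale/= mulr0 sin0 cos0; move: Mw; rewrite expr2; clear -n; lra.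
have [r r0 hr] := second_derivative_min dfP df0 ddf ltr01.
exists r => // y /hr; rewrite /f /q mulr0 sin0 cos0; move: (c / w * sin _ + _) => Q.
by clear -n; lra.
Qed.

Lemma C1_C1_on (V W : normedModType R) (A : set V) (f : V -> W) : C1 f -> C1_on A f.
Proof. by move=> [h1 h2]; split=> [z _|v z _]; [exact: h1|exact: h2]. Qed.

Definition jcont3 (U : R -> R -> 'rV[R]_n -> R) := continuous (fun z : (R * R) * 'rV[R]_n => U z.1.1 z.1.2 z.2).

Lemma jcont3_comp (T : topologicalType) U (f g : T -> R) (h : T -> 'rV[R]_n) :
  jcont3 U -> continuous f -> continuous g -> continuous h -> continuous (fun z => U (f z) (g z) (h z)).
Proof. by move=> cU cf cg ch; apply: (cts_comp cU (cts_pair (cts_pair cf cg) ch)). Qed.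

(* [a] and [b] are the two time coordinates of [T], the equation being driven by [a];
   [emb] is the inverse of [(a, b)]. *)
Lemma slice_jet_sub (T : normedModType R) (O : set T) (e : T) (a b : {linear T -> R})
    (emb : R -> R -> T) (K : P -> R) (u : T * 'rV[R]_n -> R) (U : R -> R -> 'rV[R]_n -> R) :
  continuous a -> continuous b -> a e = 1 -> b e = 0 ->
  (forall t s, a (emb t s) = t /\ b (emb t s) = s) ->
  (forall t s, 0 < t -> 0 < s -> O (emb t s)) ->
  continuous K -> jcont3 U ->
  (forall tau y, 0 < a tau -> 0 < b tau -> u (tau, y) = U (a tau) (b tau) y) ->
  viscosity_subsolution O e K u ->
  forall s0 : R, 0 <= s0 -> jet_sub K (fun t => U t s0).
Proof.
move=> ca cb ae be ab Oab cK cU uU vs s0 s00 t0 x0 al p t00 [M [rj [rj0 J]]].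
rewrite leNgt; apply/negP => lt0.
(* One more than the constant of the jet: the surplus makes the maximum strict and localizes nearby
   maxima. *)
pose N := `|M| + 1.
have N0 : 0 <= N by rewrite addr_ge0.
have [q [dq qP]] : exists q dq : 'I_n -> R -> R, forall i,
  [/\ (forall y, is_derive y (1 : R) (q i) (dq i y)) /\ continuous (dq i),
  forall y (m : int), q i (y + m%:~R) = q i y, dq i 0 = p 0 i, q i 0 = 0 &
  exists2 r : R, 0 < r & forall y, `|y| < r -> p 0 i * y + N * y ^+ 2 <= q i y].
  have /choice[q /choice[dq qP]] := fun i => periodic_parabola (p 0 i) N0.
  by exists q, dq.
have [rq rq0 hq] : exists2 r : R, 0 < r & forall i y, `|y| < r -> p 0 i * y + N * y ^+ 2 <= q i y.
  have /choice[ri riP] : forall i, exists r : R, 0 < r /\ forall y, `|y| < r -> p 0 i * y + N * y ^+ 2 <= q i y.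
    by move=> i; have [_ _ _ _ [r r0 hr]] := qP i; exists r.
  exists (\big[Num.min/1]_i ri i).
    by apply: lt_bigmin => // i _; case: (riP i).
  move=> i y yr; have [_] := riP i; apply; apply: lt_le_trans yr _.
  exact: bigmin_le_cond.
pose f (t : R) := al * (t - t0) + N * (t - t0) ^+ 2.
pose df (t : R) := al + 2 * N * (t - t0).
have fP (t : R) : is_derive t (1 : R) f (df t).
  by rewrite /f /df; apply: is_derive_eq; rewrite /GRing.scale/=; ring.
pose g (x : 'rV[R]_n) := \sum_i q i (x 0 i - x0 0 i).
have gq (x : 'rV[R]_n) : (forall i, `|x 0 i - x0 0 i| < rq) -> dotp p (x - x0) + N * sqn (x - x0) <= g x.
  move=> xr; rewrite /sqn /dotp mulr_sumr -big_split; apply: ler_sum => i _ /=.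
  by rewrite !mxE -expr2; exact: hq.
pose Df (x : 'rV[R]_n) : 'rV[R]_n := \row_i dq i (x 0 i - x0 0 i).
have cE : continuous (fun z : R * 'rV[R]_n => df z.1 + K (z.2, Df z.2)).
  have c1 : continuous (fun z : R * 'rV[R]_n => z.1) by apply: cts_fst; exact: cts_id.
  have c2 : continuous (fun z : R * 'rV[R]_n => z.2) by apply: cts_snd; exact: cts_id.
  apply: ctsD.
    apply: ctsD; first exact: cts_cst.
    by apply: ctsM; [exact: cts_cst|apply: ctsB => //; exact: cts_cst].
  apply: (cts_comp cK); apply: cts_pair => //.
  have -> : (fun z : R * 'rV[R]_n => Df z.2) = fun z => \sum_i dq i (z.2 0 i - x0 0 i) *: (delta_mx 0 i : 'rV[R]_n).
    apply/funext => z; rewrite [LHS]row_sum_delta; apply: eq_bigr => i _; by rewrite mxE.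
  apply: cts_sum => i; apply: ctsZ; last exact: cts_cst.
  have [[_ cdq] _ _ _ _] := qP i; apply: (cts_comp cdq).
  by apply: ctsB; [exact: cts_coord|exact: cts_cst].
have E0 : df t0 + K (x0, Df x0) = al + K (x0, p).
  rewrite /df subrr mulr0 addr0; congr (_ + K (_, _)).
  by apply/rowP => i; rewrite mxE subrr; have [] := qP i.
have E0' : 0 < df t0 + K (x0, Df x0) by rewrite E0.
(* The maximum with both times free is only close to [(t0, x0)], so the strict failure of the
   inequality is first extended to a neighbourhood. *)
have [rE rE0 hE] := (cts_eps _).1 cE (t0, x0) _ E0'.
have [r1 [r10 r1t r1q]] := exists_lt_min t00 rq0.
have [r2 [r20 r21 r2j]] := exists_lt_min r10 rj0.
have [r [r0 rr2 rrE]] := exists_lt_min r20 rE0.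
pose Box := [set t : R | t0 - r <= t <= t0 + r] `*` [set x : 'rV[R]_n | `|x - x0| <= r].
have cBox : compact Box by apply: compact_setX; [exact: compact_itv_le|exact: compact_cball_at].
have r28 : 0 < r ^+ 2 / 8 by rewrite divr_gt0 ?exprn_gt0.
(* Two errors of [r^2 / 8], at the reference point and at the maximum, leave at most [r^2 / 4] for
   the penalizations, which keeps the maximum inside the box. *)
have [sg sg0 hsg] : exists2 sg : R, 0 < sg & forall (t : R) (x : 'rV[R]_n) (s : R), Box (t, x) -> `|s - s0| < sg ->
    `|U t s x - U t s0 x| < r ^+ 2 / 8.
  have cB : compact ((([set t : R | t0 - r <= t <= t0 + r] `*` [set s0 : R])) `*` [set x : 'rV[R]_n | `|x - x0| <= r]).
    apply: compact_setX; last exact: compact_cball_at.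
    by apply: compact_setX; [exact: compact_itv_le|exact: compact_set1].
  have [d d0 hd] := uniform_on_compact cB cU r28; exists d => // t x s [/= tB xB] sd.
  apply: (hd ((t, s0), x) ((t, s), x)) => //.
  by rewrite !prod_normE/= !subrr !normr0 !gt_max sd d0.
(* The penalization is centred strictly after [s0], and [k] keeps the maximum within [sg / 3] of its
   centre: even for [s0 = 0] the maximum lies over positive times, where the equation holds. *)
pose s1 := s0 + sg / 3.
pose k := (r ^+ 2 + 1) / (sg / 3) ^+ 2.
have kE : k * (sg / 3) ^+ 2 = r ^+ 2 + 1 by rewrite /k divfK// expf_neq0// lt0r_neq0// divr_gt0.
have k0 : 0 < k by rewrite divr_gt0 ?exprn_gt0 ?divr_gt0// ltr_wpDl ?sqr_ge0.
pose Phi (t s : R) x := U t s x - f t - g x - k * (s - s1) ^+ 2.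
have cg : continuous g.
  apply: cts_sum => i; apply: (@cts_comp _ _ _ (q i)).
    by have [[dqi _] _ _ _ _] := qP i; exact: is_derive1_cts dqi.
  by apply: ctsB; [apply: cts_coord; exact: cts_id|exact: cts_cst].
have cf : continuous f by exact: is_derive1_cts fP.
have [[[t s] x] [/= [/= tB sB] xB] hmax] : exists2 z : (R * R) * 'rV[R]_n,
  (([set t : R | t0 - r <= t <= t0 + r] `*` [set s : R | s0 <= s <= s0 + 2 * (sg / 3)]) `*` [set x : 'rV[R]_n | `|x - x0| <= r]) z &
  forall z', (([set t : R | t0 - r <= t <= t0 + r] `*` [set s : R | s0 <= s <= s0 + 2 * (sg / 3)]) `*` [set x : 'rV[R]_n | `|x - x0| <= r]) z' ->
  Phi z'.1.1 z'.1.2 z'.2 <= Phi z.1.1 z.1.2 z.2.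
  apply: max_compact.
  - exists ((t0, s0), x0); split; [split|] => /=; rewrite ?subrr ?normr0 ?(ltW r0)//; apply/andP; move: r0 sg0; clear -n; split; lra.
  - by apply: compact_setX; [apply: compact_setX; exact: compact_itv_le|exact: compact_cball_at].
  - have c1 : continuous (fun z : (R * R) * 'rV[R]_n => z.1.1) by do 2!apply: cts_fst; exact: cts_id.
    have c2 : continuous (fun z : (R * R) * 'rV[R]_n => z.1.2) by apply: cts_snd; apply: cts_fst; exact: cts_id.
    have c3 : continuous (fun z : (R * R) * 'rV[R]_n => z.2) by apply: cts_snd; exact: cts_id.
    have c4 := ctsB c2 (cts_cst (c := s1)).
    rewrite /Phi; apply: ctsB; [apply: ctsB; [apply: ctsB|]|] => //.
    + exact: (cts_comp cf c1).
    + exact: (cts_comp cg c3).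
    + by apply: ctsM; [exact: cts_cst|have c5 := ctsM c4 c4; exact: c5].
have H (t' s' : R) (x' : 'rV[R]_n) : t0 - r <= t' <= t0 + r -> s0 <= s' <= s0 + 2 * (sg / 3) -> `|x' - x0| <= r ->
   Phi t' s' x' <= Phi t s x.
  by move=> h1 h2 h3; apply: (hmax ((t', s'), x')).
have low : U t0 s0 x0 - r ^+ 2 / 8 <= Phi t s x.
  have s1d : `|s1 - s0| < sg by rewrite /s1 addrAC subrr add0r gtr0_norm ?divr_gt0//; lra.
  have := hsg t0 x0 s1 _ s1d; rewrite /Box/= subrr normr0 (ltW r0) => hh.
  have {hh} := hh (conj (introT andP (conj (_ : t0 - r <= t0) (_ : t0 <= t0 + r))) isT).
  rewrite gerBl lerDl (ltW r0) => /(_ isT isT); rewrite ltr_norml => /andP[h1 _].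
  apply: le_trans (H t0 s1 x0 _ _ _); last 3 first.
  - by rewrite gerBl lerDl (ltW r0).
  - by rewrite /s1; apply/andP; split; move: sg0; clear -n; lra.
  - by rewrite subrr normr0 ltW.
  have g0 : g x0 = 0 by rewrite /g big1// => i _; rewrite subrr; have [] := qP i.
  by rewrite /Phi g0 /f !subrr !expr0n/=; move: h1; clear -n; lra.
have up : Phi t s x <= U t0 s0 x0 + r ^+ 2 / 8 - ((t - t0) ^+ 2 + sqn (x - x0)) - k * (s - s1) ^+ 2.
  have sd : `|s - s0| < sg.
    by case/andP: sB => h1 h2; rewrite ger0_norm ?subr_ge0//; move: h2 sg0; clear -n; lra.
  have := hsg t x s (conj tB xB) sd; rewrite ltr_norml => /andP[_ h1].
  have tj : `|t - t0| < rj.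
    by case/andP: tB => b1 b2; rewrite ltr_norml; apply/andP; split; move: b1 b2 rr2 r2j; clear -n; lra.
  have xj : `|x - x0| < rj by apply: le_lt_trans xB (lt_trans rr2 r2j).
  have := J t x tj xj.
  have := gq x _; have xq i : `|x 0 i - x0 0 i| < rq.
    have := coord_le_norm (x - x0) i; rewrite !mxE => /le_lt_trans; apply.
    by apply: le_lt_trans xB (lt_trans rr2 (lt_trans r21 r1q)).
  move=> /(_ xq); rewrite /Phi /f /N.
  have := sqn_ge0 (x - x0); have := sqr_ge0 (t - t0).
  move: (sqn _) (dotp _ _) (g x) ((t - t0) ^+ 2) => S D G T2 T20 S0 a1 a2.
  have : M * (T2 + S) <= `|M| * (T2 + S) by rewrite ler_wpM2r ?ler_norm// addr_ge0.
  by move: a1 a2 h1; clear -n; lra.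
have near1 : (t - t0) ^+ 2 + sqn (x - x0) + k * (s - s1) ^+ 2 <= r ^+ 2 / 4.
  by move: low up; clear -n; lra.
have ks : 0 <= k * (s - s1) ^+ 2 by rewrite mulr_ge0 ?sqr_ge0// ltW.
have r2p : 0 < r ^+ 2 by rewrite exprn_gt0.
have tr : `|t - t0| < r.
  by apply: sqrt_small => //; have := sqn_ge0 (x - x0); move: near1 ks r2p; clear -n; lra.
have xr : `|x - x0| < r.
  by apply: sqn_small => //; have := sqr_ge0 (t - t0); move: near1 ks r2p; clear -n; lra.
have sr : `|s - s1| < sg / 3.
  apply: sqrt_small; first by rewrite divr_gt0.
  rewrite -(ltr_pM2l k0) kE; have := sqn_ge0 (x - x0); have := sqr_ge0 (t - t0).
  by move: near1 r2p; clear -n; lra.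
have t_gt0 : 0 < t.
  by move: tr rr2 r21 r1t; rewrite ltr_norml => /andP[+ _]; clear -n; lra.
have [s_gt s_lt] : s0 < s /\ s < s0 + 2 * (sg / 3).
  by move: sr; rewrite ltr_norml /s1 => /andP[]; clear -n; split; lra.
have s_gt0 : 0 < s by apply: le_lt_trans s_gt.
pose ps (s : R) := k * (s - s1) ^+ 2.
have psP (y : R) : is_derive y (1 : R) ps (2 * k * (y - s1)).
  by rewrite /ps; apply: is_derive_eq; rewrite /GRing.scale/=; ring.
pose phi (z : T * 'rV[R]_n) := f (a z.1) + ps (b z.1) + g z.2.
have cfst : continuous (fst : T * 'rV[R]_n -> T) by apply: cts_fst; exact: cts_id.
have csnd : continuous (snd : T * 'rV[R]_n -> 'rV[R]_n) by apply: cts_snd; exact: cts_id.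
have C1phi : C1 phi.
  apply: C1D; first apply: C1D.
  - apply: (@C1_lin_comp _ _ _ _ _ (a \o fst : {linear (T * 'rV[R]_n)%type -> R}) f).
      exact: (cts_comp ca cfst).
    apply: (C1_real fP); apply: ctsD; first exact: cts_cst.
    by apply: ctsM; [exact: cts_cst|apply: ctsB; [exact: cts_id|exact: cts_cst]].
  - apply: (@C1_lin_comp _ _ _ _ _ (b \o fst : {linear (T * 'rV[R]_n)%type -> R}) ps).
      exact: (cts_comp cb cfst).
    apply: (C1_real psP); apply: ctsM; first exact: cts_cst.
    by apply: ctsB; [exact: cts_id|exact: cts_cst].
  - apply: C1_sum => i; have [[dqi cdqi] _ _ _ _] := qP i.
    pose qi (y : R) := q i (y - x0 0 i).
    apply: (@C1_on_eq _ _ _ _ (fun z : T * 'rV[R]_n => qi (dotp (delta_mx 0 i) z.2))).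
      apply: (@C1_lin_comp _ _ _ _ setT ((dotp (delta_mx 0 i) : {linear 'rV[R]_n -> R}) \o snd : {linear (T * 'rV[R]_n)%type -> R}) qi).
        by apply: cts_dotp => //; exact: cts_cst.
      apply: (@C1_real _ qi (fun y => dq i (y - x0 0 i))).
        move=> y; rewrite /qi -[dq i _]mulr1; apply: (@is_derive1_comp _ (q i) (fun y => y - x0 0 i)) => //.
        by apply: is_derive_eq; rewrite subr0.
      by apply: (cts_comp cdqi); apply: ctsB; [exact: cts_id|exact: cts_cst].
    by move=> z; rewrite /qi dotpC dotp_delta.
have gper (y : 'rV[R]_n) (m : 'rV[int]_n) : g (y + map_mx intr m) = g y.
  rewrite /g; apply: eq_bigr => i _; rewrite !mxE addrAC; have [_ + _ _ _] := qP i; exact.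
have tphi : test_function O phi.
  by split; [exact: C1_C1_on|move=> tau _ y m; rewrite /phi/= gper].
have [ea eb] := ab t s.
have := vs phi tphi (emb t s, x) (Oab _ _ t_gt0 s_gt0).
have -> : HJ_lhs e K phi (emb t s, x) = df t + K (x, Df x).
  rewrite /HJ_lhs /=; congr (_ + K (_, _)).
    rewrite (@derive_eq_line _ _ R _ _ (fun y => f y + (ps s + g x)) _ _ t 1).
      by have [_ ->] := is_deriveD (fP t) (is_derive_cst (ps s + g x) t (1 : R)); rewrite addr0.
    by move=> h; rewrite /phi/= !linearD !linearZ/= ae be ea eb scaler0 add0r addrA.
  apply/rowP => i; rewrite !mxE.
  have [[dqi _] _ _ _ _] := qP i.
  have dqi' : is_derive (x 0 i) (1 : R) (fun y => q i (y - x0 0 i)) (dq i (x 0 i - x0 0 i)).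
    rewrite -[dq i _]mulr1; apply: (@is_derive1_comp _ (q i) (fun y => y - x0 0 i)) => //.
    by apply: is_derive_eq; rewrite subr0.
  pose cc := f t + ps s + \sum_(j | j != i) q j (x 0 j - x0 0 j).
  rewrite (@derive_eq_line _ _ R _ _ (fun y => q i (y - x0 0 i) + cc) _ _ (x 0 i) 1).
    by have [_ ->] := is_deriveD dqi' (is_derive_cst cc (x 0 i) (1 : R)); rewrite addr0.
  move=> h; rewrite /phi/= ea eb /g (bigD1 i)//=.
  rewrite (eq_bigr (fun j => q j (x 0 j - x0 0 j))); last first.
    by move=> j ji; rewrite !mxE (negbTE ji) andbF mulr0 add0r.
  have -> : (h *: delta_mx 0 i + x) 0 i = h *: 1 + x 0 i by rewrite !mxE !eqxx.
  by rewrite /cc addrCA.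
move=> hvs.
suff : df t + K (x, Df x) <= 0.
  have := hE (t, x); rewrite prod_normE gt_max/= (lt_trans tr rrE) (lt_trans xr rrE) => /(_ isT).
  by rewrite ltr_norml => /andP[h _] h2; move: h h2; clear -n; lra.
apply: hvs; apply/near_eps.
have q1 : 0 < r - `|t - t0| by rewrite subr_gt0.
have q2 : 0 < sg / 3 - `|s - s1| by rewrite subr_gt0.
have q3 : 0 < r - `|x - x0| by rewrite subr_gt0.
have [da da0 hda] := (cts_eps a).1 ca (emb t s) _ q1.
have [da' da'0 hda'] := (cts_eps a).1 ca (emb t s) _ t_gt0.
have [db db0 hdb] := (cts_eps b).1 cb (emb t s) _ q2.
have [db' db'0 hdb'] := (cts_eps b).1 cb (emb t s) _ s_gt0.
have [d1 [d10 d1a d1a']] := exists_lt_min da0 da'0.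
have [d2 [d20 d2b d2b']] := exists_lt_min db0 db'0.
have [d3 [d30 d31 d32]] := exists_lt_min d10 d20.
have [d [d0 dd3 dq3]] := exists_lt_min d30 q3.
exists d => // -[tau y]; rewrite prod_normE gt_max/= => /andP[taud yd].
have ta := hda tau (lt_trans taud (lt_trans dd3 (lt_trans d31 d1a))).
have ta' := hda' tau (lt_trans taud (lt_trans dd3 (lt_trans d31 d1a'))).
have tb := hdb tau (lt_trans taud (lt_trans dd3 (lt_trans d32 d2b))).
have tb' := hdb' tau (lt_trans taud (lt_trans dd3 (lt_trans d32 d2b'))).
rewrite ea in ta ta'; rewrite eb in tb tb'.
have a0 : 0 < a tau by move: ta'; rewrite ltr_norml => /andP[+ _]; clear -n; lra.
have b0 : 0 < b tau by move: tb'; rewrite ltr_norml => /andP[+ _]; clear -n; lra.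
rewrite uU// uU ?ea ?eb// /phi/= ea eb.
have c1 : t0 - r <= a tau <= t0 + r.
  have hh : `|a tau - t0| <= r by move: (ler_distD t (a tau) t0) ta; clear -n; lra.
  by move: hh; rewrite ler_norml => /andP[]; clear -n; move=> h1 h2; apply/andP; split; lra.
have c2 : s0 <= b tau <= s0 + 2 * (sg / 3).
  have hh : `|b tau - s1| <= sg / 3 by move: (ler_distD s (b tau) s1) tb; clear -n; lra.
  by move: hh; rewrite ler_norml /s1 => /andP[]; clear -n; move=> h1 h2; apply/andP; split; lra.
have c3 : `|y - x0| <= r by move: (ler_distD x y x0) yd dq3; clear -n; lra.
by have := H (a tau) (b tau) y c1 c2 c3; rewrite /Phi -!/(ps _); clear -n; lra.
Qed.

End Slices.

(** * Classical time derivative of a solution that is C11 in space *)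

Section Rigidity.
Context {R : realType} {n : nat}.
Notation P := ('rV[R]_n * 'rV[R]_n)%type.
Implicit Types (K : P -> R) (v : R -> 'rV[R]_n -> R).

Lemma superjet_quad_diff v t x a p Q C : superjet v t x a p -> quad_diff (v t) Q C -> p = Q x.
Proof.
move=> [M [r [r0 J]]] H; apply/rowP => i.
have key (s : R) : `|s| <= 1 -> dotp (Q x - p) (s *: delta_mx 0 i) <= 0.
  move=> s1; apply: (@le_small _ _ _ (`|C| + `|M|) r) => // h h0 hr; rewrite add0r.
  pose y : 'rV[R]_n := h *: (s *: delta_mx 0 i).
  have ny : `|y| <= h.
    rewrite /y !normrZ (gtr0_norm h0) ler_piMr ?(ltW h0)//.
    by rewrite mulr_ile1// norm_delta.
  have sy : sqn y <= h ^+ 2.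
    have -> : sqn y = (h * s) ^+ 2 by rewrite /y scalerA sqnZ /sqn dotp_delta mxE !eqxx mulr1.
    have : s ^+ 2 <= 1 by rewrite -(real_normK (num_real s)) expr_le1.
    by rewrite exprMn => h1; rewrite ler_piMr ?sqr_ge0.
  have := J t (x + y); rewrite subrr normr0 => /(_ r0); rewrite addrAC subrr add0r => /(_ (le_lt_trans ny hr)).
  have := H x y; rewrite ler_norml => /andP[h1 _].
  have e1 : h * dotp (Q x - p) (s *: delta_mx 0 i) = dotp (Q x) y - dotp p y.
    by rewrite /y -dotpZr dotpDl dotpNl.
  have c1 : C * sqn y <= `|C| * h ^+ 2.
    by apply: le_trans (ler_wpM2r (sqn_ge0 y) (ler_norm C)) _; rewrite ler_wpM2l.
  have c2 : M * sqn y <= `|M| * h ^+ 2.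
    by apply: le_trans (ler_wpM2r (sqn_ge0 y) (ler_norm M)) _; rewrite ler_wpM2l.
  move=> h2; rewrite -(ler_pM2l h0) e1; move: h1 h2 c1 c2; rewrite expr0n/=; clear -n; lra.
have := key 1; have := key (- 1); rewrite normrN normr1 !dotpZr !dotp_delta !mxE => /(_ (lexx _)) k1 /(_ (lexx _)) k2.
by apply/eqP; rewrite eq_le; apply/andP; move: k1 k2; clear -n; split; lra.
Qed.

(** A faster growth at [x0] would survive a penalization localized around [x0] and before [t2]. The
    resulting superjet has the actual gradient as momentum, by [superjet_quad_diff], so the equation
    contradicts the bound on [- K]. *)
Lemma jet_mvt_upper K v Q (C L Ct t1 t2 m rho : R) (x0 : 'rV[R]_n) :
  jcont v -> sper v -> jet_sub K v -> 0 <= Ct -> 0 <= L ->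
  (forall t s x, 0 <= t -> 0 <= s -> `|v t x - v s x| <= Ct * `|t - s|) ->
  (forall t x y, 0 <= t -> `|v t x - v t y| <= L * `|x - y|) ->
  (forall t, 0 <= t -> quad_diff (v t) (Q t) C) ->
  0 <= t1 -> t1 < t2 -> 0 < rho ->
  (forall t x, t1 <= t <= t2 -> `|x - x0| <= rho -> - K (x, Q t x) <= m) ->
  v t2 x0 - v t1 x0 <= m * (t2 - t1).
Proof.
move=> cv pv sub Ct0 L0 vt vx vq t10 t12 rho0 Km; rewrite leNgt; apply/negP => hlt.
pose eta := (v t2 x0 - v t1 x0 - m * (t2 - t1)) / 3.
have eta0 : 0 < eta by rewrite /eta; move: hlt; clear -n; lra.
have etaE : v t2 x0 - v t1 x0 - m * (t2 - t1) = 3 * eta by rewrite /eta; clear -n; lra.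
clearbody eta; clear hlt.
have t20 : 0 <= t2 by apply: le_trans t10 (ltW t12).
have [B B0 hB] := strip_bounded t2 cv pv.
have t120 : 0 < t2 - t1 by rewrite subr_gt0.
pose lam := eta / (t2 - t1) / 2.
have lam0 : 0 < lam by rewrite !divr_gt0.
have lamE : lam * (t2 - t1) = eta / 2 by rewrite /lam mulrAC divfK// lt0r_neq0.
clearbody lam.
have [d [d0 dt dE]] : exists d : R, [/\ 0 < d, d < t2 - t1 & (Ct + `|m|) * d <= eta].
  have q0 : 0 < eta / (Ct + `|m| + 1) by rewrite divr_gt0// ltr_wpDl// addr_ge0.
  have [d [d0 d1 d2]] := exists_lt_min t120 q0; exists d; split => //.
  move: d2; rewrite ltr_pdivlMr ?ltr_wpDl ?addr_ge0//.
  by move: d0; clear -n; lra.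
pose B3 := 2 * B + `|m| * (t2 - t1) + 1.
have B30 : 0 < B3 by rewrite /B3 ltr_wpDl// addr_ge0 ?mulr_ge0 ?(ltW t120)// ltW.
pose ts := t2 - d.
have [tst1 tst2] : t1 < ts /\ ts < t2 by rewrite /ts; move: d0 dt; clear -n; split; lra.
(* The first term confines the maximum to the open ball. The second excludes the time [t1], where
   [L r - k r^2 <= L^2 / (4 k)] with [r = |x - x0|] cannot reach the gap. *)
pose k := B3 / rho ^+ 2 + (L ^+ 2 + 1) / eta.
have k1 : 0 < B3 / rho ^+ 2 by rewrite divr_gt0 ?exprn_gt0.
have k2 : 0 < (L ^+ 2 + 1) / eta by rewrite divr_gt0// ltr_wpDl ?sqr_ge0.
have k0 : 0 < k by rewrite addr_gt0.
have kr : B3 <= k * rho ^+ 2.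
  have : B3 / rho ^+ 2 * rho ^+ 2 <= k * rho ^+ 2 by rewrite ler_wpM2r ?sqr_ge0// lerDl ltW.
  by rewrite divfK ?lt0r_neq0 ?exprn_gt0.
have ke : L ^+ 2 < k * eta.
  have : (L ^+ 2 + 1) / eta * eta <= k * eta by rewrite ler_wpM2r ?(ltW eta0)// lerDr ltW.
  by rewrite divfK ?lt0r_neq0//; clear -n; lra.
clearbody k.
(* The barrier starts at [ts = t2 - d] and reaches [B3], more than the available oscillation, at
   [t2]. The reference value is taken at [ts], which costs a multiple of [d]. *)
pose psi (t : R) := (m + lam) * (t - t1) + B3 / d ^+ 2 * sqpos (t - ts).
have B3d : 0 < B3 / d ^+ 2 by rewrite divr_gt0 ?exprn_gt0.
pose Phi t x := v t x - psi t - k * sqn (x - x0).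
have [[t x] [/= tT xr] hmax] : exists2 z : R * 'rV[R]_n,
     ([set t : R | t1 <= t <= t2] `*` [set x : 'rV[R]_n | `|x - x0| <= rho]) z &
     forall z', ([set t : R | t1 <= t <= t2] `*` [set x : 'rV[R]_n | `|x - x0| <= rho]) z' ->
       Phi z'.1 z'.2 <= Phi z.1 z.2.
  apply: max_compact.
  - by exists (t1, x0); split => /=; rewrite ?subrr ?normr0 ?lexx ?(ltW rho0)//= ltW.
  - by apply: compact_setX; [exact: compact_itv_le|exact: compact_cball_at].
  - have c1 : continuous (fun z : R * 'rV[R]_n => z.1) by apply: cts_fst; exact: cts_id.
    have c2 : continuous (fun z : R * 'rV[R]_n => z.2) by apply: cts_snd; exact: cts_id.
    rewrite /Phi /psi; apply: ctsB; first apply: ctsB => //.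
    + apply: ctsD; first by apply: ctsM; [exact: cts_cst|apply: ctsB => //; exact: cts_cst].
      apply: ctsM; first exact: cts_cst.
      by apply: (cts_comp sqpos_cts); apply: ctsB => //; exact: cts_cst.
    + by apply: ctsM; [exact: cts_cst|apply: cts_sqn; apply: ctsB => //; exact: cts_cst].
have H (s : R) (y : 'rV[R]_n) : t1 <= s <= t2 -> `|y - x0| <= rho -> Phi s y <= Phi t x.
  by move=> sT yr; apply: (hmax (s, y)).
have [t1t tt2] := andP tT.
have t0 : 0 <= t by apply: le_trans t10 t1t.
have big : v t1 x0 + 3 / 2 * eta <= Phi t x.
  apply: le_trans (H ts x0 _ _); last 2 first.
  - by rewrite !ltW.
  - by rewrite subrr normr0 ltW.
  rewrite /Phi /psi !subrr sqn0 sqpos0//.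
  have := vt t2 ts x0 t20 (le_trans t10 (ltW tst1)).
  have -> : t2 - ts = d by rewrite /ts; ring.
  rewrite (gtr0_norm d0) => /ler_normlW h1.
  have h2 : - (`|m| * d) <= m * d by rewrite -mulNr ler_wpM2r ?(ltW d0)// lerNl -normrN ler_norm.
  have h3 : 0 <= lam * d by rewrite mulr_ge0// ltW.
  by move: h1 h2 h3 lamE etaE dE; rewrite /ts; clear -n; lra.
have tT0 : 0 <= t <= t2 by rewrite t0.
have B1 := ler_normlW (hB t x tT0).
have T10 : 0 <= t1 <= t2 by rewrite t10 ltW.
have B2 := lerNnormlW (hB t1 x0 T10).
have nx : 0 <= k * sqn (x - x0) by rewrite mulr_ge0 ?sqn_ge0// ltW.
have nt : 0 <= B3 / d ^+ 2 * sqpos (t - ts) by rewrite mulr_ge0 ?sqpos_ge0// ltW.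
have mt : - (`|m| * (t2 - t1)) <= (m + lam) * (t - t1).
  have h1 : 0 <= lam * (t - t1) by rewrite mulr_ge0 ?(ltW lam0)// subr_ge0.
  have h2 : - (`|m| * (t - t1)) <= m * (t - t1).
    by rewrite -mulNr ler_wpM2r ?subr_ge0// lerNl -normrN ler_norm.
  have h3 : `|m| * (t - t1) <= `|m| * (t2 - t1) by rewrite ler_wpM2l// lerD2r.
  by move: h1 h2 h3; clear -n; lra.
have xr' : `|x - x0| < rho.
  apply: sqn_small => //; rewrite -(ltr_pM2l k0).
  by move: big B1 B2 nt mt kr eta0; rewrite /Phi /psi /B3; clear -n; lra.
have t2' : t < t2.
  rewrite lt_neqAle tt2 andbT; apply/eqP => tE.
  have : B3 / d ^+ 2 * sqpos (t - ts) = B3.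
    rewrite tE /ts opprB addrCA subrr addr0 /sqpos (_ : Num.max 0 d = d); last by apply/max_idPr; exact: ltW.
    by rewrite divfK// lt0r_neq0// exprn_gt0.
  by move: big B1 B2 nx mt eta0; rewrite /Phi /psi /B3; clear -n; lra.
have t1' : t1 < t.
  rewrite lt_neqAle t1t andbT; apply/eqP => tE.
  have := ler_normlW (vx t1 x x0 t10); rewrite tE => h1.
  have h2 : k * `|x - x0| ^+ 2 <= k * sqn (x - x0) by rewrite ler_wpM2l ?norm_sqn// ltW.
  have h3 : 3 / 2 * eta <= L * `|x - x0| - k * `|x - x0| ^+ 2.
    by move: big h1 h2 nt; rewrite /Phi /psi tE subrr mulr0; clear -n; lra.
  have h4 : k * (3 / 2 * eta) <= k * (L * `|x - x0| - k * `|x - x0| ^+ 2) by rewrite ler_wpM2l// ltW.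
  have := sqr_ge0 (2 * k * `|x - x0| - L); have := sqr_ge0 L.
  by move: h4 ke eta0; clear -n; nra.
have J : superjet v t x (m + lam + B3 / d ^+ 2 * (2 * Num.max 0 (t - ts))) ((2 * k) *: (x - x0)).
  exists (B3 / d ^+ 2 + k), (Num.min (Num.min (t - t1) (t2 - t)) (rho - `|x - x0|)); split.
    by rewrite !lt_min !subr_gt0 t1' t2'.
  move=> s y; rewrite !lt_min => /andP[/andP[s1 s2] _] /andP[_ yy].
  have sT : t1 <= s <= t2.
    by move: s1 s2; rewrite !ltr_norml => /andP[+ _] /andP[_ +]; clear -n; move=> *; apply/andP; split; lra.
  have yr : `|y - x0| <= rho.
    rewrite -(subrKA x); apply: le_trans (ler_normD _ _) _.
    by move: yy; clear -n; lra.
  have := H s y sT yr; rewrite /Phi /psi.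
  have -> : s - t1 = (t - t1) + (s - t) by ring.
  have -> : s - ts = (t - ts) + (s - t) by ring.
  have -> : y - x0 = (x - x0) + (y - x) by rewrite [RHS]addrC subrKA.
  have := sqpos_taylor (t - ts) (s - t).
  rewrite (sqnD (x - x0)) dotpZl.
  move: (sqpos (t - ts + _)) (sqpos (t - ts)) (Num.max _ _) => S1 S2 mm.
  move: (dotp _ _) (sqn (y - x)) (sqn_ge0 (y - x)) (sqn (x - x0)) => D1 Sy Sy0 Sx a1 a2.
  have f1 : B3 / d ^+ 2 * S1 <= B3 / d ^+ 2 * (S2 + 2 * mm * (s - t) + (s - t) ^+ 2) by rewrite ler_wpM2l// ltW.
  have f2 : 0 <= B3 / d ^+ 2 * Sy by rewrite mulr_ge0// ltW.
  have f3 : 0 <= k * (s - t) ^+ 2 by rewrite mulr_ge0 ?sqr_ge0// ltW.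
  by move: a2 f1 f2 f3; clear -n; lra.
have t00 : 0 < t by apply: le_lt_trans t10 t1'.
have := sub _ _ _ _ t00 J; rewrite (superjet_quad_diff J (vq t t0)).
have := Km t x tT xr.
have : 0 <= B3 / d ^+ 2 * (2 * Num.max 0 (t - ts)).
  by apply: mulr_ge0; [exact: ltW|rewrite mulr_ge0// le_max lexx].
by move: lam0; clear -n; lra.
Qed.

Lemma quad_diffN (f : 'rV[R]_n -> R) Q (C : R) : quad_diff f Q C -> quad_diff (fun x => - f x) (fun x => - Q x) C.
Proof.
move=> H x h; rewrite dotpNl; have := H x h; rewrite -normrN; congr (`|_| <= _); ring.
Qed.

Lemma quad_diff_bound (f : 'rV[R]_n -> R) Q (C L : R) : 0 <= L -> quad_diff f Q C ->
  (forall x y, `|f x - f y| <= L * `|x - y|) -> forall x, `|Q x| <= L.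
Proof.
move=> L0 H fL x.
have J : superjet (fun _ => f) 0 x 0 (Q x).
  exists `|C|, 1; split => // t y _ _; have := H x (y - x); rewrite subrKC ler_norml => /andP[_ h].
  have h1 : C * sqn (y - x) <= `|C| * sqn (y - x) by rewrite ler_wpM2r ?sqn_ge0 ?ler_norm.
  have h2 : 0 <= `|C| * (t - 0) ^+ 2 by rewrite mulr_ge0 ?sqr_ge0.
  by move: h h1 h2; clear -n; lra.
by apply: (superjet_momentum L0 J) => y; rewrite distrC; apply: le_trans (ler_norm _) (fL _ _).
Qed.

Record regular_solution K v Q (C L Ct : R) : Prop := RegularSolution {
  rs_tame : tame K; rs_cont : jcont v; rs_per : sper v;
  rs_sub : jet_sub K v; rs_super : jet_super K v;
  rs_C0 : 0 <= C; rs_Ct0 : 0 <= Ct; rs_L0 : 0 <= L;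
  rs_time : forall t s x, 0 <= t -> 0 <= s -> `|v t x - v s x| <= Ct * `|t - s|;
  rs_space : forall t x y, 0 <= t -> `|v t x - v t y| <= L * `|x - y|;
  rs_grad : forall t, 0 <= t -> quad_diff (v t) (Q t) C }.

Lemma gradient_bound K v Q (C L Ct t : R) x : regular_solution K v Q C L Ct -> 0 <= t -> `|Q t x| <= L.
Proof.
by move=> [_ _ _ _ _ _ _ L0 _ vx vq] t0; apply: (quad_diff_bound L0 (vq t t0)) => y z; exact: vx.
Qed.

(** Two uniformly close functions with a common quadratic constant have close gradients: a step of
    length [h] gives an error of order [C h + Ct d / h], so [h] is fixed before [d]. *)
Lemma gradient_uniform K v Q (C L Ct e : R) : regular_solution K v Q C L Ct -> 0 < e -> exists2 d : R, 0 < d & forall t s x y, 0 <= t -> 0 <= s ->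
  `|t - s| < d -> `|x - y| < d -> `|Q t x - Q s y| <= e.
Proof.
move=> [_ _ _ _ _ C0 Ct0 _ vt _ vq] e0; pose k := C * (3 + 3 * n%:R).
have k0 : 0 <= k by rewrite mulr_ge0// addr_ge0// mulr_ge0.
pose h := e / (8 * C + 1); have C8 : 0 < 8 * C + 1 by rewrite ltr_wpDl// mulr_ge0.
have h0 : 0 < h by rewrite divr_gt0.
have hE : h * (8 * C + 1) = e by rewrite /h divfK// lt0r_neq0.
clearbody h.
have q1 : 0 < e / (2 * k + 1) by rewrite divr_gt0// ltr_wpDl// mulr_ge0.
have q2 : 0 < e * h / (8 * Ct + 1) by rewrite divr_gt0 ?mulr_gt0// ltr_wpDl// mulr_ge0.
have [d [d0 d1 d2]] := exists_lt_min q1 q2; exists d => // t s x y t0 s0 ts xy.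
have a1 : `|Q t x - Q t y| <= e / 2.
  apply: le_trans (quad_diff_lip C0 (vq _ t0) y x) _; rewrite -/k.
  have b1 : k * `|x - y| <= k * d by rewrite ler_wpM2l// ltW.
  move: d1; rewrite ltr_pdivlMr ?ltr_wpDl ?mulr_ge0//.
  by move: b1 d0; clear -n; lra.
have a2 : `|Q t y - Q s y| <= e / 2.
  apply: norm_le_dotp => [|i sg sg1]; first by rewrite divr_ge0// ltW.
  pose w : 'rV[R]_n := h *: (sg *: delta_mx 0 i).
  have sw : sqn w <= h ^+ 2.
    have -> : sqn w = (h * sg) ^+ 2 by rewrite /w scalerA sqnZ /sqn dotp_delta mxE !eqxx mulr1.
    have : sg ^+ 2 <= 1 by rewrite -(real_normK (num_real sg)) expr_le1.
    by rewrite exprMn => h1; rewrite ler_piMr ?sqr_ge0.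
  have := vq _ t0 y w; have := vq _ s0 y w; have := vt _ _ (y + w) t0 s0; have := vt _ _ y t0 s0.
  have b1 : Ct * `|t - s| <= Ct * d by rewrite ler_wpM2l// ltW.
  have b2 : C * sqn w <= C * h ^+ 2 by rewrite ler_wpM2l.
  rewrite !ler_norml => /andP[c1 _] /andP[c2 c2'] /andP[c3 c3'] /andP[c4 c4'].
  have c5 : dotp (Q t y - Q s y) w <= 2 * (C * h ^+ 2) + 2 * (Ct * d).
    by rewrite dotpDl dotpNl; move: b1 b2 c1 c2' c3' c4; clear -n; lra.
  rewrite -(ler_pM2l h0) -dotpZr -/w; apply: le_trans c5 _.
  move: d2; rewrite ltr_pdivlMr ?ltr_wpDl ?mulr_ge0// => d2.
  have c6 : C * h ^+ 2 <= h * e / 8.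
    rewrite expr2 -hE; have : 0 <= h * h by rewrite mulr_ge0// ltW.
    by clear -n; lra.
  have c7 : 0 <= d by exact: ltW.
  by move: d2 c6 c7; clear -n; lra.
rewrite -(subrKA (Q t y)); apply: le_trans (ler_normD _ _) _.
by move: a1 a2; clear -n; lra.
Qed.

Lemma energy_uniform K v Q (C L Ct e : R) : regular_solution K v Q C L Ct -> 0 < e -> exists2 d : R, 0 < d & forall t s x y, 0 <= t -> 0 <= s ->
  `|t - s| < d -> `|x - y| < d -> `|K (x, Q t x) - K (y, Q s y)| <= e.
Proof.
move=> S e0; have [cK pK _ mid] := rs_tame S; have [th [C1 [_ C10 _ hK]]] := mid L.
have e2 : 0 < e / 2 by rewrite divr_gt0.
have [d1 d10 hd1] := slab_uniform L cK pK e2.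
have q0 : 0 < e / 2 / C1 by rewrite divr_gt0.
have [d2 d20 hd2] := gradient_uniform S q0.
have [d [d0 dd1 dd2]] := exists_lt_min d10 d20; exists d => // t s x y t0 s0 ts xy.
have a1 := hd1 y x (Q t x) (gradient_bound x S t0) (lt_trans xy dd1).
have a2 := hK y (Q t x) (Q s y) (gradient_bound x S t0) (gradient_bound y S s0).
have a3 := hd2 t s x y t0 s0 (lt_trans ts dd2) (lt_trans xy dd2).
have a4 : C1 * `|Q t x - Q s y| <= e / 2.
  by apply: le_trans (ler_wpM2l (ltW C10) a3) _; rewrite mulrC divfK// lt0r_neq0.
rewrite -(subrKA (K (y, Q t x))); apply: le_trans (ler_normD _ _) _.
by move: a1 a2 a4; clear -n; lra.
Qed.

(** [jet_mvt_upper], applied to [v] and to [- v] with the Hamiltonian [(x, p) -> - K (x, - p)],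
    squeezes the increments in time between bounds that [energy_uniform] brings together. *)
Lemma jet_time_derivative K v Q (C L Ct t : R) x : regular_solution K v Q C L Ct -> 0 < t -> is_derive t (1 : R) (v ^~ x) (- K (x, Q t x)).
Proof.
move=> S t0; have [tK cv pv sub sup C0 Ct0 L0 vt vx vq] := S.
apply/is_derive1_eps => e e0; have [d d0 hd] := energy_uniform S e0.
have [r [r0 rd rt]] := exists_lt_min d0 t0; exists r => // s sr.
have key (t1 t2 : R) : 0 <= t1 -> t1 < t2 -> `|t1 - t| < r -> `|t2 - t| < r ->
    (- K (x, Q t x) - e) * (t2 - t1) <= v t2 x - v t1 x <= (- K (x, Q t x) + e) * (t2 - t1).
  move=> t10 t12 t1r t2r.
  have near s' y : t1 <= s' <= t2 -> `|y - x| <= r -> `|K (y, Q s' y) - K (x, Q t x)| <= e.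
    move=> /andP[s1 s2] yx; apply: hd; [exact: le_trans t10 s1|exact: ltW| |exact: le_lt_trans yx rd].
    apply: lt_trans rd; move: s1 s2 t1r t2r; rewrite !ltr_norml => s1 s2 /andP[a1 a2] /andP[a3 a4].
    by apply/andP; move: s1 s2 a1 a2 a3 a4; clear -n; split; lra.
  apply/andP; split; last first.
    apply: (@jet_mvt_upper K v Q C L Ct _ _ _ r) => // s' y s'T yr.
    by have := near s' y s'T yr; rewrite ler_norml => /andP[+ _]; clear -n; lra.
  have h : - v t2 x - - v t1 x <= (K (x, Q t x) + e) * (t2 - t1).
    apply: (@jet_mvt_upper (fun z => - K (z.1, - z.2)) (fun t x => - v t x) (fun t x => - Q t x) C L Ct _ _ _ r) => //.
    - by move=> z; apply: cvgN; exact: cv.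
    - by move=> a y k; rewrite pv.
    - move=> a y b p a0 J /=; have : subjet v a y (- b) (- p) by apply/subjetN; rewrite !opprK.
      by move=> /(sup _ _ _ _ a0); clear -n; lra.
    - by move=> a b y a0 b0; rewrite -opprD normrN; exact: vt.
    - by move=> a y z a0; rewrite -opprD normrN; exact: vx.
    - by move=> a a0; apply: quad_diffN; exact: vq.
    - move=> s' y s'T yr /=; rewrite !opprK.
      by have := near s' y s'T yr; rewrite ler_norml => /andP[_]; clear -n; lra.
  by move: h; clear -n; lra.
have [->|st] := eqVneq s t; first by rewrite !subrr scale0r subrr !normr0 mulr0.
rewrite -[(s - t) *: _]/((s - t) * _).
have [lts|lst] := ltP t s.
  have := key t s (ltW t0) lts; rewrite subrr normr0 => /(_ r0 sr) /andP[k1 k2].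
  rewrite (gtr0_norm (x := s - t)) ?subr_gt0// ler_norml.
  by apply/andP; move: k1 k2; clear -n; split; lra.
have ls : s < t by rewrite lt_neqAle st.
have s0 : 0 <= s by move: sr rt; rewrite ltr_norml => /andP[+ _]; clear -n; lra.
have := key s t s0 ls sr; rewrite subrr normr0 => /(_ r0) /andP[k1 k2].
rewrite (ltr0_norm (x := s - t)) ?subr_lt0// ler_norml.
by apply/andP; move: k1 k2; clear -n; split; lra.
Qed.

End Rigidity.

(** * Rigidity: constant energy and affine evolution *)

Section RigidityTheorem.
Context {R : realType} {n : nat}.
Notation P := ('rV[R]_n * 'rV[R]_n)%type.
Implicit Types (K : P -> R) (v f : R -> 'rV[R]_n -> R).

(** A maximum principle in time that uses the derivative only where the maximum over [x] is reached:
    a maximum over the strip of [f] minus a slightly steeper affine function is such a point, with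
    too large a derivative. *)
Lemma envelope f (T1 T2 c b : R) : jcont f -> sper f -> T1 <= T2 ->
  (forall (t : R) x, T1 < t -> t <= T2 -> (forall y, f t y <= f t x) ->
     exists2 d : R, is_derive t (1 : R) (f ^~ x) d & d <= c) ->
  (forall y, f T1 y <= b) -> forall x, f T2 x <= b + c * (T2 - T1).
Proof.
move=> cf pf T12 H fb xs; rewrite leNgt; apply/negP => hlt.
have T120 : 0 <= T2 - T1 by rewrite subr_ge0.
pose lam := (f T2 xs - (b + c * (T2 - T1))) / (T2 - T1 + 1).
have q0 : 0 < T2 - T1 + 1 by rewrite ltr_wpDl.
have lam0 : 0 < lam by rewrite divr_gt0// subr_gt0.
have lamE : lam * (T2 - T1) + lam = f T2 xs - (b + c * (T2 - T1)).
  by rewrite /lam -[X in _ + X]mulr1 -mulrDr divfK// lt0r_neq0.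
clearbody lam.
pose Psi t x := f t x - (c + lam) * (t - T1).
have [[t x] [/= tT x1] hmax] : exists2 z : R * 'rV[R]_n,
     ([set t : R | T1 <= t <= T2] `*` [set x : 'rV[R]_n | `|x| <= 1]) z &
     forall z', ([set t : R | T1 <= t <= T2] `*` [set x : 'rV[R]_n | `|x| <= 1]) z' ->
       Psi z'.1 z'.2 <= Psi z.1 z.2.
  apply: max_compact.
  - by exists (T1, 0); split => /=; rewrite ?normr0 ?lexx.
  - by apply: compact_setX; [exact: compact_itv_le|exact: compact_cball].
  - apply: ctsB => //; apply: ctsM; first exact: cts_cst.
    by apply: ctsB; [apply: cts_fst; exact: cts_id|exact: cts_cst].
have HP (s : R) (y : 'rV[R]_n) : T1 <= s <= T2 -> Psi s y <= Psi t x.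
  move=> sT; have [k hk] := reduce_mod_Zn y.
  by have := hmax (s, y + map_mx intr k) (conj sT hk); rewrite /Psi/= pf.
have [T1t tT2] := andP tT.
have big : b + lam <= Psi t x.
  apply: le_trans (HP T2 xs _); last by rewrite T12 lexx.
  by rewrite /Psi; move: lamE; clear -n; lra.
have tT1 : T1 < t.
  rewrite lt_neqAle T1t andbT; apply/eqP => tE.
  by have := fb x; move: big; rewrite /Psi -tE subrr mulr0; move: lam0; clear -n; lra.
have [y|d df dc] := H t x tT1 tT2.
  by have := HP t y tT; rewrite /Psi; clear -n; lra.
have dP : is_derive t (1 : R) (Psi ^~ x) (d - (c + lam)).
  by rewrite /Psi; apply: is_derive_eq; rewrite /GRing.scale/=; ring.
have : 0 <= d - (c + lam).
  apply: (der_max_left dP (_ : 0 < t - T1)); first by rewrite subr_gt0.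
  move=> s s1 s2; apply: HP; apply/andP; split; move: s1 s2 tT2; clear -n; lra.
by move: dc lam0; clear -n; lra.
Qed.

Lemma quad_diff_comb_critical (m : nat) (g : 'I_m -> 'rV[R]_n -> R) G (a : 'I_m -> R) (C : R) x : 0 <= C ->
  (forall i, quad_diff (g i) (G i) C) ->
  (forall y, \sum_i a i * g i y <= \sum_i a i * g i x) -> \sum_i a i *: G i x = 0.
Proof.
move=> C0 H hx; apply/rowP => j; rewrite mxE.
have ds : is_derive x (delta_mx 0 j) (fun y => \sum_i a i * g i y) (\sum_i a i * G i x 0 j).
  rewrite (_ : (fun _ => _) = \sum_i (a i *: g i)).
    apply: is_derive_sum => i; apply: is_deriveZ; rewrite -dotp_delta; exact: quad_diff_derive C0 (H i).
  by apply/funext => y; rewrite fct_sumE; apply: eq_bigr.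
have ds' : is_derive 0 (1 : R) (fun t => \sum_i a i * g i (x + t *: delta_mx 0 j)) (\sum_i a i * G i x 0 j).
  by apply/(is_derive_line (fun y => \sum_i a i * g i y)); rewrite scale0r addr0.
rewrite summxE (eq_bigr (fun i => a i * G i x 0 j)); last by move=> i _; rewrite mxE.
apply: (der_local_max ds' ltr01) => t _; rewrite scale0r addr0; exact: hx.
Qed.

Lemma shift_cont v (a h : R) : jcont v -> jcont (fun t => v (a * t + h)).
Proof.
move=> cv; apply: (@jcont_comp _ _ _ v (fun z : R * 'rV[R]_n => a * z.1 + h) (fun z => z.2)) => //.
  apply: ctsD; last exact: cts_cst.
  by apply: ctsM; [exact: cts_cst|apply: cts_fst; exact: cts_id].
by apply: cts_snd; exact: cts_id.
Qed.

Lemma is_derive_affine (g : R -> R) (a h t d : R) : is_derive (a * t + h) (1 : R) g d ->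
  is_derive t (1 : R) (fun s => g (a * s + h)) (a * d).
Proof.
move=> dg; rewrite mulrC; apply: (@is_derive1_comp _ g (fun s => a * s + h)) => //.
by apply: is_derive_eq; rewrite /GRing.scale/= mulr1 addr0.
Qed.

(** Asymptotic concavity. With [e = h / T], the envelope is applied to
    [v ((1 + e) t) + v ((1 - e) t) - 2 v t], which vanishes at time 0. At a spatial maximum the
    middle gradient is the mean of the two others: convexity gives [- th |p1 - p2|^2], the unequal
    speeds at most [e K1 |p1 - p2|], in total at most [e^2 K1^2 / (4 th)]. Over a time [T] this is
    of order [h^2 / T]. *)
Lemma second_difference_time K v Q C L Ct : regular_solution K v Q C L Ct ->
  exists2 A : R, 0 <= A & forall (T h : R) x, 0 < h -> h < T ->
    v (T + h) x + v (T - h) x - 2 * v T x <= A * h ^+ 2 / T.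
Proof.
move=> S; have [tK cv pv sub sup C0 Ct0 L0 vt vx vq] := S.
have [_ _ _ mid] := tK; have [th [K1 [th0 K10 hK hL]]] := mid L.
exists (K1 ^+ 2 / (4 * th)); first by rewrite divr_ge0 ?sqr_ge0// mulr_ge0// ltW.
move=> T h x h0 hT; have T0 : 0 < T by apply: lt_trans hT.
pose e := h / T.
have e0 : 0 < e by rewrite divr_gt0.
have e1 : e < 1 by rewrite /e ltr_pdivrMr ?mul1r.
pose f t x := v ((1 + e) * t + 0) x + v ((1 - e) * t + 0) x - 2 * v (1 * t + 0) x.
have cf : jcont f.
  apply: ctsB; first by apply: ctsD; exact: shift_cont.
  by apply: ctsM; [exact: cts_cst|exact: shift_cont].
have pf : sper f by move=> t y k; rewrite /f !pv.
have := @envelope f 0 T (e ^+ 2 * (K1 ^+ 2 / (4 * th))) 0 cf pf (ltW T0) _ _ x.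
have -> : f T x = v (T + h) x + v (T - h) x - 2 * v T x.
  rewrite /f !addr0 mul1r mulrDl mulrBl mul1r /e divfK//; exact: lt0r_neq0.
rewrite add0r subr0 => H.
have -> : K1 ^+ 2 / (4 * th) * h ^+ 2 / T = e ^+ 2 * (K1 ^+ 2 / (4 * th)) * T.
  by rewrite /e; field; rewrite !lt0r_neq0.
apply: H => [t y t0 tT hmax|y]; last first.
  by rewrite /f !mulr0 addr0; clear -n; lra.
have t1 : 0 < (1 + e) * t + 0 by rewrite addr0 mulr_gt0// addr_gt0.
have t2 : 0 < (1 - e) * t + 0 by rewrite addr0 mulr_gt0// subr_gt0.
have t3 : 0 < 1 * t + 0 by rewrite addr0 mul1r.
have d1 := jet_time_derivative y S t1.
have d2 := jet_time_derivative y S t2.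
have d3 := jet_time_derivative y S t3.
have d1' := is_derive_affine d1; have d2' := is_derive_affine d2; have d3' := is_derive_affine d3.
have crit : Q ((1 + e) * t + 0) y + Q ((1 - e) * t + 0) y = 2 *: Q (1 * t + 0) y.
  have := @quad_diff_comb_critical 3 (fun i => v (nth 0 [:: (1 + e) * t + 0; (1 - e) * t + 0; 1 * t + 0] i))
     (fun i => Q (nth 0 [:: (1 + e) * t + 0; (1 - e) * t + 0; 1 * t + 0] i)) (fun i => nth 0 [:: 1; 1; - 2] i) C y C0.
  move=> HH; apply/eqP; rewrite -subr_eq0; apply/eqP.
  rewrite -[RHS]HH; first by rewrite !big_ord_recr !big_ord0/= !scale1r scaleNr add0r.
    by case=> [[|[|[|?]]]] //= _; apply: vq; exact: ltW.
  move=> z; rewrite !big_ord_recr !big_ord0/=.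
  by have := hmax z; rewrite /f; clear -n; lra.
have pM1 := gradient_bound y S (ltW t1); have pM2 := gradient_bound y S (ltW t2).
have h1 := hK y y y _ _ pM1 pM2; have h2 := hL y _ _ pM1 pM2.
rewrite crit scalerA mulVf// scale1r in h1.
have yy : y + y - 2 *: y = 0 by rewrite scaler_nat mulr2n subrr.
rewrite !subrr sqn0 yy normr0 !mulr0 !addr0 in h1.
exists ((1 + e) * - K (y, Q ((1 + e) * t + 0) y) + (1 - e) * - K (y, Q ((1 - e) * t + 0) y) - 2 * (1 * - K (y, Q (1 * t + 0) y))).
  rewrite /f; exact: (is_deriveB (is_deriveD d1' d2') (is_deriveZ 2 d3')).
have := norm_sqn (Q ((1 + e) * t + 0) y - Q ((1 - e) * t + 0) y).
rewrite !addr0 mul1r in h1 h2 *.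
set p1 := Q _ _ in h1 h2 *; set p2 := Q _ _ in h1 h2 *; set p3 := Q _ _ in h1 *.
move: h2; rewrite ler_norml => /andP[h2 _].
move: (K (y, p1)) (K (y, p2)) (K (y, p3)) (sqn (p1 - p2)) (`|p1 - p2|) h1 h2 => k1 k2 k3 sq nq h1 h2 h3.
have s1 : th * nq ^+ 2 <= th * sq by rewrite ler_wpM2l// ltW.
have s2 : e * - (K1 * nq) <= e * (k1 - k2) by rewrite ler_wpM2l// ltW.
have s3 : e * (K1 * nq) - th * nq ^+ 2 <= e ^+ 2 * (K1 ^+ 2 / (4 * th)).
  have -> : e * (K1 * nq) - th * nq ^+ 2 = e ^+ 2 * (K1 ^+ 2 / (4 * th)) - (2 * th * nq - e * K1) ^+ 2 / (4 * th).
    by field; exact: lt0r_neq0.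
  by rewrite lerBlDr lerDl divr_ge0 ?sqr_ge0// mulr_ge0// ltW.
by move: h1 s1 s2 s3; clear -n; lra.
Qed.

(** At an extremal point the derivative of the increment is 0, so the supremum does not grow
    forwards. The case [rho = - 1], through the reflection [t -> t1 + t2 - t], shows that it does
    not grow backwards; [sg] covers the maximum and the minimum. *)
Lemma increment_sup_invariant K v Q C L Ct (sg h a t1 t2 : R) : regular_solution K v Q C L Ct ->
  0 < h -> 0 < t1 -> 0 < t2 ->
  (forall y, sg * (v (t1 + h) y - v t1 y) <= a) -> forall y, sg * (v (t2 + h) y - v t2 y) <= a.
Proof.
move=> S h0 t10 t20; have [tK cv pv sub sup C0 Ct0 L0 vt vx vq] := S.
pose f (rho c t : R) x := sg * (v (rho * t + (c + h)) x - v (rho * t + c) x).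
have key (rho c T1 T2 : R) : T1 <= T2 -> (forall t, T1 <= t -> t <= T2 -> 0 < rho * t + c) ->
    (forall y, f rho c T1 y <= a) -> forall y, f rho c T2 y <= a.
  move=> T12 pos fa y.
  have cf : jcont (f rho c).
    by apply: ctsM; [exact: cts_cst|apply: ctsB; exact: shift_cont].
  have pf : sper (f rho c) by move=> t z k; rewrite /f !pv.
  have := @envelope (f rho c) T1 T2 0 a cf pf T12 _ fa y; rewrite mul0r addr0; apply.
  move=> t x t1' t2' hmax; have p0 := pos t (ltW t1') t2'.
  have p1 : 0 < rho * t + (c + h) by rewrite addrA addr_gt0.
  have d1 := is_derive_affine (jet_time_derivative x S p1).
  have d2 := is_derive_affine (jet_time_derivative x S p0).
  have crit : sg *: (Q (rho * t + (c + h)) x - Q (rho * t + c) x) = 0.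
    have := @quad_diff_comb_critical 2 (fun i => v (nth 0 [:: rho * t + (c + h); rho * t + c] i))
      (fun i => Q (nth 0 [:: rho * t + (c + h); rho * t + c] i)) (fun i => nth 0 [:: sg; - sg] i) C x C0.
    move=> HH; rewrite -[RHS]HH; first by rewrite !big_ord_recr !big_ord0/= add0r scaleNr scalerBr.
      by case=> [[|[|?]]] //= _; apply: vq; exact: ltW.
    by move=> z; rewrite !big_ord_recr !big_ord0/= !add0r !mulNr -!mulrBr; exact: hmax.
  exists (sg * (rho * - K (x, Q (rho * t + (c + h)) x) - rho * - K (x, Q (rho * t + c) x))).
    exact: (is_deriveZ sg (is_deriveB d1 d2)).
  have [->|sg0] := eqVneq sg 0; first by rewrite mul0r.
  move/eqP: crit; rewrite scaler_eq0 (negbTE sg0)/= subr_eq0 => /eqP ->.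
  by rewrite subrr mulr0.
move=> fa y; have [t12|t21] := lerP t1 t2.
  have := key 1 0 t1 t2 t12 _ _ y; rewrite /f !mul1r !addr0 !add0r; apply.
    by move=> t t1t _; rewrite mul1r addr0; apply: lt_le_trans t1t.
  by move=> z; exact: fa.
have := key (- 1) (t1 + t2) t2 t1 (ltW t21) _ _ y; rewrite /f.
have e1 : -1 * t2 + (t1 + t2) = t1 by ring.
have e2 : -1 * t1 + (t1 + t2) = t2 by ring.
have e3 : -1 * t2 + (t1 + t2 + h) = t1 + h by ring.
have e4 : -1 * t1 + (t1 + t2 + h) = t2 + h by ring.
rewrite e2 e4; apply => [t tt1 tt2|z]; last by rewrite e1 e3; exact: fa.
by move: tt2 t20; clear -n; lra.
Qed.

Lemma increment_range K v Q C L Ct (h : R) : regular_solution K v Q C L Ct -> 0 < h ->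
  exists a b : R, forall t, 0 < t ->
   [/\ forall y, b <= v (t + h) y - v t y <= a, exists x, v (t + h) x - v t x = a &
       exists x, v (t + h) x - v t x = b].
Proof.
move=> S h0; have [tK cv pv sub sup C0 Ct0 L0 vt vx vq] := S.
have key (sg : R) : exists a : R, forall t, 0 < t ->
    (forall y, sg * (v (t + h) y - v t y) <= a) /\ exists x, sg * (v (t + h) x - v t x) = a.
  have ex t : exists x, forall y, sg * (v (t + h) y - v t y) <= sg * (v (t + h) x - v t x).
    have cf : continuous (fun x => sg * (v (t + h) x - v t x)).
      apply: ctsM; first exact: cts_cst.
      exact: (ctsB (jcont_comp cv (cts_cst (c := t + h)) (@cts_id _)) (jcont_comp cv (cts_cst (c := t)) (@cts_id _))).
    have [|x _ hx] := max_compact _ (@compact_cball R n 1) cf; first by exists 0; rewrite /= normr0.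
    exists x => y; have [k hk] := reduce_mod_Zn y.
    by have := hx _ hk; rewrite !pv.
  have [x1 hx1] := ex 1; exists (sg * (v (1 + h) x1 - v 1 x1)) => t t0.
  have up := increment_sup_invariant S h0 ltr01 t0 hx1; split => //.
  have [x hx] := ex t; exists x; apply/eqP; rewrite eq_le up/=.
  exact: (increment_sup_invariant S h0 t0 ltr01 hx).
have [a ha] := key 1; have [b hb] := key (- 1); exists a, (- b) => t t0.
have [a1 [x1 a2]] := ha t t0; have [b1 [x2 b2]] := hb t t0; split.
- by move=> y; have := a1 y; have := b1 y; clear -n; move=> *; apply/andP; split; lra.
- by exists x1; rewrite -a2 mul1r.
- by exists x2; rewrite -b2 mulN1r opprK.
Qed.

Lemma limit_large (X Y A : R) (T0 : R) : (forall T, T0 < T -> X <= Y + A / T) -> X <= Y.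
Proof.
move=> H; rewrite leNgt; apply/negP => YX.
have q0 : 0 < X - Y by rewrite subr_gt0.
pose T := `|T0| + `|A| / (X - Y) + 1.
have T1 : 0 < T by rewrite /T ltr_wpDl// addr_ge0// divr_ge0// ltW.
have : X <= Y + A / T.
  apply: H; rewrite /T; have := ler_norm T0; have : 0 <= `|A| / (X - Y) by rewrite divr_ge0// ltW.
  by clear -n; lra.
have : `|A| / T < X - Y.
  rewrite ltr_pdivrMr// /T !mulrDr mulr1 [X in _ + X + _]mulrC divfK ?lt0r_neq0//.
  have : 0 <= (X - Y) * `|T0| by rewrite mulr_ge0// ltW.
  by move: q0; clear -n; lra.
have : A / T <= `|A| / T by rewrite ler_wpM2r ?ler_norm// invr_ge0 ltW.
by clear -n; lra.
Qed.

(* The range [a, b] of the increments over a time [h] does not depend on time, while the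
   asymptotic concavity in time makes it at least double with [h]: it is a point since
   the oscillation in space is bounded. *)
Lemma increment_constant K v Q C L Ct (h : R) : regular_solution K v Q C L Ct -> 0 < h ->
  exists a : R, forall t x, 0 < t -> v (t + h) x - v t x = a.
Proof.
move=> S; have [tK cv pv sub sup C0 Ct0 L0 vt vx vq] := S.
pose AB (h a b : R) := forall t, 0 < t ->
   [/\ forall y, b <= v (t + h) y - v t y <= a, exists x, v (t + h) x - v t x = a &
       exists x, v (t + h) x - v t x = b].
have [A A0 hA] := second_difference_time S.
(* Representatives in the unit ball are at distance at most 2. *)
have osc t x y : 0 <= t -> v t x - v t y <= 2 * L.
  move=> t0; have [kx hkx] := reduce_mod_Zn x; have [ky hky] := reduce_mod_Zn y.
  rewrite -(pv t x kx) -(pv t y ky); apply: le_trans (ler_norm _) (le_trans (vx _ _ _ t0) _).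
  rewrite mulrC ler_wpM2r//; apply: le_trans (ler_normB _ _) _.
  by move: hkx hky; clear -n; lra.
have claim (k : nat) : forall g a b : R, 0 < g -> AB g a b -> 2 ^+ k * (a - b) <= 4 * L.
  elim: k => [g a b g0 ab|k IH g a b g0 ab].
    have [_ [x xa] [y yb]] := ab 1 ltr01; rewrite expr0 mul1r -xa -yb.
    have := osc (1 + g) x y (ltW (addr_gt0 ltr01 g0)); have := osc 1 y x ler01.
    by clear -n; lra.
  have g20 : 0 < 2 * g by rewrite mulr_gt0.
  have [a2 [b2 ab2]] := increment_range S g20.
  (* At an [x] where the increment over [[T, T + g]] is [a], concavity makes the increment over
     [[T - g, T]] at least [a - A g^2 / T]; then [T] tends to infinity. In [h2] the extremal
     increment is taken over the first interval. *)
  have h1 : 2 * a <= a2.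
    apply: (@limit_large _ _ (A * g ^+ 2) g) => T gT.
    have T0 : 0 < T by apply: lt_trans gT.
    have [_ [x xa] _] := ab T T0.
    have Tg : 0 < T - g by rewrite subr_gt0.
    have [r2 _ _] := ab2 (T - g) Tg; have := r2 x.
    have -> : T - g + 2 * g = T + g by ring.
    move=> /andP[_]; have := hA T g x g0 gT; rewrite -xa.
    by clear -n; lra.
  have h2 : b2 <= 2 * b.
    apply: (@limit_large _ _ (A * g ^+ 2) g) => T gT.
    have T0 : 0 < T by apply: lt_trans gT.
    have Tg : 0 < T - g by rewrite subr_gt0.
    have [_ _ [x xb]] := ab (T - g) Tg.
    have [r2 _ _] := ab2 (T - g) Tg; have := r2 x.
    have -> : T - g + 2 * g = T + g by ring.
    rewrite subrK in xb.
    move=> /andP[+ _]; have := hA T g x g0 gT; rewrite -xb.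
    by clear -n; lra.
  have := IH (2 * g) a2 b2 g20 ab2.
  have : 2 ^+ k * (2 * (a - b)) <= 2 ^+ k * (a2 - b2).
    by rewrite ler_wpM2l ?exprn_ge0//; move: h1 h2; clear -n; lra.
  by rewrite exprS; clear -n; lra.
move=> h0; have [a [b ab]] := increment_range S h0.
have aleb : a <= b.
  apply: (@expn2_small _ _ _ (4 * L)) => k; have := claim k h a b h0 ab.
  have p0 : 0 < 2 ^+ k :> R by rewrite exprn_gt0.
  rewrite mulrC -ler_pdivlMr// => hh; move: hh; clear -n; lra.
exists a => t x t0; have [r _ _] := ab t t0; have /andP[r1 r2] := r x.
by apply/eqP; rewrite eq_le r2 (le_trans aleb r1).
Qed.

(** Since the increments over each [h] depend neither on the point nor on the time, the time
    derivatives at any two points coincide. Integration gives the affine formula between positive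
    times, and the Lipschitz bound in time extends it to 0. *)
Lemma rigidity K v Q C L Ct : regular_solution K v Q C L Ct -> exists c : R,
  (forall t x, 0 < t -> K (x, Q t x) = c) /\ forall t x, 0 <= t -> v t x = v 0 x - c * t.
Proof.
move=> S; have [tK cv pv sub sup C0 Ct0 L0 vt vx vq] := S.
have inc h : exists a : R, 0 < h -> forall t x, 0 < t -> v (t + h) x - v t x = a.
  have [h0|h0] := ltP 0 h; last by exists 0.
  by have [a ha] := increment_constant S h0; exists a.
have KC t x s y : 0 < t -> 0 < s -> - K (x, Q t x) <= - K (y, Q s y).
  move=> t0 s0.
  have /is_derive1_eps d1 := jet_time_derivative x S t0.
  have /is_derive1_eps d2 := jet_time_derivative y S s0.
  apply/ler_addgt0Pr => e e0; have e2 : 0 < e / 2 by rewrite divr_gt0.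
  have [r1 r10 hr1] := d1 _ e2; have [r2 r20 hr2] := d2 _ e2.
  have [h [h0 hr hr']] := exists_lt_min r10 r20.
  have [a ha] := inc h.
  have := hr1 (t + h); rewrite [t + h - t]addrAC subrr add0r (gtr0_norm h0) => /(_ hr).
  have := hr2 (s + h); rewrite [s + h - s]addrAC subrr add0r (gtr0_norm h0) => /(_ hr').
  rewrite !ha// !ler_norml -![h *: _]/(h * _) => /andP[k1 k2] /andP[k3 k4].
  by rewrite -(ler_pM2l h0); move: k1 k4 k2 k3; clear -n; lra.
have Kc t x : 0 < t -> K (x, Q t x) = K (0, Q 1 0).
  by move=> t0; apply/eqP; rewrite eq_le -!(lerN2 (K _)) !KC.
exists (K (0, Q 1 0)); split => // t x t0.
have [->|tn] := eqVneq t 0; first by rewrite mulr0 subr0.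
have tp : 0 < t by rewrite lt_neqAle eq_sym tn.
have pos s : 0 < s -> s <= t -> v t x - v s x = - K (0, Q 1 0) * (t - s).
  move=> s0 st; have [z /andP[sz zt] ->] := mvt st (fun z (hz : s <= z <= t) =>
     jet_time_derivative x S (lt_le_trans s0 (proj1 (andP hz)))).
  by rewrite Kc// (lt_le_trans s0).
pose k := K (0, Q 1 0); rewrite -/k in pos *.
have bound s : 0 < s -> s < t -> `|v t x - (v 0 x - k * t)| <= (Ct + `|k|) * s.
  move=> s0 st; have := pos s s0 (ltW st); have := vt s 0 x (ltW s0) (lexx _); rewrite subr0 (gtr0_norm s0).
  have -> : v t x - (v 0 x - k * t) = (v s x - v 0 x) + (v t x - v s x - - k * (t - s)) + k * s by ring.
  move=> h1 ->; rewrite subrr addr0; apply: le_trans (ler_normD _ _) _.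
  by rewrite normrM (gtr0_norm s0) mulrDl lerD.
apply/eqP; rewrite -subr_eq0 -normr_le0.
by apply: (@le_small _ _ _ (Ct + `|k|) t) => // s s0 st; rewrite add0r; exact: bound.
Qed.

End RigidityTheorem.

(** * Change of sign and slices of multi-time solutions *)

Section MultiTime.
Context {R : realType} {n : nat}.
Notation P := ('rV[R]_n * 'rV[R]_n)%type.

(** The Hamiltonian of the equation solved by [- u]; concavity in [p] becomes convexity. *)
Definition flip (K : P -> R) (z : P) : R := - K (z.1, - z.2).

Lemma within_comp (T V W : topologicalType) (A : set V) (f : V -> W) (g : T -> V) :
  {within A, continuous f} -> continuous g -> (forall z, A (g z)) -> continuous (fun z => f (g z)).
Proof.
move=> /subspace_continuousP cf cg Ag z B nB.
have := cg z _ (cf (g z) (Ag z) B nB); rewrite /nbhs/= => H.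
by apply: filterS H => w /=; apply; exact: Ag.
Qed.

Lemma open_prod (T V : topologicalType) (A : set T) (B : set V) : open A -> open B -> open (A `*` B).
Proof.
move=> oA oB; rewrite openE => -[x y] [/= Ax By].
by exists (A, B) => //=; split; apply: open_nbhs_nbhs.
Qed.

Lemma open_quadrant : open [set t : R * R | 0 < t.1 /\ 0 < t.2].
Proof.
rewrite (_ : mkset _ = [set t : R | 0 < t] `*` [set t : R | 0 < t]).
  by apply: open_prod; exact: open_gt.
by apply/seteqP; split=> -[].
Qed.

(** [phi] is regular only over [O], so the derivative of [- phi] is the opposite of that of [phi]
    only there; openness makes this hold near the point, which transfers continuity. *)
Lemma test_functionN (T : normedModType R) (O : set T) (phi : T * 'rV[R]_n -> R) :
  open O -> test_function O phi -> test_function O (fun z => - phi z).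
Proof.
move=> oO [[dphi cphi] pphi]; split; last by move=> t Ot x k; rewrite pphi.
have oA : open (O `*` setT : set (T * 'rV[R]_n)) by apply: open_prod => //; exact: openT.
split=> [z Az|v z Az]; first by apply: differentiableN; exact: dphi.
have cc : {for z, continuous (fun z => - 'D_v phi z)} by apply: continuousN; exact: cphi.
have nA : \forall w \near z, 'D_v (fun z => - phi z) w = - 'D_v phi w.
  have := open_nbhs_nbhs (conj oA Az); apply: filterS => w Aw.
  by apply: deriveN; apply: diff_derivable; exact: dphi.
move=> B nB; rewrite (nbhs_singleton nA) in nB.
have := cc B nB; rewrite /nbhs/= => H.
by apply: filterS2 nA H => w wE Bw; rewrite /preimage/= wE.
Qed.

Lemma HJ_lhs_flip (T : normedModType R) (e : T) (K : P -> R) phi z : differentiable phi z ->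
  HJ_lhs e (flip K) phi z = - HJ_lhs e K (fun w => - phi w) z.
Proof.
move=> dz; rewrite /HJ_lhs /flip/=.
have dpart v : 'D_v (fun w => - phi w) z = - 'D_v phi z.
  by apply: deriveN; exact: diff_derivable.
have -> : 'D_e (fun t => - phi (t, z.2)) z.1 = - 'D_e (fun t => phi (t, z.2)) z.1.
  rewrite (derive_partial_fst (fun w => - phi w)) (derive_partial_fst phi).
  by rewrite -surjective_pairing dpart.
have -> : grad (fun x => - phi (z.1, x)) z.2 = - grad (fun x => phi (z.1, x)) z.2.
  apply/rowP => i; rewrite !mxE (derive_partial_snd (fun w => - phi w)) (derive_partial_snd phi).
  by rewrite -surjective_pairing dpart.
by rewrite opprD opprK.
Qed.

Lemma viscosity_flip (T : normedModType R) (O : set T) (e : T) (K : P -> R) u : open O ->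
  viscosity_supersolution O e K u <-> viscosity_subsolution O e (flip K) (fun z => - u z).
Proof.
move=> oO; split=> H phi tphi z Oz hz; have [[dphi _] _] := tphi; have dz := dphi z (conj Oz I).
  rewrite HJ_lhs_flip// oppr_le0; apply: H (test_functionN oO tphi) _ Oz _.
  apply: filterS hz => w.
  by move: (u w) (u z) (phi w) (phi z); clear -n; move=> *; lra.
have := H _ (test_functionN oO tphi) z Oz; rewrite HJ_lhs_flip; last exact: differentiableN.
rewrite oppr_le0 (_ : (fun _ => - - _) = phi); last by apply/funext => w; rewrite opprK.
apply; apply: filterS hz => w.
by move: (u w) (u z) (phi w) (phi z); clear -n; move=> *; lra.
Qed.

Lemma slice_jets (T : normedModType R) (O : set T) (e : T) (a b : {linear T -> R})
    (emb : R -> R -> T) (K : P -> R) (u : T * 'rV[R]_n -> R) (U : R -> R -> 'rV[R]_n -> R) :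
  open O -> continuous a -> continuous b -> a e = 1 -> b e = 0 ->
  (forall t s, a (emb t s) = t /\ b (emb t s) = s) ->
  (forall t s, 0 < t -> 0 < s -> O (emb t s)) ->
  continuous K -> jcont3 U ->
  (forall tau y, 0 < a tau -> 0 < b tau -> u (tau, y) = U (a tau) (b tau) y) ->
  viscosity_solution O e K u ->
  forall s0 : R, 0 <= s0 -> jet_sub K (fun t => U t s0) /\ jet_super K (fun t => U t s0).
Proof.
move=> oO ca cb ae be embE Oemb cK cU uU [_ _ sub sup] s0 s00; split.
  exact: (slice_jet_sub ca cb ae be embE Oemb cK cU uU sub).
have cK' : continuous (flip K).
  apply: ctsN; apply: (cts_comp cK); apply: cts_pair; first by apply: cts_fst; exact: cts_id.
  by apply: ctsN; apply: cts_snd; exact: cts_id.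
have cU' : jcont3 (fun t s x => - U t s x) by exact: ctsN.
have uU' tau y : 0 < a tau -> 0 < b tau -> - u (tau, y) = - U (a tau) (b tau) y.
  by move=> h1 h2; rewrite uU.
have := slice_jet_sub ca cb ae be embE Oemb cK' cU' uU' ((viscosity_flip e K u oO).1 sup) s00.
move=> H t x p q t0 /subjetN J; have := H t x _ _ t0 J; rewrite /flip/= opprK.
by rewrite -opprD oppr_le0.
Qed.

Lemma flip_jets (K : P -> R) v : jet_sub K v -> jet_super K v ->
  jet_sub (flip K) (fun t x => - v t x) /\ jet_super (flip K) (fun t x => - v t x).
Proof.
move=> sub sup; split=> t x a p t0 J.
  have := sup t x (- a) (- p) t0; rewrite subjetN !opprK => /(_ J).
  by rewrite /flip/= -oppr_ge0 opprD opprK.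
move/subjetN: J; rewrite (_ : (fun _ _ => _) = v); last first.
  by apply/funext => s; apply/funext => y; rewrite opprK.
by move=> J; have := sub t x _ _ t0 J; rewrite /flip/= -oppr_ge0 opprD opprK.
Qed.

(** Extends [u] continuously to all real times from the closed quadrant; jets at a positive time do
    not see the extension. *)
Definition clamp (u : (R * R) * 'rV[R]_n -> R) (t s : R) x := u ((Num.max 0 t, Num.max 0 s), x).

Lemma multitime_slices (H G : P -> R) (u0 : 'rV[R]_n -> R) u : continuous H -> continuous G ->
  multitime_solution H G u0 u ->
  [/\ jcont3 (clamp u), forall t s, Zn_periodic (clamp u t s),
      forall s : R, 0 <= s -> jet_sub H (fun t => clamp u t s) /\ jet_super H (fun t => clamp u t s),
      forall t : R, 0 <= t -> jet_sub G (clamp u t) /\ jet_super G (clamp u t) &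
      clamp u 0 0 = u0].
Proof.
move=> cH cG [pu cu vH vG u0E].
have m0 (s : R) : 0 <= Num.max 0 s by rewrite le_max lexx.
have mE (s : R) : 0 < s -> Num.max 0 s = s by move=> s0; apply/max_idPr; exact: ltW.
have cU : jcont3 (clamp u).
  apply: (within_comp cu) => //; last by move=> z; split => //; split => /=.
  apply: cts_pair; last by apply: cts_snd; exact: cts_id.
  apply: cts_pair; apply: cts_max; try exact: cts_cst.
    by apply: cts_fst; apply: cts_fst; exact: cts_id.
  by apply: cts_snd; apply: cts_fst; exact: cts_id.
have cf : continuous (fst : R * R -> R) by apply: cts_fst; exact: cts_id.
have cs : continuous (snd : R * R -> R) by apply: cts_snd; exact: cts_id.
split=> //.
- by move=> t s; apply: pu; split => /=.
- move=> s s0.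
  have := @slice_jets ((R * R)%type : normedModType R) _ (1, 0) fst snd (fun t s => (t, s)) H u (clamp u) open_quadrant cf cs erefl erefl.
  apply => //.
  by move=> [t r] y /= t0 r0; rewrite /clamp !mE.
- have cU' : jcont3 (fun s t => clamp u t s).
    apply: (jcont3_comp cU).
    - by apply: cts_snd; apply: cts_fst; exact: cts_id.
    - by apply: cts_fst; apply: cts_fst; exact: cts_id.
    - by apply: cts_snd; exact: cts_id.
  move=> t t0.
  have := @slice_jets ((R * R)%type : normedModType R) _ (0, 1) snd fst (fun t s => (s, t)) G u (fun s t => clamp u t s) open_quadrant cs cf erefl erefl.
  apply => //.
  by move=> [r s] y /= t0' r0; rewrite /clamp !mE.
- by apply/funext => x; rewrite /clamp maxxx u0E.
Qed.

End MultiTime.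

(** * The symmetric two-time problem *)

Section TwoTimes.
Context {R : realType} {n : nat}.
Notation P := ('rV[R]_n * 'rV[R]_n)%type.
Implicit Types (K : P -> R) (U : R -> R -> 'rV[R]_n -> R).

(* The symmetric form of the multi-time problem: for [K2 = flip G], the second equation for
   [U] becomes a Tonelli equation for [- U]. *)
Record two_time_solution K1 K2 U (L : R) : Prop := TwoTimeSolution {
  tt_tame1 : tame K1; tt_tame2 : tame K2;
  tt_cont : jcont3 U; tt_per : forall t s, Zn_periodic (U t s);
  tt_jets1 : forall s, 0 <= s -> jet_sub K1 (U ^~ s) /\ jet_super K1 (U ^~ s);
  tt_jets2 : forall t, 0 <= t -> jet_sub K2 (fun s x => - U t s x) /\ jet_super K2 (fun s x => - U t s x);
  tt_L0 : 0 <= L; tt_init : forall x y, `|U 0 0 x - U 0 0 y| <= L * `|x - y| }.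

(** Exchanging the times together with the sign preserves the structure, so what is proved in the
    first time holds in the second one. *)
Lemma two_time_swap K1 K2 U (L : R) : two_time_solution K1 K2 U L ->
  two_time_solution K2 K1 (fun t s x => - U s t x) L.
Proof.
move=> [t1 t2 cU pU j1 j2 L0 i0]; split => //.
- apply: ctsN; apply: (jcont3_comp cU).
  - by apply: cts_snd; apply: cts_fst; exact: cts_id.
  - by apply: cts_fst; apply: cts_fst; exact: cts_id.
  - by apply: cts_snd; exact: cts_id.
- by move=> t s x k; rewrite pU.
- move=> t t0; have := j1 t t0.
  rewrite (_ : (fun _ _ => - - _) = U ^~ t)//; last first.
  by apply/funext => s; apply/funext => x; rewrite opprK.
- by move=> x y; rewrite -opprD normrN.
Qed.

Lemma two_time_jcont1 K1 K2 U (L s : R) : two_time_solution K1 K2 U L -> jcont (U ^~ s).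
Proof.
move=> S; apply: (jcont3_comp (tt_cont S)).
- by apply: cts_fst; exact: cts_id.
- exact: cts_cst.
- by apply: cts_snd; exact: cts_id.
Qed.

Lemma two_time_jcont2 K1 K2 U (L t : R) : two_time_solution K1 K2 U L -> jcont (fun s x => - U t s x).
Proof. by move=> S; exact: (two_time_jcont1 (s := t) (two_time_swap S)). Qed.

Lemma two_time_lipschitz K1 K2 U (L : R) : two_time_solution K1 K2 U L ->
  exists L1 C1 : R, [/\ 0 <= L1, 0 <= C1,
    forall s t t' x, 0 <= s -> 0 <= t -> 0 <= t' -> `|U t s x - U t' s x| <= C1 * `|t - t'| &
    forall s t x y, 0 <= s -> 0 <= t -> `|U t s x - U t s y| <= L1 * `|x - y|].
Proof.
move=> S; have [t1 t2 cU pU j1 j2 L0 i0] := S.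
have [L' [C' [L'0 C'0 H2]]] := jet_lipschitz t2 L0.
have [L1 [C1 [L10 C10 H1]]] := jet_lipschitz t1 L'0.
exists L1, C1.
have [sb sp] := j2 0 (lexx _).
have [||_ xl] := H2 _ (two_time_jcont2 (t := 0) S) _ sb sp.
- by move=> s x k; rewrite pU.
- by move=> x y; rewrite -opprD normrN.
have key s : 0 <= s -> (forall t s' x, 0 <= t -> 0 <= s' -> `|U t s x - U s' s x| <= C1 * `|t - s'|) /\
  (forall t x y, 0 <= t -> `|U t s x - U t s y| <= L1 * `|x - y|).
  move=> s0; have [sb1 sp1] := j1 s s0.
  apply: (H1 _ (two_time_jcont1 (s := s) S) _ sb1 sp1).
    by move=> t x k; exact: pU.
  by move=> x y; have := xl s x y s0; rewrite -opprD normrN.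
split => //; first by move=> s t t' x s0 t0 t'0; exact: (key s s0).1.
by move=> s t x y s0 t0; exact: (key s s0).2.
Qed.

(** [jet_semiconcave] concerns the single time [t0]; a later time [t] is reached by moving the
    origin of times to [t - t0]. *)
Lemma two_time_semiconcave K1 K2 U (L t0 : R) : two_time_solution K1 K2 U L -> 0 < t0 ->
  exists2 A : R, 0 <= A & forall t s x h, t0 <= t -> 0 <= s ->
    U t s (x + h) + U t s (x - h) - 2 * U t s x <= A * sqn h.
Proof.
move=> S t00; have [t1 t2 cU pU j1 j2 L0 i0] := S.
have [L1 [C1 [L10 C10 tl xl]]] := two_time_lipschitz S.
have [A A0 hA] := jet_semiconcave t1 L10 C10 t00; exists A => // t s x h t0t s0.
have [sb sp] := j1 s s0.
have d0 : 0 <= t - t0 by rewrite subr_ge0.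
have := hA (fun r => U (r + (t - t0)) s) (jcont_shift (s := t - t0) (two_time_jcont1 (s := s) S)) _
  (jet_sub_shift d0 sb) (jet_super_shift d0 sp) _ _ x h.
rewrite subrKC; apply.
- by move=> r y k; exact: pU.
- move=> r r' y r0 r'0; have := tl s (r + (t - t0)) (r' + (t - t0)) y s0 (addr_ge0 r0 d0) (addr_ge0 r'0 d0).
  by rewrite opprD addrACA subrr addr0.
- by move=> r y z r0; exact: (xl s _ _ _ s0 (addr_ge0 r0 d0)).
Qed.

Lemma two_time_quad_diff K1 K2 U (L t0 : R) : two_time_solution K1 K2 U L -> 0 < t0 ->
  exists Q (C : R), 0 <= C /\ forall t s, t0 <= t -> t0 <= s -> quad_diff (U t s) (Q t s) C.
Proof.
move=> S t00.
have [L1 [C1 [L10 C10 tl xl]]] := two_time_lipschitz S.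
have [A A0 hA] := two_time_semiconcave S t00.
have [B B0 hB] := two_time_semiconcave (two_time_swap S) t00.
(* The default [P = 0] below the threshold lets [Q] be chosen for all pairs of times at once. *)
have H (z : R * R) : exists P, t0 <= z.1 -> t0 <= z.2 -> quad_diff (U z.1 z.2) P (A + B).
  have [t0t|t0t] := leP t0 z.1; last by exists 0.
  have [t0s|t0s] := leP t0 z.2; last by exists 0.
  have s0 := le_trans (ltW t00) t0s; have p0 := le_trans (ltW t00) t0t.
  have [|x h|x y|Q hQ] := @second_difference_quad_diff R n (U z.1 z.2) (A + B) L1.
  - exact: addr_ge0.
  - have h1 := hA z.1 z.2 x h t0t s0; have h2 := hB z.2 z.1 x h t0s p0.
    have k1 : 0 <= A * sqn h by rewrite mulr_ge0 ?sqn_ge0.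
    have k2 : 0 <= B * sqn h by rewrite mulr_ge0 ?sqn_ge0.
    by rewrite ler_norml; apply/andP; split; move: h1 h2 k1 k2; clear -n; lra.
  - exact: xl.
  by exists Q.
have [Q hQ] := boolp.choice H.
exists (fun t s => Q (t, s)), (A + B); split; first exact: addr_ge0.
by move=> t s; exact: (hQ (t, s)).
Qed.

(** The origin is moved to [t0] because the C11 bound is available only away from time 0. *)
Lemma two_time_rigid K1 K2 U (L t0 : R) : two_time_solution K1 K2 U L -> 0 < t0 ->
  exists Q (C : R), [/\ 0 <= C, forall t s, t0 <= t -> t0 <= s -> quad_diff (U t s) (Q t s) C &
   forall s, t0 <= s -> exists c : R, (forall t x, t0 < t -> K1 (x, Q t s x) = c) /\
     (forall t x, t0 <= t -> U t s x = U t0 s x - c * (t - t0))].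
Proof.
move=> S t00; have [t1 t2 cU pU j1 j2 L0 i0] := S.
have [L1 [C1 [L10 C10 tl xl]]] := two_time_lipschitz S.
have [Q [C [C0 hQ]]] := two_time_quad_diff S t00; exists Q, C; split => // s t0s.
have d0 := ltW t00; have s0 := le_trans d0 t0s; have [sb sp] := j1 s s0.
have RS : regular_solution K1 (fun r => U (r + t0) s) (fun r => Q (r + t0) s) C L1 C1.
  split => //.
  - exact: (jcont_shift (s := t0) (two_time_jcont1 (s := s) S)).
  - exact: (jet_sub_shift d0 sb).
  - exact: (jet_super_shift d0 sp).
  - move=> r r' y r0 r'0; have := tl s (r + t0) (r' + t0) y s0 (addr_ge0 r0 d0) (addr_ge0 r'0 d0).
    by rewrite opprD addrACA subrr addr0.
  - by move=> r y z r0; exact: (xl s _ _ _ s0 (addr_ge0 r0 d0)).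
  - by move=> r r0; apply: hQ => //; rewrite lerDr.
have [c [c1 c2]] := rigidity RS; exists c; split=> t x t0t.
  by have := c1 (t - t0) x; rewrite subrK subr_gt0; exact.
by have := c2 (t - t0) x; rewrite subrK subr_ge0 add0r; exact.
Qed.

Lemma two_time_increment K1 K2 U (L t0 : R) : two_time_solution K1 K2 U L -> 0 < t0 ->
  forall t t' s x y, t0 <= t -> t0 <= t' -> t0 <= s -> U t s x - U t' s x = U t s y - U t' s y.
Proof.
move=> S t00 t t' s x y t0t t0t' t0s.
have [Q [C [_ _ H]]] := two_time_rigid S t00; have [c [_ hc]] := H s t0s.
by rewrite (hc t x t0t) (hc t y t0t) (hc t' x t0t') (hc t' y t0t'); ring.
Qed.

Lemma two_time_conclusion K1 K2 U (L : R) : two_time_solution K1 K2 U L ->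
  exists Q (C c1 c2 : R), [/\ 0 <= C, quad_diff (U 0 0) Q C, forall x, K1 (x, Q x) = c1 &
    forall x, K2 (x, - Q x) = c2].
Proof.
move=> S; have S' := two_time_swap S.
(* With the threshold [1/2] the pair [(1, 1)] is strictly beyond it, and the energies can be read
   there. *)
have h0 : 0 < 2^-1 :> R by rewrite invr_gt0.
have h1 : 2^-1 < 1 :> R by rewrite invf_lt1// ltr1n.
have [Q [C [C0 hQ hc]]] := two_time_rigid S h0.
have [Q' [C' [C'0 hQ' hc']]] := two_time_rigid S' h0.
have [c1 [hc1 _]] := hc 1 (ltW h1); have [c2 [hc2 _]] := hc' 1 (ltW h1).
have q1 := hQ 1 1 (ltW h1) (ltW h1); have q2 := hQ' 1 1 (ltW h1) (ltW h1).
have QQ x : Q' 1 1 x = - Q 1 1 x.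
  by rewrite -(quad_diff_grad x C'0 q2) -(quad_diff_grad x C0 (quad_diffN q1)).
(* From [(1, 1)] to [(t, 1)] and then to [(t, t)] only constants are added, [t] itself serving as
   the threshold. Continuity at the corner reaches [(0, 0)], so the initial datum has the gradient
   found at [(1, 1)]. *)
have cst x : U 0 0 x = U 1 1 x + (U 0 0 0 - U 1 1 0).
  have key (t : R) : 0 < t -> t <= 1 -> U t t x - U t t 0 = U 1 1 x - U 1 1 0.
    move=> t0 t1; have e1 := two_time_increment S t0 x 0 t1 (lexx t) t1.
    have e2 := two_time_increment S' t0 x 0 t1 (lexx t) (lexx t).
    by move: e1 e2; clear -n; lra.
  have cD : continuous (fun t => (U t t x - U t t 0) - (U 1 1 x - U 1 1 0)).
    apply: ctsB; last exact: cts_cst.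
    by apply: ctsB; apply: (jcont3_comp (tt_cont S)); (exact: cts_id || exact: cts_cst).
  suff : `|(U 0 0 x - U 0 0 0) - (U 1 1 x - U 1 1 0)| <= 0.
    by rewrite normr_le0 => /eqP; clear -n; lra.
  apply/ler_addgt0Pr => e e0; rewrite add0r.
  have [d d0 hd] := (cts_eps _).1 cD 0 e e0.
  have [m [m0 m1 md]] := exists_lt_min ltr01 d0.
  have := hd m; rewrite subr0 (gtr0_norm m0) => /(_ md).
  by rewrite key ?(ltW m1)// subrr sub0r normrN => /ltW.
exists (Q 1 1), C, c1, c2; split => //.
- by move=> x h; rewrite (cst (x + h)) (cst x); have := q1 x h; congr (`|_| <= _); ring.
- by move=> x; exact: hc1.
- by move=> x; rewrite -QQ; exact: hc2.
Qed.

Lemma multitime_rigid (H G : P -> R) (u0 : 'rV[R]_n -> R) u : tame H -> tame (flip G) -> continuous G ->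
  lipschitz u0 -> multitime_solution H G u0 u ->
  exists c1 c2 : R, C11 u0 /\ forall x, H (x, grad u0 x) = c1 /\ G (x, grad u0 x) = c2.
Proof.
move=> tH tG cG /lipschitz_onE[L L0 hL] su; have [cH _ _ _] := tH.
have [cU pU jH jG uE] := multitime_slices cH cG su.
have S : two_time_solution H (flip G) (clamp u) L.
  split => //; last by move=> x y; rewrite uE; exact: hL.
    by move=> t t0; have [s1 s2] := jG t t0; exact: flip_jets.
  exact: ltW.
have [Q [C [c1 [c2 [C0 q h1 h2]]]]] := two_time_conclusion S; rewrite uE in q.
exists c1, (- c2); split; first exact: quad_diff_C11 C0 q.
move=> x; rewrite (quad_diff_grad x C0 q); split => //.
by have := h2 x; rewrite /flip/= !opprK => <-; rewrite opprK.
Qed.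

End TwoTimes.

(** * Classical solutions and the semigroup on data of constant energy *)

Section ClassicalSolutions.
Context {R : realType} {n : nat}.
Notation P := ('rV[R]_n * 'rV[R]_n)%type.
Implicit Types (K : P -> R) (w : 'rV[R]_n -> R).

Lemma local_max_derive (V : normedModType R) (f : V -> R) (z v : V) (d : R) :
  local_max f z -> is_derive z v f d -> d = 0.
Proof.
move=> /near_eps[r r0 hr] df.
have q0 : 0 < r / (`|v| + 1) by rewrite divr_gt0// ltr_wpDl.
have df' : is_derive 0 (1 : R) (fun t => f (z + t *: v)) d.
  by apply: (is_derive_line f z v 0 _).1; rewrite scale0r addr0.
apply: (der_local_max df' q0) => t; rewrite subr0 scale0r addr0 ltr_pdivlMr ?ltr_wpDl// => tq.
apply: hr; rewrite addrAC subrr add0r normrZ; apply: le_lt_trans tq.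
by rewrite ler_wpM2l// lerDl.
Qed.

Lemma grad_addC w (k : R) (x : 'rV[R]_n) : C1 w -> grad (fun y => w y + k) x = grad w x.
Proof.
move=> cw; apply/rowP => i; rewrite !mxE.
have d1 := C1_is_derive x (delta_mx 0 i) cw.
have d2 := is_deriveD d1 (is_derive_cst k x (delta_mx 0 i)).
by case: d2 => _ ->; rewrite addr0.
Qed.

Lemma local_max_partials (T : normedModType R) (f : T * 'rV[R]_n -> R) z : local_max f z ->
  local_max (fun t => f (t, z.2)) z.1 /\ local_max (fun x => f (z.1, x)) z.2.
Proof.
case: z => t x fz /=; split.
  have c1 : continuous (fun t : T => (t, x)) by apply: cts_pair; [exact: cts_id|exact: cts_cst].
  exact: (c1 t _ fz).
have c1 : continuous (fun x : 'rV[R]_n => (t, x)) by apply: cts_pair; [exact: cts_cst|exact: cts_id].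
exact: (c1 x _ fz).
Qed.

Lemma differentiable_partials (T : normedModType R) (f : T * 'rV[R]_n -> R) z : differentiable f z ->
  differentiable (fun t => f (t, z.2)) z.1 /\ differentiable (fun x => f (z.1, x)) z.2.
Proof.
by case: z => t x df; split; [apply: (@differentiable_comp _ _ _ _ (fun t : T => (t, x)) f)
  |apply: (@differentiable_comp _ _ _ _ (fun x : 'rV[R]_n => (t, x)) f)].
Qed.

Lemma classical_subsolution (T : normedModType R) (O : set T) (e : T) K w (psi : T -> R) (c : R) :
  C1 w -> (forall x, K (x, grad w x) = c) -> (forall t, is_derive t e psi (- c)) ->
  viscosity_subsolution O e K (fun z => w z.2 + psi z.1).
Proof.
move=> cw Kc dpsi phi [[dphi _] _] z Oz /local_max_partials/=[m1 m2].
have [d1 d2] := differentiable_partials (dphi z (conj Oz I)).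
have e1 : 'D_e (fun t => phi (t, z.2)) z.1 = - c.
  have := local_max_derive m1 (is_deriveB (is_deriveD (is_derive_cst (w z.2) z.1 e) (dpsi z.1)) (derivableP (diff_derivable d1))).
  by move=> /eqP; rewrite add0r subr_eq0 => /eqP.
have e2 : grad (fun x => phi (z.1, x)) z.2 = grad w z.2.
  apply/rowP => i; rewrite !mxE.
  have := local_max_derive m2 (is_deriveB (is_deriveD (C1_is_derive z.2 (delta_mx 0 i) cw) (is_derive_cst (psi z.1) z.2 _)) (derivableP (diff_derivable d2))).
  by move=> /eqP; rewrite addr0 subr_eq0 => /eqP.
by rewrite /HJ_lhs e1 e2 Kc addNr.
Qed.

Lemma gradN w (x : 'rV[R]_n) : C1 w -> grad (fun y => - w y) x = - grad w x.
Proof.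
move=> cw; apply/rowP => i; rewrite !mxE; apply: deriveN; apply: diff_derivable; exact: C1_differentiable.
Qed.

Lemma classical_solution (T : normedModType R) (O : set T) (e : T) K w (psi : T -> R) (c : R) :
  open O -> C1 w -> Zn_periodic w -> (forall x, K (x, grad w x) = c) ->
  continuous psi -> (forall t, is_derive t e psi (- c)) ->
  viscosity_solution O e K (fun z => w z.2 + psi z.1).
Proof.
move=> oO cw pw Kc cpsi dpsi; split.
- by move=> t _ x k /=; rewrite pw.
- apply: continuous_subspaceT; apply: ctsD; last by apply: (cts_comp cpsi); apply: cts_fst; exact: cts_id.
  by apply: (cts_comp (C1_cts cw)); apply: cts_snd; exact: cts_id.
- exact: classical_subsolution cw Kc dpsi.
apply/(viscosity_flip e K _ oO).
rewrite (_ : (fun _ => _) = fun z : T * 'rV[R]_n => - w z.2 + - psi z.1); last first.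
  by apply/funext => z; rewrite opprD.
apply: (@classical_subsolution T O e (flip K) (fun x => - w x) (fun t => - psi t) (- c)).
  exact: C1N.
by move=> x; rewrite /flip gradN// opprK Kc.
Qed.

(** The perturbed classical solution [w - c t + eps t^2] is itself a test function, and its gradient
    in [x] is that of [w] everywhere. At a maximum over a positive time the subsolution inequality
    therefore reads [2 eps t <= 0]. *)
Lemma subsolution_upper_bound K w (u : R * 'rV[R]_n -> R) (c k : R) : C1 w -> Zn_periodic w -> (forall x, K (x, grad w x) = c) ->
  {within [set t : R | 0 <= t] `*` setT, continuous u} -> (forall t : R, 0 <= t -> Zn_periodic (fun x => u (t, x))) ->
  (forall x, u (0, x) = w x) -> (forall (t : R) x, 0 <= t -> u (t, x) <= w x + k * t) ->
  viscosity_subsolution [set t : R | 0 < t] 1 K u -> forall (t : R) x, 0 <= t -> u (t, x) <= w x - c * t.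
Proof.
move=> cw pw Kc cu pu u0 uk sub ts xs ts0; rewrite leNgt; apply/negP => hlt.
have ts1 : 0 < ts.
  rewrite lt_neqAle ts0 andbT; apply/eqP => E; move: hlt; rewrite -E u0 mulr0 subr0; by rewrite ltxx.
pose D t x := u (t, x) - w x + c * t.
have Ds : 0 < D ts xs by rewrite /D; move: hlt; clear -n; lra.
pose eps := D ts xs / (2 * ts ^+ 2).
have t20 : 0 < 2 * ts ^+ 2 by rewrite mulr_gt0// exprn_gt0.
have eps0 : 0 < eps by rewrite divr_gt0.
have epsE : eps * ts ^+ 2 = D ts xs / 2.
  by rewrite /eps; field; rewrite lt0r_neq0.
clearbody eps.
(* Since [D t x <= A t], the penalization has absorbed the gap at the time [T], where
   [A T <= eps T^2]: the maximum is reached before [T]. *)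
pose A := `|k + c|; pose T := A / eps + ts.
have T0 : 0 < T by apply: ltr_wpDl ts1; exact: divr_ge0 (normr_ge0 _) (ltW eps0).
have TE : A <= eps * T by rewrite /T mulrDr mulrCA divff ?lt0r_neq0// mulr1 lerDl mulr_ge0// ltW.
have tsT : ts <= T by rewrite /T lerDr; exact: divr_ge0 (normr_ge0 _) (ltW eps0).
clearbody T.
pose Psi t x := u (Num.max 0 t, x) - (w x - c * t + eps * t ^+ 2).
have cPsi : continuous (fun z : R * 'rV[R]_n => Psi z.1 z.2).
  apply: ctsB.
    apply: (within_comp cu); last by move=> z; split => //=; rewrite le_max lexx.
    apply: cts_pair; last by apply: cts_snd; exact: cts_id.
    by apply: cts_max; [exact: cts_cst|apply: cts_fst; exact: cts_id].
  have c1 : continuous (fun z : R * 'rV[R]_n => z.1) by apply: cts_fst; exact: cts_id.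
  apply: ctsD; last by apply: ctsM; [exact: cts_cst|exact: ctsM].
  apply: ctsB; last by apply: ctsM; [exact: cts_cst|exact: c1].
  by apply: (cts_comp (C1_cts cw)); apply: cts_snd; exact: cts_id.
have mE (s : R) : 0 <= s -> Num.max 0 s = s by move=> s0; apply/max_idPr.
have [[t x] [/= tT x1] hmax] : exists2 z : R * 'rV[R]_n,
     ([set t : R | 0 <= t <= T] `*` [set x : 'rV[R]_n | `|x| <= 1]) z &
     forall z', ([set t : R | 0 <= t <= T] `*` [set x : 'rV[R]_n | `|x| <= 1]) z' ->
       Psi z'.1 z'.2 <= Psi z.1 z.2.
  apply: max_compact => //.
  - by exists (0, 0); split => /=; rewrite ?normr0 ?lexx// ltW.
  - by apply: compact_setX; [exact: compact_itv_le|exact: compact_cball].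
have [t0 tT'] := andP tT.
have HP (s : R) (y : 'rV[R]_n) : 0 <= s <= T -> Psi s y <= Psi t x.
  move=> sT; have [j hj] := reduce_mod_Zn y; have /andP[s0 _] := sT.
  have := hmax (s, y + map_mx intr j) (conj sT hj).
  by rewrite /Psi/= pw !mE// (pu s s0).
have big : D ts xs / 2 <= Psi t x.
  apply: le_trans (HP ts xs _); last by rewrite ts0.
  by rewrite /Psi mE// epsE /D; clear -n; lra.
have PsiE (s : R) y : 0 <= s -> Psi s y = D s y - eps * s ^+ 2.
  by move=> s0; rewrite /Psi mE// /D; ring.
have D0 s y : 0 <= s -> D s y <= A * s.
  move=> s0; have := uk s y s0; rewrite /D.
  have : (k + c) * s <= A * s by rewrite ler_wpM2r// ler_norm.
  by clear -n; lra.
have tp : 0 < t.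
  rewrite lt_neqAle t0 andbT; apply/eqP => E; move: big; rewrite PsiE// -E expr0n/= mulr0 subr0.
  by have := D0 0 x (lexx _); rewrite mulr0; move: Ds; clear -n; lra.
have tlT : t < T.
  rewrite lt_neqAle tT' andbT; apply/eqP => E; move: big; rewrite PsiE//.
  have := D0 t x t0; have : A * t <= eps * T * t by rewrite ler_wpM2r.
  rewrite -E expr2 mulrA; move: Ds; clear -n; lra.
pose phi (z : R * 'rV[R]_n) := w z.2 + (eps * z.1 ^+ 2 - c * z.1).
pose g (s : R) := eps * s ^+ 2 - c * s.
have dg (s : R) : is_derive s (1 : R) g (2 * eps * s - c).
  by rewrite /g; apply: is_derive_eq; rewrite /GRing.scale/=; ring.
have cphi : C1 phi.
  have l1 : continuous (fst : R * 'rV[R]_n -> R) by apply: cts_fst; exact: cts_id.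
  have l2 : continuous (snd : R * 'rV[R]_n -> 'rV[R]_n) by apply: cts_snd; exact: cts_id.
  apply: C1D; first exact: (C1_lin_comp _ l2 cw).
  apply: (C1_lin_comp _ l1 (C1_real dg _)).
  apply: ctsB; last exact: cts_cst.
  by apply: ctsM; [exact: cts_cst|exact: cts_id].
have tphi : test_function [set t : R | 0 < t] phi.
  split; last by move=> s _ y j; rewrite /phi/= pw.
  by case: cphi => h1 h2; split=> [z _|v z _]; [exact: h1|exact: h2].
have mx : local_max (V := (R * 'rV[R]_n)%type) (fun z => u z - phi z) (t, x).
  have Tt : 0 < T - t by rewrite subr_gt0.
  have [m [m0 mt mT]] := exists_lt_min tp Tt.
  apply/near_eps; exists m => // -[s y]; rewrite prod_normE gt_max/= => /andP[sm _].
  move: sm; rewrite ltr_norml => /andP[sm1 sm2].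
  have s0 : 0 <= s by move: sm1 mt; clear -n; lra.
  have sT : s <= T by move: sm2 mT; clear -n; lra.
  have := HP s y; rewrite s0 sT => /(_ isT); rewrite !PsiE// /D /phi/=.
  by clear -n; lra.
have := sub phi tphi (t, x) tp mx; rewrite /HJ_lhs/=.
rewrite /phi/= (grad_addC _ _ cw) Kc.
have [_ ->] := is_deriveD (is_derive_cst (w x) t (1 : R)) (dg t).
rewrite add0r subrK leNgt mulr_gt0// mulr_gt0//.
Qed.

Lemma cauchy_unique K w (u : R * 'rV[R]_n -> R) (c : R) : C1 w -> Zn_periodic w -> (forall x, K (x, grad w x) = c) ->
  cauchy_solution K w u -> forall (t : R) x, 0 <= t -> u (t, x) = w x - c * t.
Proof.
move=> cw pw Kc [pu /lipschitz_onE[k k0 lu] [_ _ sub sup] u0] t x t0.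
have growth (s : R) y : 0 <= s -> `|u (s, y) - w y| <= k * s.
  move=> s0; rewrite -u0; have := lu (s, y) (0, y) (conj s0 I) (conj (lexx _) I).
  by rewrite prod_normE/= subr0 subrr normr0 (ger0_norm s0) (max_idPl s0).
have cu : {within [set t : R | 0 <= t] `*` setT, continuous u}.
  apply/subspace_continuousP => z Az; apply/cvgrPdist_lt => e e0.
  have q0 : 0 < e / k by rewrite divr_gt0.
  rewrite near_withinE; apply: (near_eps z _).2; exists (e / k) => // y yz Ay.
  by rewrite distrC; apply: le_lt_trans (lu y z Ay Az) _; rewrite mulrC -ltr_pdivlMr.
have uk (s : R) y : 0 <= s -> u (s, y) <= w y + k * s.
  move=> s0; have := ler_normlW (growth s y s0); move: (u (s, y)) (w y) (k * s).
  by clear -n; move=> *; lra.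
have up := subsolution_upper_bound cw pw Kc cu pu u0 uk sub x t0.
have oO : open [set t : R | 0 < t] by exact: open_gt.
have cw' : C1 (fun x => - w x) by exact: C1N.
have pw' : Zn_periodic (fun x => - w x) by move=> y j; rewrite pw.
have Kc' y : flip K (y, grad (fun x => - w x) y) = - c by rewrite /flip gradN// opprK Kc.
have cu' : {within [set t : R | 0 <= t] `*` setT, continuous (fun z => - u z)}.
  by move=> z; apply: continuousN; exact: cu.
have pu' (s : R) : 0 <= s -> Zn_periodic (fun x => - u (s, x)) by move=> s0 y j; rewrite pu.
have u0' y : - u (0, y) = - w y by rewrite u0.
have uk' (s : R) y : 0 <= s -> - u (s, y) <= - w y + k * s.
  move=> s0; have := lerNnormlW (growth s y s0); move: (u (s, y)) (w y) (k * s).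
  by clear -n; move=> *; lra.
have := subsolution_upper_bound cw' pw' Kc' cu' pu' u0' uk' ((viscosity_flip _ K u oO).1 sup) x t0.
move: up; move: (u (t, x)) (w x) => a b; clear -n; move=> h1 h2.
by apply/eqP; rewrite eq_le; apply/andP; split; lra.
Qed.

(** [semigroup] is defined by a choice, so its value is obtained from existence, here of [w - c t],
    and from uniqueness for these data. *)
Lemma semigroup_classical K w (c t : R) : C1 w -> Zn_periodic w -> lipschitz w ->
  (forall x, K (x, grad w x) = c) -> 0 <= t -> semigroup K t w = fun x => w x - c * t.
Proof.
move=> cw pw /lipschitz_onE[k k0 lw] Kc t0.
have ex : exists u, cauchy_solution K w u.
  exists (fun z => w z.2 + - c * z.1); split.
  - by move=> s _ x j /=; rewrite pw.
  - apply: (@lipschitz_onI _ _ _ _ _ (k + `|c|)) => -[s y] [s' y'] _ _ /=.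
    have n1 : `|y - y'| <= `|(s, y) - (s', y')| by rewrite prod_normE le_max/= lexx orbT.
    have n2 : `|s - s'| <= `|(s, y) - (s', y')| by rewrite prod_normE le_max/= lexx.
    rewrite opprD addrACA -mulrBr mulrDl; apply: le_trans (ler_normD _ _) _.
    rewrite normrM normrN lerD ?ler_wpM2l//; apply: le_trans (lw _ _ I I) _.
    by rewrite ler_wpM2l// ltW.
  - apply: (@classical_solution R [set t : R | 0 < t] 1 K w (fun t => - c * t) c) => //.
    + by apply: ctsM; [exact: cts_cst|exact: cts_id].
    + by move=> s; apply: is_derive_eq; rewrite /GRing.scale/=; ring.
  - by move=> x /=; rewrite mulr0 addr0.
apply/funext => x; exact: (cauchy_unique cw pw Kc (getPex ex)).
Qed.

End ClassicalSolutions.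

(** * Primitives on the whole line *)

Section Primitive.
Context {R : realType}.

Lemma primitive_from (f : R -> R) (a : R) : continuous f -> exists F : R -> R,
  forall t, a < t -> is_derive t (1 : R) F (f t).
Proof.
move=> cf; exists (fun x => \int[lebesgue_measure]_(t in `[a, x]) f t)%R => t at_.
have t1 : t < t + 1 by rewrite ltrDl.
have int : lebesgue_measure.-integrable `[a, t + 1] (EFin \o f).
  apply: continuous_compact_integrable; first exact: segment_compact.
  exact: continuous_subspaceT.
have [d1 d2] := continuous_FTC1_closed t1 int at_ (cf t).
by apply: (DeriveDef d1); rewrite -derive1E; exact: d2.
Qed.

Lemma derive_zero_eq (f : R -> R) (a : R) : (forall t, a < t -> is_derive t (1 : R) f 0) ->
  forall s t, a < s -> a < t -> f s = f t.
Proof.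
move=> df; suff key s t : a < s -> s <= t -> f s = f t.
  by move=> s t as_ at_; have [st|/ltW ts] := leP s t; [exact: key|symmetry; exact: key].
move=> as_ st; have [c _ /eqP] := mvt (df := fun=> 0) st (fun z (hz : s <= z <= t) => df z (lt_le_trans as_ (proj1 (andP hz)))).
by rewrite mul0r subr_eq0 => /eqP.
Qed.

(** The fundamental theorem gives a primitive on each half-line [t > a]. Normalized at 0, two of
    them agree on their common domain, so the base point can move away with [t]. *)
Lemma primitive (f : R -> R) : continuous f -> exists2 F : R -> R, F 0 = 0 &
  forall t, is_derive t (1 : R) F (f t).
Proof.
move=> cf; have H (a : R) : exists F : R -> R, forall t : R, a < t -> is_derive t (1 : R) F (f t).
  exact: primitive_from.
have [G hG] := boolp.choice H.
pose F t := G (- (`|t| + 1)) t - G (- (`|t| + 1)) 0.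
exists F => [|t]; first by rewrite /F subrr.
have cons (a b : R) : a < 0 -> b < 0 -> forall s, a < s -> b < s -> G a s - G a 0 = G b s - G b 0.
  move=> a0 b0 s as_ bs; pose m := Num.max a b.
  have ms : m < s by rewrite gt_max as_.
  have m0 : m < 0 by rewrite gt_max a0.
  have d0 (r : R) : m < r -> is_derive r (1 : R) (fun s => G a s - G b s) 0.
    rewrite gt_max => /andP[ar br].
    have := is_deriveB (hG a r ar) (hG b r br); rewrite subrr; exact.
  have := derive_zero_eq d0 ms m0; clear; lra.
pose a := - (`|t| + 2).
have a0 : a < 0 by rewrite oppr_lt0 ltr_wpDl.
have at_ : a < t by rewrite /a; have := ler_norm (- t); rewrite normrN; clear; lra.
have dt : is_derive t (1 : R) (fun s => G a s - G a 0) (f t).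
  have := is_deriveB (hG a t at_) (is_derive_cst (G a 0) t (1 : R)); rewrite subr0; exact.
have FE (s : R) : `|s - t| < 1 -> F s = G a s - G a 0.
  move=> st; have h1 : `|s| <= `|t| + `|s - t| by rewrite -{1}(subrK t s) addrC ler_normD.
  have h2 := ler_norm (- s); rewrite normrN in h2.
  have s1 : - (`|s| + 1) < 0 by rewrite oppr_lt0 ltr_wpDl.
  by apply: cons => //; rewrite /a; move: h1 h2 st; clear; lra.
apply/is_derive1_eps => e e0; have [r r0 hr] := (is_derive1_eps _ _ _).1 dt e e0.
have [m [m0 mr m1]] := exists_lt_min r0 ltr01.
exists m => // s sm; rewrite !FE ?subrr ?normr0//; last exact: lt_trans m1.
by apply: hr; exact: lt_trans mr.
Qed.

End Primitive.

(** * Global solutions of Lipschitz differential equations *)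

Section ODE.
Context {R : realType} {n : nat}.
Notation P := ('rV[R]_n * 'rV[R]_n)%type.

(** A single index for the [2 n] coordinates, which reduces statements on curves in phase space to
    real functions. *)
Definition co (j : bool * 'I_n) (z : P) : R := if j.1 then z.1 0 j.2 else z.2 0 j.2.

Lemma coB j a b : co j (a - b) = co j a - co j b.
Proof. by rewrite /co; case: j.1; rewrite !mxE. Qed.

Lemma coZ j (k : R) a : co j (k *: a) = k * co j a.
Proof. by rewrite /co; case: j.1; rewrite !mxE. Qed.

Lemma co_norm j z : `|co j z| <= `|z|.
Proof.
rewrite /co; case: j.1; apply: le_trans (coord_le_norm _ _) _; [exact: norm_fst_le|exact: norm_snd_le].
Qed.

Lemma norm_co (z : P) (c : R) : 0 <= c -> (forall j, `|co j z| <= c) -> `|z| <= c.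
Proof.
move=> c0 h; rewrite prod_normE ge_max; apply/andP; split; apply: norm_le_coord => // i.
  exact: (h (true, i)).
exact: (h (false, i)).
Qed.

Lemma co_surj (f : bool * 'I_n -> R) : exists z, forall j, co j z = f j.
Proof.
exists (\row_i f (true, i), \row_i f (false, i)) => -[[] i]; by rewrite /co/= mxE.
Qed.

Lemma is_derive_co (F : R -> P) t (d : P) :
  is_derive t (1 : R) F d <-> forall j, is_derive t (1 : R) (fun s => co j (F s)) (co j d).
Proof.
split=> [/is_derive1_eps dF j|dF].
  apply/is_derive1_eps => e e0; have [r r0 hr] := dF e e0; exists r => // s sr.
  by have := hr s sr; apply: le_trans; rewrite -[_ *: co j d]coZ -!coB co_norm.
apply/is_derive1_eps => e e0.
have H j : exists r : R, 0 < r /\ forall s, `|s - t| < r ->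
    `|co j (F s) - co j (F t) - (s - t) *: co j d| <= e * `|s - t|.
  by have [r r0 hr] := (is_derive1_eps _ _ _).1 (dF j) e e0; exists r.
have [r hr] := boolp.choice H.
exists (\big[Num.min/1]_j r j); first by apply: lt_bigmin => // j _; have [] := hr j.
move=> s sr; apply: norm_co; first by rewrite mulr_ge0// ltW.
move=> j; rewrite !coB coZ; apply: (hr j).2; apply: lt_le_trans sr _.
exact: bigmin_le_cond.
Qed.

Lemma vector_primitive (g : R -> P) (z : P) : continuous g ->
  exists F : R -> P, F 0 = z /\ forall t, is_derive t (1 : R) F (g t).
Proof.
move=> cg; have H j : exists F : R -> R, F 0 = 0 /\ forall t, is_derive t (1 : R) F (co j (g t)).
  have [F F0 dF] : exists2 F : R -> R, F 0 = 0 & forall t, is_derive t (1 : R) F (co j (g t)).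
    apply: primitive; apply/cts_eps => t e e0; have [d d0 hd] := (cts_eps _).1 cg t e e0.
    by exists d => // s sd; apply: le_lt_trans (hd s sd); rewrite -coB co_norm.
  by exists F.
have [F hF] := boolp.choice H.
have H2 t : exists w, forall j, co j w = co j z + F j t by apply: co_surj.
have [V hV] := boolp.choice H2; exists V; split.
  apply/eqP; rewrite -subr_eq0 -normr_le0; apply: norm_co => // j.
  by rewrite coB hV (hF j).1 addr0 subrr normr0.
move=> t; apply/is_derive_co => j.
apply: (is_derive_ext (f := fun s => co j z + F j s)) => [s|]; first by rewrite hV.
by have := is_deriveD (is_derive_cst (co j z) t (1 : R)) ((hF j).2 t); rewrite add0r.
Qed.

Lemma lipschitz_curve (F : R -> P) (dF : R -> P) (M s t : R) : s <= t ->
  (forall r, s <= r <= t -> is_derive r (1 : R) F (dF r)) -> (forall r, s <= r <= t -> `|dF r| <= M) ->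
  `|F t - F s| <= M * (t - s).
Proof.
move=> st d h; have M0 : 0 <= M by apply: le_trans (h s _); rewrite ?lexx.
apply: norm_co => [|j]; first by rewrite mulr_ge0// subr_ge0.
rewrite coB; apply: (mvt_abs st (fun r hr => (is_derive_co _ _ _).1 (d r hr) j)) => r hr.
exact: le_trans (co_norm _ _) (h r hr).
Qed.

(** Integrating a bound of weight [expR (a * s)] gains a factor [1 / a]; this is the estimate behind
    Picard iteration in a weighted norm. *)
Lemma exp_growth_right (f df : R -> R) (a B t : R) : 0 <= B -> f 0 = 0 -> 0 <= t ->
  (forall s, is_derive s (1 : R) f (df s)) -> (forall s, 0 <= s -> df s <= B * a * expR (a * s)) ->
  f t <= B * expR (a * t).
Proof.
move=> B0 f0 t0 d h.
have dg (s : R) : is_derive s (1 : R) (fun s => f s - B * expR (a * s)) (df s - B * a * expR (a * s)).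
  have d1 : is_derive s (1 : R) (fun s => a * s) a by apply: is_derive_eq; exact: mulr1.
  have d2 : is_derive s (1 : R) (fun s => expR (a * s)) (expR (a * s) * a).
    exact: (is_derive1_comp (is_derive_expR (a * s)) d1).
  have := is_deriveB (d s) (is_deriveZ B d2).
  by rewrite (_ : B *: (expR (a * s) * a) = B * a * expR (a * s))// /GRing.scale/=; ring.
have := @mvt_le _ _ _ 0 t 0 t0 (fun s _ => dg s).
rewrite f0 mulr0 expR0 mulr1 mul0r => H.
have : f t - B * expR (a * t) - (0 - B) <= 0.
  by apply: H => s /andP[s0 _]; rewrite subr_le0; exact: h.
by move: B0; clear; lra.
Qed.

Lemma exp_growth_real (f df : R -> R) (a B : R) : 0 <= B -> f 0 = 0 ->
  (forall s, is_derive s (1 : R) f (df s)) -> (forall s, `|df s| <= B * a * expR (a * `|s|)) ->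
  forall t, `|f t| <= B * expR (a * `|t|).
Proof.
move=> B0 f0 dj dh t.
have key (g dg : R -> R) (s : R) : 0 <= s -> g 0 = 0 -> (forall s, is_derive s (1 : R) g (dg s)) ->
    (forall s, `|dg s| <= B * a * expR (a * `|s|)) -> `|g s| <= B * expR (a * s).
  move=> s0 g0 dg' hg; rewrite ler_norml lerNl; apply/andP; split.
    apply: (@exp_growth_right (fun s => - g s) (fun s => - dg s)) => //; first by rewrite g0 oppr0.
    by move=> r r0; have := lerNnormlW (hg r); rewrite (ger0_norm r0); move: (expR _) => E; clear; lra.
  apply: (@exp_growth_right g dg) => //.
  by move=> r r0; have := ler_normlW (hg r); rewrite (ger0_norm r0).
have [t0|t0] := leP 0 t; first by rewrite (ger0_norm t0); exact: (key f df t t0 f0 dj dh).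
rewrite (ltr0_norm t0).
have := key (fun s => f (- s)) (fun s => - df (- s)) (- t).
rewrite opprK oppr_ge0 (ltW t0) oppr0; apply => // s; last by rewrite normrN -[`|s|]normrN.
have dN : is_derive s (1 : R) (fun s => - s) (- 1 : R) by apply: is_derive_eq.
by have := is_derive1_comp (dj (- s)) dN; rewrite mulrN1.
Qed.

Lemma exp_growth (F : R -> P) (dF : R -> P) (a B : R) : 0 <= B -> F 0 = 0 ->
  (forall s, is_derive s (1 : R) F (dF s)) -> (forall s, `|dF s| <= B * a * expR (a * `|s|)) ->
  forall t, `|F t| <= B * expR (a * `|t|).
Proof.
move=> B0 F0 d h t; apply: norm_co => [|j]; first by rewrite mulr_ge0// expR_ge0.
apply: (@exp_growth_real (fun s => co j (F s)) (fun s => co j (dF s))) => //.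
- by rewrite F0 /co; case: j.1; rewrite mxE.
- by move=> s; exact: (is_derive_co _ _ _).1 (d s) j.
- by move=> s; apply: le_trans (co_norm _ _) (h s).
Qed.

(** Picard iteration, with distances measured against [expR (a * |t|)]. For [a = 2 L] it contracts
    by one half on the whole line at once. *)
Lemma ode_global (X : P -> P) (L M : R) (z : P) : 0 < L -> 0 < M ->
  (forall a b, `|X a - X b| <= L * `|a - b|) -> (forall a, `|X a| <= M) ->
  exists c : R -> P, c 0 = z /\ forall t, is_derive t (1 : R) c (X (c t)).
Proof.
move=> L0 M0 XL XM.
have cX : continuous X.
  apply/cts_eps => w e e0; exists (e / L); first by rewrite divr_gt0.
  by move=> y yw; apply: le_lt_trans (XL _ _) _; rewrite mulrC -ltr_pdivlMr.
(* The Picard map is made total by a default value, so that it can be chosen as a function; it is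
   only applied to the iterates, which are continuous, and to no other curve. *)
have HT g : exists F : R -> P, continuous g -> F 0 = z /\ forall t, is_derive t (1 : R) F (X (g t)).
  have [cg|ncg] := boolp.pselect (continuous g); last by exists (fun=> 0).
  by have [F hF] := vector_primitive z (cts_comp cX cg); exists F.
have [T hT] := boolp.choice HT.
pose c k := iter k T (fun=> z).
have cc k : continuous (c k).
  elim: k => [|k IH]; first exact: cts_cst.
  exact: is_derive1_cts (hT _ IH).2.
have c0 k : c k 0 = z by case: k => [//|k]; exact: (hT _ (cc k)).1.
have dc k t : is_derive t (1 : R) (c k.+1) (X (c k t)) := (hT _ (cc k)).2 t.
pose a := 2 * L; have a0 : 0 < a by rewrite mulr_gt0.
pose B := M / a; have B0 : 0 < B by rewrite divr_gt0.
have BaE : B * a = M by rewrite /B divfK// lt0r_neq0.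
have aE : a = 2 * L by [].
clearbody a B.
have half (k : nat) : 2 ^- k = 2 * 2 ^- k.+1 :> R by rewrite exprS; field; exact: lt0r_neq0 (exprn_gt0 _ _).
have p2 (k : nat) : 0 < 2 ^- k :> R by rewrite invr_gt0 exprn_gt0.
have step (k : nat) : forall t, `|c k.+1 t - c k t| <= 2 ^- k * B * expR (a * `|t|).
  elim: k => [|k IH].
    move=> t; rewrite expr0 invr1 mul1r.
    apply: (@exp_growth (fun t => c 1%N t - c 0%N t) (fun t => X (c 0%N t))) => //; first exact: ltW.
    + by rewrite !c0 subrr.
    + by move=> s; have := is_deriveB (dc 0%N s) (is_derive_cst z s (1 : R)); rewrite subr0.
    + move=> s; apply: le_trans (XM _) _; rewrite BaE; apply: ler_peMr; first exact: ltW.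
      by rewrite -[leLHS]expR0 ler_expR mulr_ge0// ltW.
  apply: (@exp_growth (fun t => c k.+2 t - c k.+1 t) (fun t => X (c k.+1 t) - X (c k t))).
  - by rewrite mulr_ge0// ltW.
  - by rewrite !c0 subrr.
  - move=> s; apply: le_trans (XL _ _) _.
    apply: le_trans (ler_wpM2l (ltW L0) (IH s)) _; rewrite half aE.
    by rewrite le_eqVlt; apply/orP; left; apply/eqP; ring.
have lim t : exists l, forall k : nat, `|c k t - l| <= 2 ^- k * (2 * B * expR (a * `|t|)).
  have s0 : 0 <= 2 * B * expR (a * `|t|) by rewrite mulr_ge0 ?expR_ge0// mulr_ge0// ltW.
  have H j : exists l : R, forall k : nat, `|co j (c k t) - l| <= 2 ^- k * (2 * B * expR (a * `|t|)).
    apply: (geometric_limit (a := fun k => co j (c k t)) s0) => k.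
    rewrite -coB; apply: le_trans (co_norm _ _) (le_trans (step k t) _).
    by rewrite half le_eqVlt; apply/orP; left; apply/eqP; ring.
  have [l hl] := boolp.choice H; have [w hw] := co_surj l; exists w => k.
  apply: norm_co => [|j]; first by rewrite mulr_ge0// ltW.
  by rewrite coB hw.
have [u hu] := boolp.choice lim.
have lip s t : s <= t -> `|u t - u s| <= M * (t - s).
  move=> st; apply: (@expn2_small _ _ _ (2 * B * expR (a * `|t|) + 2 * B * expR (a * `|s|))) => k.
  have h1 := hu t k; have h2 := hu s k.
  have h3 : `|c k t - c k s| <= M * (t - s).
    case: {h1 h2} k => [|k]; first by rewrite subrr normr0 mulr_ge0 ?subr_ge0// ltW.
    by apply: (lipschitz_curve st (fun r _ => dc k r)).
  apply: le_trans (ler_distD (c k t) _ _) _; rewrite distrC.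
  have := ler_distD (c k s) (c k t) (u s).
  by move: h1 h2 h3; rewrite mulrDr; clear; lra.
have cu : continuous u.
  apply/cts_eps => t e e0; exists (e / M); first by rewrite divr_gt0.
  move=> s; rewrite ltr_pdivlMr// mulrC; apply: le_lt_trans.
  have [st|/ltW ts] := leP s t.
    by rewrite distrC [X in M * X]distrC (ger0_norm (x := t - s)) ?subr_ge0//; exact: lip.
  by rewrite (ger0_norm (x := s - t)) ?subr_ge0//; exact: lip.
have [F [F0 dF]] := vector_primitive z (cts_comp cX cu).
(* The limit [u] is compared with the primitive [F] of [X] along [u]: the growth estimate bounds [F]
   minus the iterate of index [k + 1] by a multiple of [2 ^- k]. *)
suff uF : u = F by exists u; rewrite uF; split => // t; rewrite -{2}uF; exact: dF.
apply/funext => t; apply/eqP; rewrite -subr_eq0 -normr_le0.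
apply: (@expn2_small _ _ _ (3 * B * expR (a * `|t|))) => k; rewrite add0r.
have : `|F t - c k.+1 t| <= 2 ^- k * B * expR (a * `|t|).
  apply: (@exp_growth (fun t => F t - c k.+1 t) (fun t => X (u t) - X (c k t))).
  - by rewrite mulr_ge0// ltW.
  - by rewrite F0 c0 subrr.
  - move=> s; apply: le_trans (XL _ _) _; rewrite distrC.
    apply: le_trans (ler_wpM2l (ltW L0) (hu s k)) _; rewrite aE.
    by rewrite le_eqVlt; apply/orP; left; apply/eqP; ring.
have [E [EE E0]] : exists E, E = B * expR (a * `|t|) /\ 0 <= 2 ^- k.+1 * E.
  by exists (B * expR (a * `|t|)); split => //; rewrite mulr_ge0 ?(ltW (p2 _))// mulr_ge0 ?expR_ge0// ltW.
have := hu t k.+1; have := ler_distD (c k.+1 t) (u t) (F t).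
rewrite [`|u t - c _ _|]distrC [`|c _ _ - F t|]distrC -!(mulrA _ B) -EE (half k).
by move: E0; clear; lra.
Qed.

End ODE.

(** * Existence of Hamiltonian curves for all times *)

Section HamiltonianCurves.
Context {R : realType} {n : nat}.
Notation P := ('rV[R]_n * 'rV[R]_n)%type.
Implicit Types (K : P -> R).

Lemma Dx_coord K z i : Dx K z 0 i = 'D_(bas1 i) K z.
Proof. by rewrite mxE derive_partial_fst -surjective_pairing. Qed.

Lemma Dp_coord K z i : Dp K z 0 i = 'D_(bas2 i) K z.
Proof. by rewrite mxE derive_partial_snd -surjective_pairing. Qed.

Lemma derive_Dx_Dp K z w : C1 K -> 'D_w K z = dotp (Dx K z) w.1 + dotp (Dp K z) w.2.
Proof.
move=> cK; have dK := C1_differentiable z cK.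
rewrite {1}[w]pair_decomp deriveDdir// !derive_sumdir//.
by congr (_ + _); apply: eq_bigr => i _; rewrite (deriveZdir _ _ dK) ?Dx_coord ?Dp_coord mulrC.
Qed.

Lemma is_derive_curve (V W : normedModType R) (f : V -> W) (c : R -> V) t d : C1 f -> is_derive t (1 : R) c d ->
  is_derive t (1 : R) (fun s => f (c s)) ('D_d f (c t)).
Proof.
move=> cf dc; have df := C1_differentiable (c t) cf.
have dct : differentiable c t by apply/derivable1_diffP; case: dc.
have dfc : differentiable (fun s => f (c s)) t by exact: (differentiable_comp dct df).
apply: DeriveDef; first exact: diff_derivable.
rewrite (deriveE _ dfc) (diff_comp dct df)/= (deriveE _ df); congr ('d f _ _).
by rewrite -(deriveE _ dct); case: dc.
Qed.

Lemma co_ham_field K j z : co j (ham_field K z) = if j.1 then 'D_(bas2 j.2) K z else - 'D_(bas1 j.2) K z.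
Proof.
case: j => -[] i; rewrite /co/=; first exact: Dp_coord.
by rewrite -Dx_coord /= -[X in _ = - X]/(Dx K z 0 i); move: (Dx K z) => v; rewrite mxE.
Qed.

Lemma ham_field_slab K (M : R) : C2 K -> x_periodic K -> exists2 L : R, 0 < L &
  forall z w : P, `|z.2| <= M -> `|w.2| <= M ->
    `|ham_field K z| <= L /\ `|ham_field K z - ham_field K w| <= L * `|z - w|.
Proof.
move=> cK pK.
have H (j : bool * 'I_n) : exists L : R, 0 < L /\ forall z w : P, `|z.2| <= M -> `|w.2| <= M ->
    `|co j (ham_field K z)| <= L /\ `|co j (ham_field K z) - co j (ham_field K w)| <= L * `|z - w|.
  have key (v : P) : exists L : R, 0 < L /\ forall z w : P, `|z.2| <= M -> `|w.2| <= M ->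
      `|'D_v K z| <= L /\ `|'D_v K z - 'D_v K w| <= L * `|z - w|.
    have [B B0 hB] := slab_bounded M (C1_Dcts (v := v) (C2_C1 cK)) (x_periodic_derive v pK).
    have [L L0 hL] := C1_slab_lip M (C2_D v cK) (x_periodic_derive v pK).
    exists (B + L); split; first exact: addr_gt0.
    move=> z w zM wM; split; first by apply: le_trans (hB z zM) _; rewrite lerDl ltW.
    by apply: le_trans (hL w z wM zM) _; rewrite ler_wpM2r// lerDr ltW.
  case: j => -[] i.
    have [L [L0 hL]] := key (bas2 i); exists L; split => // z w zM wM.
    by rewrite !co_ham_field; exact: hL.
  have [L [L0 hL]] := key (bas1 i); exists L; split => // z w zM wM.
  by rewrite !co_ham_field/= -opprD !normrN; exact: hL.
have [L hL] := boolp.choice H.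
have L0 : 0 <= \sum_j L j by apply: sumr_ge0 => j _; exact: ltW (hL j).1.
exists (1 + \sum_j L j); first by rewrite ltr_wpDr.
have LS j : L j <= 1 + \sum_j L j.
  by rewrite (bigD1 j)//= addrCA lerDl addr_ge0// sumr_ge0// => i _; exact: ltW (hL i).1.
move=> z w zM wM; split; apply: norm_co => [|j].
- by rewrite addr_ge0.
- exact: le_trans ((hL j).2 z w zM wM).1 (LS j).
- by rewrite mulr_ge0// addr_ge0.
rewrite coB; apply: le_trans ((hL j).2 z w zM wM).2 _.
by rewrite ler_wpM2r.
Qed.

Lemma ham_field_tangent K z : C1 K -> 'D_(ham_field K z) K z = 0.
Proof. by move=> cK; rewrite derive_Dx_Dp// dotpNr dotpC addrN. Qed.

Lemma constant_of_derive_zero (f : R -> R) : (forall t, is_derive t (1 : R) f 0) -> forall t, f t = f 0.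
Proof.
move=> df t; apply: (@derive_zero_eq _ f (- `|t| - 1)) => //.
  by have := ler_norm (- t); rewrite normrN; clear; lra.
Qed.

(* The field is cut off away from the energy level of [z]; the curve of the truncated field
   stays in this level, where the truncation is the identity. *)
Lemma ham_curve_exists K (z : P) : C2 K -> x_periodic K ->
  (exists M : R, forall w, `|K w - K z| <= 1 -> `|w.2| <= M) ->
  exists c : R -> P, c 0 = z /\ forall t, is_derive t (1 : R) c (ham_field K (c t)).
Proof.
move=> cK pK [M hM].
have [L L0 hL] := ham_field_slab (M + 1) cK pK.
have [A A0 hA] := C1_slab_lip (M + 1) (C2_C1 cK) pK.
(* The cutoff depends on the energy rather than on the momentum: the truncated field remains tangent
   to the energy levels, so the cutoff is constant along its curves. *)
pose chi w := Num.max 0 (1 - `|K w - K z|).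
have chi0 w : 0 <= chi w by rewrite le_max lexx.
have chi1 w : chi w <= 1 by rewrite ge_max ler01/= gerBl.
have chiL w w' : `|chi w - chi w'| <= `|K w - K w'|.
  have h1 := ler_distD (K w') (K w) (K z); have h2 := ler_distD (K w) (K w') (K z).
  rewrite /chi; move: h1 h2.
  rewrite [`|K w' - K w|]distrC; move: `|K w - K w'| `|K w - K z| `|K w' - K z| => x1 x2 x3; clear.
  by case: (lerP 0 (1 - x2)) => k2; case: (lerP 0 (1 - x3)) => k3 h1 h2; rewrite ler_norml; apply/andP; split; lra.
pose X w := chi w *: ham_field K w.
have X0 w : M < `|w.2| -> X w = 0.
  move=> wM; have h : 1 < `|K w - K z| by rewrite ltNge; apply/negP => /hM; rewrite leNgt wM.
  by rewrite /X (_ : chi w = 0) ?scale0r//; apply/max_idPl; rewrite subr_le0 ltW.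
have XB w : `|X w| <= L.
  have [wM|/X0 ->] := leP `|w.2| M; last by rewrite normr0 ltW.
  rewrite normrZ (ger0_norm (chi0 w)) -[leRHS]mul1r; apply: ler_pM => //.
  have wM1 : `|w.2| <= M + 1 by apply: le_trans wM _; rewrite lerDl.
  exact: (hL w w wM1 wM1).1.
have inner w w' : `|w.2| <= M + 1 -> `|w'.2| <= M + 1 -> `|X w - X w'| <= (A * L + L) * `|w - w'|.
  move=> wM wM'; have [h1 h2] := hL w w' wM wM'.
  have -> : X w - X w' = (chi w - chi w') *: ham_field K w + chi w' *: (ham_field K w - ham_field K w').
    by rewrite scalerBl scalerBr addrA subrK.
  apply: le_trans (ler_normD _ _) _; rewrite !normrZ (ger0_norm (chi0 w')) mulrDl; apply: lerD.
    rewrite mulrAC; apply: ler_pM => //; apply: le_trans (chiL w w') _.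
    by rewrite distrC [`|w - w'|]distrC; exact: hA.
  by rewrite -[leRHS]mul1r; apply: ler_pM.
(* [X] vanishes beyond [M]. Across the margin of width 1 up to [M + 1], its bound [L] serves as a
   Lipschitz constant. *)
have outer w w' : M + 1 < `|w'.2| -> `|X w - X w'| <= L * `|w - w'|.
  move=> wM'; rewrite (X0 w') ?subr0; last by apply: le_lt_trans wM'; rewrite lerDl.
  have [wM|/X0 ->] := leP `|w.2| M; last by rewrite normr0 mulr_ge0// ltW.
  apply: le_trans (XB w) _; rewrite ler_peMr ?(ltW L0)//.
  have h1 : `|w'.2 - w.2| <= `|w - w'| by rewrite distrC; exact: (norm_snd_le (w - w')).
  have h2 : `|w'.2| <= `|w'.2 - w.2| + `|w.2| by rewrite -{1}(subrK w.2 w'.2) ler_normD.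
  by move: wM wM' h1 h2; clear; lra.
have XL w w' : `|X w - X w'| <= (A * L + L) * `|w - w'|.
  have AL : 0 <= A * L * `|w - w'| by rewrite mulr_ge0// mulr_ge0// ltW.
  have [wM|wM] := leP `|w.2| (M + 1); last first.
    rewrite distrC; apply: le_trans (outer w' w wM) _; rewrite mulrDl [`|w' - w|]distrC.
    by rewrite lerDr.
  have [wM'|wM'] := leP `|w'.2| (M + 1); first exact: inner.
  by apply: le_trans (outer w w' wM') _; rewrite mulrDl lerDr.
have AL0 : 0 < A * L + L by rewrite addr_gt0// mulr_gt0.
have [c [c0 dc]] := ode_global z AL0 L0 XL XB; exists c; split => // t.
have Kc s : K (c s) = K z.
  rewrite -[in RHS]c0; apply: (constant_of_derive_zero (f := fun s => K (c s))) => r.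
  have := is_derive_curve (C2_C1 cK) (dc r).
  rewrite /X (deriveZdir _ _ (C1_differentiable _ (C2_C1 cK))) ham_field_tangent ?scaler0//.
  exact: C2_C1.
have := dc t; rewrite /X (_ : chi (c t) = 1) ?scale1r//.
by rewrite /chi Kc subrr normr0 subr0; apply/max_idPr.
Qed.

Lemma ham_curve_energy K (c : R -> P) : C1 K -> (forall t, is_derive t (1 : R) c (ham_field K (c t))) ->
  forall t, K (c t) = K (c 0).
Proof.
move=> cK dc; apply: (constant_of_derive_zero (f := fun s => K (c s))) => r.
by have := is_derive_curve cK (dc r); rewrite ham_field_tangent.
Qed.

(** The choice in [flow] depends on the starting point but not on the time, so one curve is followed
    throughout and existence is enough to know its properties. *)
Lemma flow_curve (V : normedModType R) (X : V -> V) (z : V) :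
  (exists c : R -> V, c 0 = z /\ forall t, is_derive t (1 : R) c (X (c t))) ->
  flow X 0 z = z /\ forall t, is_derive t (1 : R) (flow X ^~ z) (X (flow X t z)).
Proof. by move=> ex; have := getPex ex. Qed.

End HamiltonianCurves.

(** * Distance of a Hamiltonian curve to a graph of constant energy *)

Section InvariantGraph.
Context {R : realType} {n : nat}.
Notation P := ('rV[R]_n * 'rV[R]_n)%type.
Implicit Types (K : P -> R) (w : 'rV[R]_n -> R).

Lemma C2N (V W : normedModType R) (f : V -> W) : C2 f -> C2 (fun z => - f z).
Proof.
move=> cf; split; first by apply: C1N; exact: C2_C1.
move=> v; rewrite (_ : 'D_v (fun z => - f z) = fun z => - 'D_v f z); first by apply: C1N; exact: C2_D.
by apply/funext => z; apply: deriveN; apply: diff_derivable; apply: C1_differentiable; exact: C2_C1.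
Qed.

Lemma ham_fieldN K z : C1 K -> ham_field (fun z => - K z) z = - ham_field K z.
Proof.
move=> cK; apply/eqP; rewrite -subr_eq0 -normr_le0; apply: norm_co => // j; rewrite coB.
have -> : co j (- ham_field K z) = - co j (ham_field K z) by rewrite -scaleN1r coZ mulN1r.
rewrite !co_ham_field !deriveN; first by case: j.1; rewrite subrr normr0.
all: by apply: diff_derivable; exact: C1_differentiable.
Qed.

Lemma derive_grad w x v : C1 w -> 'D_v w x = dotp (grad w x) v.
Proof.
move=> cw; have dw := C1_differentiable x cw.
rewrite {1}(row_sum_delta v) derive_sumdir//; apply: eq_bigr => i _.
by rewrite (deriveZdir _ _ dw) mxE mulrC.
Qed.

Lemma is_derive_fst (V W : normedModType R) (c : R -> V * W) t d : is_derive t (1 : R) c d ->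
  is_derive t (1 : R) (fun s => (c s).1) d.1.
Proof.
move=> /is_derive1_eps dc; apply/is_derive1_eps => e e0; have [r r0 hr] := dc e e0; exists r => // s sr.
by apply: le_trans (hr s sr); rewrite prod_normE le_max lexx.
Qed.

Lemma is_derive_snd (V W : normedModType R) (c : R -> V * W) t d : is_derive t (1 : R) c d ->
  is_derive t (1 : R) (fun s => (c s).2) d.2.
Proof.
move=> /is_derive1_eps dc; apply/is_derive1_eps => e e0; have [r r0 hr] := dc e e0; exists r => // s sr.
by apply: le_trans (hr s sr); rewrite prod_normE le_max lexx orbT.
Qed.

Lemma is_derive_coord (c : R -> 'rV[R]_n) t d i : is_derive t (1 : R) c d ->
  is_derive t (1 : R) (fun s => c s 0 i) (d 0 i).
Proof.
move=> /is_derive1_eps dc; apply/is_derive1_eps => e e0; have [r r0 hr] := dc e e0; exists r => // s sr.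
by apply: le_trans (hr s sr); have := coord_le_norm (c s - c t - (s - t) *: d) i; rewrite !mxE.
Qed.

(* The differential of [w] need not be differentiable along the curve: difference quotients
   of [w] in space are differentiated in time instead, and compared by means of the increments
   of [K (x, grad w x) = c0]. *)
Lemma graph_defect K w (c0 M : R) : C2 K -> x_periodic K -> C11 w ->
  (forall x, K (x, grad w x) = c0) -> (forall x, `|grad w x| <= M) ->
  exists2 C : R, 0 < C & forall (c : R -> P),
    (forall t, is_derive t (1 : R) c (ham_field K (c t))) -> (forall t, `|(c t).2| <= M) ->
    forall t1 t2 S, t1 <= t2 -> (forall t, t1 <= t <= t2 -> `|(c t).2 - grad w (c t).1| <= S) ->
      `|((c t2).2 - grad w (c t2).1) - ((c t1).2 - grad w (c t1).1)| <= C * S * (t2 - t1).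
Proof.
move=> cK pK [cw /lipschitz_onE[Lg Lg0 hg]] Kc gM.
have {}hg x y : `|grad w x - grad w y| <= Lg * `|x - y| by exact: hg.
have [L L0 hL] := ham_field_slab M cK pK.
have [T T0 hT] := C2_taylor_slab M cK pK.
pose C := n%:R * Lg * L + L; have C0 : 0 < C by rewrite ltr_wpDl// mulr_ge0 ?(ltW L0)// mulr_ge0// ltW.
pose C2 := T * (1 + Lg) ^+ 2.
have CE : C = n%:R * Lg * L + L by [].
have C2E : C2 = T * (1 + Lg) ^+ 2 by [].
clearbody C C2; exists C => // c dc cM t1 t2 S t12 hS.
have S0 : 0 <= S by apply: le_trans (hS t1 _); rewrite ?lexx.
apply: norm_le_coord => [|i]; first by rewrite mulr_ge0 ?subr_ge0// mulr_ge0// ltW.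
(* A difference quotient of [w] stands for its partial derivative, with an error of order [h]. *)
have defect (h : R) x : 0 < h -> `|w (x + h *: delta_mx 0 i) - w x - h * grad w x 0 i| <= Lg * h ^+ 2.
  move=> h0; have [s /andP[s0 s1]] := C1_mvt_segment x (h *: delta_mx 0 i) cw.
  rewrite derive_grad// dotpZr dotp_delta => ->; rewrite -mulrBr normrM (gtr0_norm h0) expr2 mulrCA.
  rewrite ler_wpM2l ?(ltW h0)//.
  have := coord_le_norm (grad w (x + s *: (h *: delta_mx 0 i)) - grad w x) i; rewrite mxE [X in _ + X]mxE => /le_trans; apply.
  apply: le_trans (hg _ _) _; rewrite ler_wpM2l ?(ltW Lg0)// addrAC subrr add0r !normrZ.
  rewrite (ger0_norm s0) (gtr0_norm h0) mulrCA ler_piMr ?(ltW h0)//.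
  by rewrite mulr_ile1// norm_delta.
pose r t := (c t).2 - grad w (c t).1.
rewrite -/(r t2) -/(r t1).
(* The energy is equal at the graph points over [x] and [x + h e_i], so Taylor's formula makes this
   combination of order [h^2] on the graph; evaluating it on the curve instead costs [h C S]. *)
have bnd (h t : R) : 0 < h -> t1 <= t <= t2 ->
    `|dotp (grad w ((c t).1 + h *: delta_mx 0 i) - grad w (c t).1) (Dp K (c t)) + h * Dx K (c t) 0 i| <= h * (C * S + C2 * h).
  move=> h0 t12'; set x := (c t).1; set p := (c t).2.
  set a := grad w _ - grad w x.
  have hd : `|h *: delta_mx 0 i : 'rV[R]_n| <= h.
    by rewrite normrZ (gtr0_norm h0) ler_piMr ?(ltW h0)// norm_delta.
  have aL : `|a| <= Lg * h.
    apply: le_trans (hg _ _) _; rewrite addrAC subrr add0r.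
    by apply: ler_wpM2l; first exact: ltW.
  pose z : P := (x, grad w x); pose z' : P := (x + h *: delta_mx 0 i, grad w (x + h *: delta_mx 0 i)).
  have zE : z' - z = (h *: delta_mx 0 i, a).
    by rewrite -[z' - z]/(x + h *: delta_mx 0 i - x, a) addrAC subrr add0r.
  have := hT z z' (gM _) (gM _); rewrite zE derive_Dx_Dp; last exact: C2_C1.
  rewrite !Kc subrr sub0r normrN /= dotpZr dotp_delta => hE.
  have nE : `|((h *: delta_mx 0 i, a) : P)| <= (1 + Lg) * h.
    by apply: le_trans (norm_pair_le _ _) _; rewrite mulrDl mul1r lerD.
  have hE' : `|h * Dx K z 0 i + dotp (Dp K z) a| <= C2 * h ^+ 2.
    have q0 : 0 <= (1 + Lg) * h by exact: mulr_ge0 (addr_ge0 ler01 (ltW Lg0)) (ltW h0).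
    apply: le_trans hE _; rewrite C2E -mulrA -exprMn; apply: ler_wpM2l; first exact: ltW.
    by rewrite ler_pXn2r ?nnegrE.
  have [_ hX] := hL (c t) z (cM t) (gM _).
  have cz : `|c t - z| <= S.
    have -> : c t - z = (0, r t) by rewrite [c t]surjective_pairing -[LHS]/(x - x, p - grad w x) subrr.
    by apply: le_trans (norm_pair_le _ _) _; rewrite normr0 add0r; exact: hS.
  have hX' : `|ham_field K (c t) - ham_field K z| <= L * S by apply: le_trans hX _; rewrite ler_wpM2l// ltW.
  have hp : `|Dp K (c t) - Dp K z| <= L * S by apply: le_trans hX'; exact: (norm_fst_le (ham_field K (c t) - ham_field K z)).
  have hx : `|Dx K (c t) 0 i - Dx K z 0 i| <= L * S.
    have := norm_snd_le (ham_field K (c t) - ham_field K z).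
    rewrite -[(_ - _).2]/(- Dx K (c t) - - Dx K z) -opprD normrN => h1.
    have h2 := coord_le_norm (Dx K (c t) - Dx K z) i.
    have := le_trans h2 (le_trans h1 hX').
    by move: (Dx K (c t)) (Dx K z) => v1 v2; rewrite !mxE.
  have -> : dotp a (Dp K (c t)) + h * Dx K (c t) 0 i =
      dotp a (Dp K (c t) - Dp K z) + h * (Dx K (c t) 0 i - Dx K z 0 i) + (h * Dx K z 0 i + dotp (Dp K z) a).
    by rewrite dotpDr dotpNr (dotpC (Dp K z)) mulrBr; move: (dotp a _) (dotp a _) (h * _) (h * _); clear; move=> *; ring.
  apply: le_trans (ler_normD _ _) _.
  have k1 : `|dotp a (Dp K (c t) - Dp K z)| <= n%:R * (Lg * h * (L * S)).
    apply: le_trans (dotp_le_norm _ _) _; rewrite ler_wpM2l//; exact: ler_pM.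
  have k2 : `|h * (Dx K (c t) 0 i - Dx K z 0 i)| <= h * (L * S).
    by rewrite normrM (gtr0_norm h0) ler_wpM2l// ltW.
  apply: le_trans (lerD (le_trans (ler_normD _ _) (lerD k1 k2)) hE') _.
  by rewrite CE le_eqVlt; apply/orP; left; apply/eqP; ring.
(* After division by [h], the errors of the difference quotient and of Taylor's formula disappear as
   [h] tends to 0. *)
apply: (@le_small _ _ _ (C2 * (t2 - t1) + 2 * Lg) 1) => // h h0 _.
pose Psi t := w ((c t).1 + h *: delta_mx 0 i) - w (c t).1 - h * (c t).2 0 i.
have dPsi t : is_derive t (1 : R) Psi
    (dotp (grad w ((c t).1 + h *: delta_mx 0 i) - grad w (c t).1) (Dp K (c t)) + h * Dx K (c t) 0 i).
  have d1 := is_derive_fst (dc t); have d2 := is_derive_coord i (is_derive_snd (dc t)).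
  have d3 := is_deriveD d1 (is_derive_cst (h *: delta_mx 0 i : 'rV[R]_n) t (1 : R)).
  rewrite addr0 in d3.
  have := is_deriveB (is_deriveB (is_derive_curve cw d3) (is_derive_curve cw d1)) (is_deriveZ h d2).
  rewrite !derive_grad// dotpDl dotpNl /=.
  rewrite (_ : h *: (- Dx K (c t)) 0 i = - (h * Dx K (c t) 0 i)) ?opprK; first exact.
  by move: (Dx K (c t)) => v; rewrite mxE -[LHS]/(h * _) mulrN.
have := mvt_abs t12 (fun t _ => dPsi t) (fun t ht => bnd h t h0 ht).
have := defect h (c t1).1 h0; have := defect h (c t2).1 h0.
have -> : (r t2 - r t1) 0 i = ((c t2).2 0 i - grad w (c t2).1 0 i) - ((c t1).2 0 i - grad w (c t1).1 0 i).
  by rewrite /r; move: (grad w _) (grad w _) => g1 g2; rewrite !mxE.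
rewrite /Psi.
move: (w _) (w _) (w _) (w _) (grad w _ 0 i) (grad w _ 0 i) ((c t2).2 0 i) ((c t1).2 0 i).
move=> a1 a2 a3 a4 g1 g2 p1 p2 h1 h2 h3.
rewrite -(ler_pM2l h0) -{1}(gtr0_norm h0) -normrM.
move: h1 h2 h3; rewrite ![`|_| <= _]ler_norml => /andP[h1 h1'] /andP[h2 h2'] /andP[h3 h3'].
apply/andP; move: h1 h1' h2 h2' h3 h3'; clear; split; nra.
Qed.

End InvariantGraph.

(** * Constant energy on a graph and its invariance *)

Section GraphEnergy.
Context {R : realType} {n : nat}.
Notation P := ('rV[R]_n * 'rV[R]_n)%type.
Implicit Types (K : P -> R) (w : 'rV[R]_n -> R).

Lemma lipschitz_cts (V W : normedModType R) (f : V -> W) (k : R) : 0 < k ->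
  (forall x y, `|f x - f y| <= k * `|x - y|) -> continuous f.
Proof.
move=> k0 h; apply/cts_eps => z e e0; exists (e / k); first by rewrite divr_gt0.
by move=> y yz; apply: le_lt_trans (h _ _) _; rewrite mulrC -ltr_pdivlMr.
Qed.

Lemma C11_grad_cts w : C11 w -> continuous (grad w).
Proof.
move=> [_ /lipschitz_onE[k k0 h]]; apply: (lipschitz_cts k0) => x y; exact: h.
Qed.

Lemma C11_grad_bounded w : C11 w -> Zn_periodic w -> exists2 M : R, 0 < M & forall x, `|grad w x| <= M.
Proof.
move=> cw pw; have [M M0 hM] := bounded_on_compact (@compact_cball R n 1) (C11_grad_cts cw).
exists M => // x; have [k hk] := reduce_mod_Zn x.
have <- : grad w (x + map_mx intr k) = grad w x; last exact: hM.
apply/rowP => i; rewrite !mxE; apply: derive_eq_line => h.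
by rewrite addrA pw.
Qed.

(** A discrete Gronwall argument: on an interval of length [1 / (2 C)] that starts on the graph,
    [graph_defect] bounds the maximal defect by half of itself. *)
Lemma graph_forward K w (c0 M : R) (c : R -> P) : C2 K -> x_periodic K -> C11 w ->
  (forall x, K (x, grad w x) = c0) -> (forall x, `|grad w x| <= M) ->
  (forall t, is_derive t (1 : R) c (ham_field K (c t))) -> (forall t, `|(c t).2| <= M) ->
  (c 0).2 = grad w (c 0).1 -> forall t, 0 <= t -> (c t).2 = grad w (c t).1.
Proof.
move=> cK pK cw Kc gM dc cM r0.
have [C C0 hC] := graph_defect cK pK cw Kc gM.
pose r t := (c t).2 - grad w (c t).1.
have cc : continuous c by exact: is_derive1_cts dc.
have cr : continuous (fun t => `|r t|).
  apply: cts_norm; apply: ctsB; first exact: cts_snd.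
  by apply: (cts_comp (C11_grad_cts cw)); exact: cts_fst.
pose tau := (2 * C)^-1; have tau0 : 0 < tau by rewrite invr_gt0 mulr_gt0.
have tauE : C * tau = 2^-1 by rewrite /tau; field; exact: lt0r_neq0.
clearbody tau.
have step (t0 : R) : r t0 = 0 -> forall t, t0 <= t <= t0 + tau -> r t = 0.
  move=> rt0.
  have [|m /= mI hm] := max_compact _ (@compact_itv_le R t0 (t0 + tau)) cr.
    by exists t0; rewrite /= lexx lerDl ltW.
  have [m1 m2] := andP mI.
  have := hC c dc cM t0 m `|r m| m1; rewrite -/(r m) -/(r t0) rt0 subr0 => H.
  have h1 : `|r m| <= C * `|r m| * (m - t0).
    by apply: H => t /andP[t1 t2]; apply: hm; rewrite /= t1 (le_trans t2).
  have h2 : C * `|r m| * (m - t0) <= C * `|r m| * tau.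
    rewrite ler_wpM2l ?mulr_ge0 ?(ltW C0)//; move: m2; clear; lra.
  have h3 : C * `|r m| * tau = `|r m| / 2 by rewrite mulrAC tauE mulrC.
  have h4 : `|r m| <= 0 by move: h1 h2 h3; clear; lra.
  by move=> t tI; apply/eqP; rewrite -normr_le0; apply: le_trans h4; exact: hm.
have all_steps (k : nat) : forall t : R, 0 <= t -> t <= k%:R * tau -> r t = 0.
  elim: k => [t t0|k IH t t0 tk].
    by rewrite mul0r => t1; rewrite (_ : t = 0) ?/r ?r0 ?subrr//; apply/eqP; rewrite eq_le t1.
  have [tk'|tk'] := leP t (k%:R * tau); first exact: IH.
  apply: (step (k%:R * tau)).
    by apply: IH => //; rewrite mulr_ge0// ltW.
  by rewrite (ltW tk')/=; move: tk; rewrite -natr1 mulrDl mul1r.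
move=> t t0; apply/eqP; rewrite -subr_eq0; apply/eqP.
have tt : 0 <= t / tau by rewrite divr_ge0// ltW.
apply: (all_steps (Num.bound (t / tau)) t t0).
by rewrite -ler_pdivrMr//; apply/ltW/archi_boundP.
Qed.

(** Conservation of energy bounds the momentum along the curve. Negative times are reduced to
    positive ones by passing to [- K], whose curves are the reversed ones. *)
Lemma graph_invariant K w (c0 : R) : C2 K -> x_periodic K ->
  (exists M : R, forall z, `|K z - c0| <= 1 -> `|z.2| <= M) ->
  C11 w -> (forall x, K (x, grad w x) = c0) -> flow_invariant (ham_field K) (grad_graph w).
Proof.
move=> cK pK [M hM] cw Kc t _ [z [x _ <-] <-].
have [f0 df] : flow (ham_field K) 0 (x, grad w x) = (x, grad w x) /\
    forall s, is_derive s (1 : R) (flow (ham_field K) ^~ (x, grad w x)) (ham_field K (flow (ham_field K) s (x, grad w x))).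
  by apply: flow_curve; apply: ham_curve_exists => //; exists M => y; rewrite Kc; exact: hM.
set c := flow (ham_field K) ^~ (x, grad w x).
have gM y : `|grad w y| <= M by apply: (hM (y, grad w y)); rewrite Kc subrr normr0.
have cM s : `|(c s).2| <= M.
  apply: hM; rewrite (ham_curve_energy (C2_C1 cK) df) -/(c 0) /c f0 Kc subrr normr0//.
have g0 : (c 0).2 = grad w (c 0).1 by rewrite /c f0.
suff g : (c t).2 = grad w (c t).1 by exists (c t).1 => //; rewrite -g -surjective_pairing.
have [t0|t0] := leP 0 t; first exact: (graph_forward cK pK cw Kc gM df cM g0).
have dN (s : R) : is_derive s (1 : R) (fun s => - s) (- 1 : R) by apply: is_derive_eq.
have dc' (s : R) : is_derive s (1 : R) (fun s => c (- s)) (ham_field (fun z => - K z) (c (- s))).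
  rewrite ham_fieldN; last exact: C2_C1.
  apply/is_derive1_eps => e e0; have [d d0 hd] := (is_derive1_eps _ _ _).1 (df (- s)) e e0.
  exists d => // r rs; have e1 : - r - - s = - (r - s) by rewrite opprB addrC opprK.
  by have := hd (- r); rewrite e1 normrN scaleNr scalerN; exact.
have Kc' y : (fun z => - K z) (y, grad w y) = - c0 by rewrite /= Kc.
have pK' : x_periodic (fun z => - K z) by move=> p y k; rewrite /= pK.
have := graph_forward (c := fun s => c (- s)) (C2N cK) pK' cw Kc' gM dc' (fun s => cM (- s)) _ (t := - t).
by rewrite !opprK oppr0 oppr_ge0 (ltW t0); apply.
Qed.

Lemma is_derive_dotp (p q : R -> 'rV[R]_n) t dp dq :
  is_derive t (1 : R) p dp -> is_derive t (1 : R) q dq ->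
  is_derive t (1 : R) (fun s => dotp (p s) (q s)) (dotp dp (q t) + dotp (p t) dq).
Proof.
move=> hp hq; rewrite (_ : (fun s => _) = \sum_i (fun s => p s 0 i * q s 0 i)); last first.
  by apply/funext => s; rewrite fct_sumE.
rewrite /dotp -big_split/=; apply: is_derive_sum => i.
have := is_deriveM (is_derive_coord i hp) (is_derive_coord i hq).
by rewrite /GRing.scale/= addrC [q t 0 i * _]mulrC.
Qed.

(** A quadratic bound on increments makes the derivative vanish along every segment. *)
Lemma quadratic_increment_constant (V : normedModType R) (F : V -> R) (C : R) :
  (forall x y, `|F y - F x| <= C * `|y - x| ^+ 2) -> forall x y, F x = F y.
Proof.
move=> h x y.
have df (z v : V) : is_derive z v F 0.
  apply/is_derive_eps => e e0; pose k := `|C| * `|v| ^+ 2.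
  have k0 : 0 <= k by rewrite mulr_ge0// sqr_ge0.
  exists (e / (k + 1)); first by rewrite divr_gt0// ltr_wpDl.
  move=> r; rewrite ltr_pdivlMr ?ltr_wpDl// => rk.
  rewrite scaler0 subr0; apply: le_trans (h _ _) _; rewrite addrAC subrr add0r normrZ exprMn.
  have h1 : C * (`|r| ^+ 2 * `|v| ^+ 2) <= `|C| * (`|r| ^+ 2 * `|v| ^+ 2).
    by rewrite ler_wpM2r ?ler_norm// mulr_ge0// sqr_ge0.
  apply: le_trans h1 _.
  have -> : `|C| * (`|r| ^+ 2 * `|v| ^+ 2) = `|r| * k * `|r| by rewrite /k; ring.
  rewrite ler_wpM2r//; have : `|r| * k <= `|r| * (k + 1) by rewrite ler_wpM2l// lerDl.
  by move: rk; clear; lra.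
have dl (t : R) : is_derive t (1 : R) (fun t => F (x + t *: (y - x))) 0.
  exact: (is_derive_line F x (y - x) t 0).1.
have := @derive_zero_eq _ (fun t => F (x + t *: (y - x))) (- 1) (fun t _ => dl t) 0 1.
by rewrite scale0r addr0 scale1r subrKC; apply; rewrite ?oppr_lt0// ltrN10.
Qed.

(* Comparing the action of [w] along two curves on the graph: the energy gap is integrated
   along them, while the other terms are quadratic in their distance. *)
Lemma graph_energy_constant K w : C2 K -> x_periodic K -> C11 w -> Zn_periodic w ->
  (forall x, exists c : R -> P, [/\ c 0 = (x, grad w x),
     forall t, is_derive t (1 : R) c (ham_field K (c t)) & forall t, (c t).2 = grad w (c t).1]) ->
  forall x y, K (x, grad w x) = K (y, grad w y).
Proof.
move=> cK pK cw pw curves.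
have [M M0 gM] := C11_grad_bounded cw pw.
have [cw1 /lipschitz_onE[Lg Lg0 hg]] := cw.
have {}hg x y : `|grad w x - grad w y| <= Lg * `|x - y| by exact: hg.
have [L L0 hL] := ham_field_slab M cK pK.
have [T T0 hT] := C2_taylor_slab M cK pK.
(* With [L * tau = 1/2], the distance between two curves at most doubles over this time. *)
pose tau := (2 * L)^-1; have tau0 : 0 < tau by rewrite invr_gt0 mulr_gt0.
have tauE : L * tau = 2^-1 by rewrite /tau; field; exact: lt0r_neq0.
clearbody tau.
have [A AE] : exists A : R, A = (2 * (1 + Lg)) ^+ 2 by exists ((2 * (1 + Lg)) ^+ 2).
pose C1 := (n%:R * L + T) * A; pose C3 := n%:R * Lg * A.
apply: (@quadratic_increment_constant _ (fun x => K (x, grad w x)) ((C1 * tau + 2 * C3) / tau)) => x y.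
have [cx [cx0 dx gx]] := curves x; have [cy [cy0 dy gy]] := curves y.
have cxM t : `|(cx t).2| <= M by rewrite gx.
have cyM t : `|(cy t).2| <= M by rewrite gy.
have cD : continuous (fun t => `|cy t - cx t|).
  by apply: cts_norm; apply: ctsB; [exact: is_derive1_cts dy|exact: is_derive1_cts dx].
have [|m /= mI hm] := max_compact _ (@compact_itv_le R 0 tau) cD.
  by exists 0; rewrite /= lexx ltW.
have [m0 mtau] := andP mI.
pose d := `|y - x|.
have D0 : `|cy 0 - cx 0| <= (1 + Lg) * d.
  rewrite cx0 cy0 -[_ - _]/(y - x, grad w y - grad w x).
  by apply: le_trans (norm_pair_le _ _) _; rewrite mulrDl mul1r lerD.
have S2 : `|cy m - cx m| <= 2 * (1 + Lg) * d.
  have dd t : is_derive t (1 : R) (fun t => cy t - cx t) (ham_field K (cy t) - ham_field K (cx t)).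
    have h := is_deriveB (dy t) (dx t); exact: h.
  have := @lipschitz_curve _ _ _ _ (L * `|cy m - cx m|) 0 m m0 (fun r _ => dd r).
  rewrite subr0 => /(_ _)H.
  have h1 : `|(cy m - cx m) - (cy 0 - cx 0)| <= L * `|cy m - cx m| * m.
    apply: H => r /andP[r0 rm]; apply: le_trans (hL _ _ (cyM r) (cxM r)).2 _.
    by rewrite ler_wpM2l ?(ltW L0)//; apply: hm; rewrite /= r0 (le_trans rm).
  have h2 : L * `|cy m - cx m| * m <= `|cy m - cx m| / 2.
    by rewrite mulrAC [X in _ <= X]mulrC -tauE ler_wpM2r// ler_wpM2l// ltW.
  have h3 : `|cy m - cx m| <= `|(cy m - cx m) - (cy 0 - cx 0)| + `|cy 0 - cx 0|.
    by rewrite -{1}(subrK (cy 0 - cx 0) (cy m - cx m)) ler_normD.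
  by move: h1 h2 h3 D0; rewrite -mulrA; clear; lra.
have dist t : 0 <= t <= tau -> `|cy t - cx t| ^+ 2 <= A * d ^+ 2.
  move=> tI; rewrite AE -exprMn ler_pXn2r// ?nnegrE//; last first.
    exact: mulr_ge0 (mulr_ge0 (ler0n _ _) (addr_ge0 ler01 (ltW Lg0))) (normr_ge0 _).
  by apply: le_trans S2; exact: hm.
pose g := K (y, grad w y) - K (x, grad w x).
(* The first-order remainder of [w] between the two base points, of order [d^2]. Its time derivative
   equals the energy gap [g] up to order [d^2], so integration over [tau] bounds [g] by a multiple
   of [d^2]. *)
pose Phi t := w (cy t).1 - w (cx t).1 - dotp (cx t).2 ((cy t).1 - (cx t).1).
pose dPhi t := dotp ((cy t).2 - (cx t).2) (Dp K (cy t)) + dotp (Dx K (cx t)) ((cy t).1 - (cx t).1).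
have hPhi t : is_derive t (1 : R) (fun t => Phi t - g * t) (dPhi t - g).
  have y1 := is_derive_fst (dy t); have x1 := is_derive_fst (dx t); have x2 := is_derive_snd (dx t).
  have d1 := is_deriveB (is_derive_curve cw1 y1) (is_derive_curve cw1 x1).
  have d2 := is_derive_dotp x2 (is_deriveB y1 x1).
  have d3 : is_derive t (1 : R) (fun t => g * t) g by apply: is_derive_eq; exact: mulr1.
  apply: (is_derive_eq (is_deriveB (is_deriveB d1 d2) d3)).
  rewrite !derive_grad// -gx -gy /dPhi/= (dotpNl (Dx _ _)) (dotpDr (cx t).2) (dotpNr (cx t).2) (dotpDl (cy t).2) (dotpNl (cx t).2).
  move: (dotp (cy t).2 _) (dotp (cx t).2 _) (dotp (cx t).2 _) (dotp (Dx _ _) _); clear; move=> *; ring.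
have bPhi t : 0 <= t <= tau -> `|dPhi t - g| <= C1 * d ^+ 2.
  move=> tI.
  have gE : g = K (cy t) - K (cx t).
    by rewrite (ham_curve_energy (C2_C1 cK) dy) (ham_curve_energy (C2_C1 cK) dx) cx0 cy0.
  have := hT (cx t) (cy t) (cxM t) (cyM t); rewrite derive_Dx_Dp; last exact: C2_C1.
  rewrite -gE -[(_ - _).1]/((cy t).1 - (cx t).1) -[(_ - _).2]/((cy t).2 - (cx t).2) => hE.
  have [_ hX] := hL (cy t) (cx t) (cyM t) (cxM t).
  have h1 : `|Dp K (cy t) - Dp K (cx t)| <= L * `|cy t - cx t|.
    by apply: le_trans hX; exact: (norm_fst_le (ham_field K (cy t) - ham_field K (cx t))).
  have h2 : `|(cy t).2 - (cx t).2| <= `|cy t - cx t| by exact: (norm_snd_le (cy t - cx t)).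
  have h3 : `|dotp ((cy t).2 - (cx t).2) (Dp K (cy t) - Dp K (cx t))| <= n%:R * L * `|cy t - cx t| ^+ 2.
    apply: le_trans (dotp_le_norm _ _) _; rewrite -mulrA ler_wpM2l// expr2 mulrCA; exact: ler_pM.
  have -> : dPhi t - g = dotp ((cy t).2 - (cx t).2) (Dp K (cy t) - Dp K (cx t))
      - (g - (dotp (Dx K (cx t)) ((cy t).1 - (cx t).1) + dotp (Dp K (cx t)) ((cy t).2 - (cx t).2))).
    by rewrite /dPhi (dotpDr _ (Dp K (cy t))) dotpNr (dotpC (Dp K (cx t))); move: (dotp _ _) (dotp _ _) (dotp _ _) => *; ring.
  apply: le_trans (ler_normB _ _) (le_trans (lerD h3 hE) _).
  rewrite -mulrDl /C1 -mulrA ler_wpM2l ?dist//.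
  by rewrite addr_ge0 ?(ltW T0)// mulr_ge0// ltW.
have ePhi t : 0 <= t <= tau -> `|Phi t| <= C3 * d ^+ 2.
  move=> tI; have [s /andP[s0 s1]] := C1_mvt_segment (cx t).1 ((cy t).1 - (cx t).1) cw1.
  rewrite subrKC derive_grad// => hw; rewrite /Phi hw gx -dotpNl -dotpDl.
  apply: le_trans (dotp_le_norm _ _) _; rewrite /C3 -!mulrA ler_wpM2l//.
  apply: (@le_trans _ _ (Lg * `|(cy t).1 - (cx t).1| ^+ 2)).
    rewrite expr2 mulrA ler_wpM2r//; apply: le_trans (hg _ _) _; rewrite ler_wpM2l ?(ltW Lg0)//.
    by rewrite addrAC subrr add0r normrZ (ger0_norm s0) ler_piMl.
  rewrite ler_wpM2l ?(ltW Lg0)//; apply: le_trans _ (dist t tI); rewrite ler_pXn2r ?nnegrE//.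
  exact: (norm_fst_le (cy t - cx t)).
have := mvt_abs (ltW tau0) (fun t _ => hPhi t) bPhi.
rewrite mulr0 !subr0 => h.
have t0I : 0 <= (0 : R) <= tau by apply/andP; split => //; exact: ltW.
have ttI : 0 <= tau <= tau by apply/andP; split => //; exact: ltW.
have e0 := ePhi 0 t0I; have e1 := ePhi tau ttI.
rewrite -[K _ - K _]/g -/d mulrAC ler_pdivlMr// -(gtr0_norm tau0) -normrM.
have : `|g * tau| <= `|Phi tau - g * tau - Phi 0| + (`|Phi tau| + `|Phi 0|).
  rewrite [X in `|X| <= _](_ : _ = - (Phi tau - g * tau - Phi 0) + (Phi tau - Phi 0)); last by ring.
  apply: le_trans (ler_normD _ _) _; rewrite normrN; apply: lerD => //.
  exact: ler_normB.
move: h e0 e1; rewrite (gtr0_norm tau0).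
move: `|g * tau| `|Phi tau| `|Phi 0| `|_ - _| => a1 a2 a3 a4; clear.
by rewrite mulrDl; move: (d ^+ 2) => dd h1 h2 h3 h4; lra.
Qed.

End GraphEnergy.

(** * The two implications and the semigroups *)

Section Conclusion.
Context {R : realType} {n : nat}.
Notation P := ('rV[R]_n * 'rV[R]_n)%type.
Implicit Types (K : P -> R) (w : 'rV[R]_n -> R).

Lemma tame_level_bounded K (c : R) : tame K -> exists M : R, forall z, `|K z - c| <= 1 -> `|z.2| <= M.
Proof.
move=> [_ _ co _]; have [M hM] := co (c + 1); exists M => -[x p] h; rewrite leNgt; apply/negP => /(hM x).
by move: (ler_normlW h); clear; move: (K (x, p)) => k h1 h2; lra.
Qed.

(** Invariance speaks of the curve chosen by [flow]. Bounded energy levels guarantee that this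
    choice is an actual Hamiltonian curve, to which [graph_energy_constant] applies. *)
Lemma invariant_energy_constant K w : C2 K -> x_periodic K ->
  (forall c : R, exists M : R, forall z, `|K z - c| <= 1 -> `|z.2| <= M) ->
  C11 w -> Zn_periodic w -> flow_invariant (ham_field K) (grad_graph w) ->
  forall x, K (x, grad w x) = K (0, grad w 0).
Proof.
move=> cK pK lv cw pw inv x; apply: graph_energy_constant => // {}x.
have ex := ham_curve_exists cK pK (lv (K (x, grad w x))).
have [f0 df] := flow_curve ex.
exists (flow (ham_field K) ^~ (x, grad w x)); split=> // t.
have [|y _ <-//] := inv t (flow (ham_field K) t (x, grad w x)).
by exists (x, grad w x) => //; exists x.
Qed.

Lemma classical_multitime (H G : P -> R) w (cH cG : R) : C1 w -> Zn_periodic w ->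
  (forall x, H (x, grad w x) = cH) -> (forall x, G (x, grad w x) = cG) ->
  exists u, multitime_solution H G w u.
Proof.
move=> cw pw hH hG; pose psi (t : R * R) := - (cH * t.1) - cG * t.2.
have c1 : continuous (fun t : R * R => t.1) by apply: cts_fst; exact: cts_id.
have c2 : continuous (fun t : R * R => t.2) by apply: cts_snd; exact: cts_id.
have cpsi : continuous psi.
  apply: ctsB; last by apply: ctsM; [exact: cts_cst|exact: c2].
  by apply: ctsN; apply: ctsM; [exact: cts_cst|exact: c1].
have dpsi (a b : R) (t : R * R) : is_derive t ((a, b) : R * R) psi (- (cH * a + cG * b)).
  apply/is_derive_eps => e e0; exists 1 => // h _.
  rewrite (_ : _ - _ - _ = 0) ?normr0 ?mulr_ge0// ?ltW//.
  by rewrite /psi -[(t + _).1]/(t.1 + h * a) -[(t + _).2]/(t.2 + h * b) -[h *: _]/(h * _); ring.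
exists (fun z => w z.2 + psi z.1); split.
- by move=> t _ x k /=; rewrite pw.
- apply: continuous_subspaceT; apply: ctsD; last by apply: (cts_comp cpsi); apply: cts_fst; exact: cts_id.
  by apply: (cts_comp (C1_cts cw)); apply: cts_snd; exact: cts_id.
- apply: (classical_solution open_quadrant cw pw hH cpsi) => t.
  by have := dpsi 1 0 t; rewrite mulr1 mulr0 addr0; exact.
- apply: (classical_solution open_quadrant cw pw hG cpsi) => t.
  by have := dpsi 0 1 t; rewrite mulr1 mulr0 add0r; exact.
- by move=> x; rewrite /psi/= !mulr0 oppr0 !addr0.
Qed.

(** After the first semigroup the datum has changed by a constant only: it has the same gradient, so
    the second semigroup again acts on a datum of constant energy. *)
Lemma semigroup_comp (H G : P -> R) w (cH cG s t : R) : C1 w -> Zn_periodic w -> lipschitz w ->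
  (forall x, H (x, grad w x) = cH) -> (forall x, G (x, grad w x) = cG) -> 0 <= s -> 0 <= t ->
  semigroup H t (semigroup G s w) = fun x => w x - cG * s - cH * t.
Proof.
move=> cw pw lw hH hG s0 t0; rewrite (semigroup_classical cw pw lw hG s0).
have cw' : C1 (fun x => w x - cG * s) by exact: (C1D cw (C1_cst _ (- (cG * s)))).
have pw' : Zn_periodic (fun x => w x - cG * s) by move=> x k; rewrite pw.
have lw' : lipschitz (fun x => w x - cG * s).
  have [k k0 hk] := lipschitz_onE lw; apply: (@lipschitz_onI _ _ _ _ _ k) => x y _ _.
  by rewrite opprD addrACA subrr addr0; exact: hk.
have hH' x : H (x, grad (fun y => w y - cG * s) x) = cH by rewrite grad_addC.
by rewrite (semigroup_classical cw' pw' lw' hH' t0).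
Qed.

End Conclusion.

Theorem theorem2p1 (R : realType) (n : nat)
    (H G : 'rV[R]_n * 'rV[R]_n -> R)
    (hH : hamiltonian H) (hG : hamiltonian G)
    (hHG : forall z, poisson H G z = 0)
    (tH : tonelli H) (tG : tonelli (fun z => - G z))
    (u0 : 'rV[R]_n -> R) (pu0 : Zn_periodic u0) (lu0 : lipschitz u0) :
  ((exists u : (R * R) * 'rV[R]_n -> R, multitime_solution H G u0 u) <->
   [/\ C11 u0,
       flow_invariant (ham_field H) (grad_graph u0) &
       flow_invariant (ham_field G) (grad_graph u0)]) /\
  ((exists u : (R * R) * 'rV[R]_n -> R, multitime_solution H G u0 u) ->
   exists cH cG : R,
     (forall x, H (x, grad u0 x) = cH /\ G (x, grad u0 x) = cG) /\
     (forall s t : R, 0 < s -> 0 < t -> forall x,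
        semigroup H t (semigroup G s u0) x = semigroup G s (semigroup H t u0) x
        /\ semigroup G s (semigroup H t u0) x = u0 x - t * cH - s * cG)).
Proof.
have [cH pH] := hH; have [cG pG] := hG.
have taH : tame H by exact: tonelli_tame.
have taG : tame (fun z => - G z) by apply: tonelli_tame => // p x k; rewrite pG.
have C2H : C2 H by case: tH.
have C2G : C2 G.
  by have [/C2N + _ _] := tG; rewrite (_ : (fun _ => - - _) = G)//; apply/funext => z; rewrite opprK.
have lH c := tame_level_bounded c taH.
have lG (c : R) : exists M : R, forall z, `|G z - c| <= 1 -> `|z.2| <= M.
  have [M hM] := tame_level_bounded (- c) taG; exists M => z h; apply: hM.
  by rewrite -opprD normrN.
(* [flip G] is the Tonelli Hamiltonian [- G] with reversed momentum, hence tame by [tame_flip]. *)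
have rigid u : multitime_solution H G u0 u ->
    exists c1 c2 : R, C11 u0 /\ forall x, H (x, grad u0 x) = c1 /\ G (x, grad u0 x) = c2.
  by apply: multitime_rigid => //; exact: (tame_flip taG).
split; [split=> [[u /rigid[c1 [c2 [cu hc]]]]|[cu iH iG]]|].
- by split=> //; [apply: (graph_invariant C2H pH (lH c1) cu)|apply: (graph_invariant C2G pG (lG c2) cu)] => x;
    have [] := hc x.
- have [cw _] := cu.
  exact: (classical_multitime cw pu0 (invariant_energy_constant C2H pH lH cu pu0 iH)
    (invariant_energy_constant C2G pG lG cu pu0 iG)).
move=> [u /rigid[c1 [c2 [[cw _] hc]]]]; exists c1, c2; split=> // s t s0 t0 x.
have h1 y : H (y, grad u0 y) = c1 by have [] := hc y.
have h2 y : G (y, grad u0 y) = c2 by have [] := hc y.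
rewrite (semigroup_comp cw pu0 lu0 h1 h2 (ltW s0) (ltW t0)).
rewrite (semigroup_comp cw pu0 lu0 h2 h1 (ltW t0) (ltW s0)).
by split; ring.
Qed.
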